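(* Fix $\alpha>0$ and $0<T<\infty$. Let $y_0\in BV(\mathbb R)$ with $y_0\ge1$, and let the discrete initial data be the cell averages $y_{0,i}=\frac1{\Delta z}\int_{z_{i-1/2}}^{z_{i+1/2}}y_0(z)\,dz$. Let $\Delta t\to0$ and $\Delta z\to0$ in such a way that the CFL condition $0\le\lambda\sup_{w\ge1}W'(w)\le1$ always holds, and assume that $|\partial_z w_{\Delta t,\alpha}(z,0)|\le M$ for a constant $M$ independent of $\Delta t$ (possibly depending on $\alpha$). Then there exists a Lipschitz continuous function $w_\alpha:\mathbb R\times[0,T]\to\mathbb R$ such that $w_{\Delta t,\alpha}\to w_\alpha$ in $C(K\times[0,T])$ for every compact $K\subset\mathbb R$, and $w_\alpha$ is a weak solution of $$\partial_t w_\alpha=\partial_z\overline{W(w_\alpha)},\quad z\in\mathbb R,\ 0<t\le T,\qquad w_\alpha(z,0)=\overline{y_0}(z),$$ i.e. $$\int_0^T\!\!\int_{\mathbb R} w_\alpha\,\partial_t\varphi-\overline{W(w_\alpha)}\,\partial_z\varphi\,dz\,dt=\int_{\mathbb R}w_\alpha(z,T)\varphi(z,T)-w_\alpha(z,0)\varphi(z,0)\,dz$$ for all $\varphi\in C_0^\infty(\mathbb R\times[0,T])$. Moreover, such a Lipschitz continuous weak solution is uniquely determined by its initial data.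
   Context: Kernel: $\Phi:[0,\infty)\to[0,\infty)$ is non-increasing with $\int_0^\infty\Phi(z)\,dz=1$ and $\int_0^\infty z\Phi(z)\,dz<\infty$; for $\alpha>0$, $\Phi_\alpha(z)=\alpha^{-1}\Phi(z/\alpha)$, and for bounded measurable $h:\mathbb R\to\mathbb R$ the averaging operator is $\overline h(z)=\int_0^\infty\Phi_\alpha(\zeta)h(z+\zeta)\,d\zeta$. Flux: $V\in C^1([0,\infty))$ is non-increasing and $W:[1,\infty)\to\mathbb R$, $W(w)=V(1/w)$. Discretization: $\Delta z>0$, $\Delta t>0$, $\lambda=\Delta t/\Delta z$, $z_j=(j-\tfrac12)\Delta z$ for $j\in\tfrac12\mathbb Z$, $t^n=n\Delta t$, and for integers $j\ge i$, $\Phi_{ij\alpha}=\int_{z_{j-1/2}}^{z_{j+1/2}}\Phi_\alpha(\zeta-z_{i-1/2})\,d\zeta$. The scheme: $w^0_i=\sum_{j\ge i}\Phi_{ij\alpha}y_{0,j}$ and $w^{n+1}_i=w^n_i+\lambda(\overline W^{\,n}_{i+1/2}-\overline W^{\,n}_{i-1/2})$ for $n\ge0$, where $\overline W^{\,n}_{i-1/2}=\sum_{j\ge i}\Phi_{ij\alpha}W(w^n_j)$. $w_{\Delta t,\alpha}(z,t)$ denotes the bilinear interpolation of the points $(z_i,t^n,w^n_i)$, $i\in\mathbb Z$, $n\ge0$. *)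

(* Defs.v *)
From Stdlib Require Import Reals Rtopology List.
From Coquelicot Require Import Coquelicot.
Open Scope R_scope.

Definition nonincr_nonneg (f : R -> R) : Prop :=
  forall x y, 0 <= x -> x <= y -> f y <= f x.

Definition kernel_hyp (Phi : R -> R) : Prop :=
  (forall z, 0 <= z -> 0 <= Phi z) /\
  nonincr_nonneg Phi /\
  is_RInt_gen Phi (at_point 0) (Rbar_locally p_infty) 1 /\
  ex_RInt_gen (fun z => z * Phi z) (at_point 0) (Rbar_locally p_infty).

Definition Phia (Phi : R -> R) (alpha : R) (z : R) : R := / alpha * Phi (z / alpha).

Definition avg (Phi : R -> R) (alpha : R) (h : R -> R) (z : R) : R :=
  RInt_gen (fun zeta => Phia Phi alpha zeta * h (z + zeta))
           (at_point 0) (Rbar_locally p_infty).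

Definition C1_nonneg (V : R -> R) : Prop :=
  exists dV : R -> R,
    (forall x, 0 < x -> is_derive V x (dV x)) /\
    filterlim (fun h => (V h - V 0) / h) (at_right 0) (locally (dV 0)) /\
    (forall x, 0 <= x ->
       filterlim dV (within (fun y => 0 <= y) (locally x)) (locally (dV x))).

Definition Wf (V : R -> R) (w : R) : R := V (/ w).

Definition BV (f : R -> R) : Prop :=
  exists C, forall (x : nat -> R) (n : nat),
    (forall k, (k <= n)%nat -> x k <= x (S k)) ->
    sum_f_R0 (fun k => Rabs (f (x (S k)) - f (x k))) n <= C.

(* z_j = (j - 1/2) dz for half-integer j (passed as a real) *)
Definition zpt (dz : R) (j : R) : R := (j - / 2) * dz.

Definition Phi_ij (Phi : R -> R) (alpha dz : R) (i j : Z) : R :=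
  RInt (fun zeta => Phia Phi alpha (zeta - zpt dz (IZR i - / 2)))
       (zpt dz (IZR j - / 2)) (zpt dz (IZR j + / 2)).

Definition y0cell (y0 : R -> R) (dz : R) (i : Z) : R :=
  / dz * RInt y0 (zpt dz (IZR i - / 2)) (zpt dz (IZR i + / 2)).

Definition sum_ge (Phi : R -> R) (alpha dz : R) (u : Z -> R) (i : Z) : R :=
  Series (fun k : nat => Phi_ij Phi alpha dz i (i + Z.of_nat k) * u (i + Z.of_nat k)%Z).

Fixpoint wsch (Phi V y0 : R -> R) (alpha dt dz : R) (n : nat) : Z -> R :=
  match n with
  | O => fun i => sum_ge Phi alpha dz (y0cell y0 dz) i
  | S m =>
      let p := wsch Phi V y0 alpha dt dz m in
      let Wb := sum_ge Phi alpha dz (fun j => Wf V (p j)) in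
      (* Wb i = \overline W^m_{i-1/2} *)
      fun i => p i + (dt / dz) * (Wb (i + 1)%Z - Wb i)
  end.

Definition winterp (Phi V y0 : R -> R) (alpha dt dz : R) (z t : R) : R :=
  let n := Z.to_nat (Int_part (t / dt)) in
  let i := Int_part (z / dz + / 2) in
  let th := (z - zpt dz (IZR i)) / dz in
  let s := (t - INR n * dt) / dt in
  let w := wsch Phi V y0 alpha dt dz in
  (1 - th) * (1 - s) * w n i + th * (1 - s) * w n (i + 1)%Z
  + (1 - th) * s * w (S n) i + th * s * w (S n) (i + 1)%Z.

Definition lipschitz_strip (T : R) (w : R -> R -> R) : Prop :=
  exists L, forall z z' t t', 0 <= t <= T -> 0 <= t' <= T ->
    Rabs (w z t - w z' t') <= L * (Rabs (z - z') + Rabs (t - t')).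

Definition Dz (f : R -> R -> R) : R -> R -> R := fun z t => Derive (fun x => f x t) z.
Definition Dt (f : R -> R -> R) : R -> R -> R := fun z t => Derive (fun s => f z s) t.

Fixpoint pderiv (l : list bool) (f : R -> R -> R) : R -> R -> R :=
  match l with
  | nil => f
  | b :: l' => if b then Dz (pderiv l' f) else Dt (pderiv l' f)
  end.

Definition smooth2 (f : R -> R -> R) : Prop :=
  forall (l : list bool) (z t : R),
    continuous (fun p : R * R => pderiv l f (fst p) (snd p)) (z, t) /\
    ex_derive (fun x => pderiv l f x t) z /\
    ex_derive (fun s => pderiv l f z s) t.

Definition test_fun (T : R) (phi : R -> R -> R) : Prop :=
  smooth2 phi /\
  exists Rs, forall z t, 0 <= t <= T -> Rs < Rabs z -> phi z t = 0.

Definition intR (f : R -> R) : R :=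
  RInt_gen f (Rbar_locally m_infty) (Rbar_locally p_infty).

Definition weak_sol (Phi V : R -> R) (alpha T : R) (w : R -> R -> R) : Prop :=
  forall phi, test_fun T phi ->
    RInt (fun t => intR (fun z =>
            w z t * Dt phi z t
            - avg Phi alpha (fun x => Wf V (w x t)) z * Dz phi z t)) 0 T
    = intR (fun z => w z T * phi z T - w z 0 * phi z 0).

(* Main.v *)
Require Import Defs.
From Stdlib Require Import Reals Rtopology List ZArith Lra Lia FunctionalExtensionality.
From Coquelicot Require Import Coquelicot.
Open Scope R_scope.

(** For a non-increasing kernel, translating the average of [h] by [d] changes it
    by at most [2 Phi_alpha(0) d sup|h|]. Applied to [h(. + s) - h], this bounds
    the second differences of the average, so the average of a Lipschitz function is
    differentiable, and [h |-> d/dz (average of h)] is bounded in the sup norm.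
    Hence the nonlocal equation is an ODE with Lipschitz right-hand side: it has
    a solution [w] by Picard iteration, in a norm weighted by [exp (2 C t)]. The
    scheme is the explicit Euler method for this ODE, up to a consistency error of
    order [dz] per unit time, so it converges to [w] uniformly in [z], along the
    whole sequence; the CFL condition is only needed to keep the scheme above 1.
    A Lipschitz weak solution, tested with products of bumps in [z] and [t],
    satisfies the ODE integrated against every bump in [z]; the difference of
    two solutions can then be halved repeatedly in the weighted norm, so it
    vanishes. *)

(** * Riemann integrability of monotone and BV functions *)

(* [ring] looks up the type of the left-hand side, which for values of [RInt]
   and [scal] is a Coquelicot structure that is only convertible to [R]. *)
Ltac ring_R := match goal with |- @eq _ ?a ?b => change (@eq R a b); apply Rminus_diag_uniq; ring end.

(** All integrals are Riemann integrals, while the kernel is only monotone, [y0] only BV, and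
    functions sampled on the grid are steps. The class [DM] of differences of monotone functions
    contains all of them; composition with the increasing grid rounding stays inside it, and a
    product of two members is integrable. The flux is controlled only on [1, oo), so the ODE is
    solved with the flux truncated at 1. Being bounded and globally Lipschitz, the truncated flux
    makes all averages meaningful without an upper bound on the solution. That the solution stays
    above 1 is not read off from the ODE: it is inherited from the scheme, whose values are at least
    1 and converge to it. Only then is the truncated equation the stated one. Lipschitz bounds and
    derivatives in time are convenient on the whole line, so solutions are extended beyond [0, T]:
    by constants for the Picard iteration, linearly for the weak form, and by clamping the time for
    uniqueness. *)

Definition incr (u : R -> R) : Prop := forall x y, x <= y -> u x <= u y.

(** Superlevel sets of a monotone function are half-lines, so on [a, b] the indicator jumps at most
    once, at the supremum [m] of the points where [u] is below [c]; its value at [m] does not affect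
    integrability. *)
Lemma ex_RInt_threshold u c a b :
  incr u -> ex_RInt (fun x => if Rle_dec c (u x) then 1 else 0) a b.
Proof.
  intros Hu.
  assert (Hab : forall a b, a <= b ->
    ex_RInt (fun x => if Rle_dec c (u x) then 1 else 0) a b).
  { clear a b. intros a b Hab.
    destruct (Rle_dec c (u a)) as [Ha|Ha].
    { apply (ex_RInt_ext (fun _ => 1)); [|apply ex_RInt_const].
      intros x Hx. rewrite Rmin_left, Rmax_right in Hx by lra.
      destruct (Rle_dec c (u x)) as [|n]; [easy|].
      exfalso; apply n. pose proof (Hu a x); lra. }
    set (E := fun x => a <= x <= b /\ u x < c).
    destruct (completeness E) as [m [Hm1 Hm2]].
    { exists b. intros x [Hx _]; lra. }
    { exists a. split; lra. }
    assert (am : a <= m) by (apply Hm1; split; lra).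
    assert (mb : m <= b) by (apply Hm2; intros x [Hx _]; lra).
    apply (ex_RInt_Chasles _ a m b).
    - apply (ex_RInt_ext (fun _ => 0)); [|apply ex_RInt_const].
      intros x Hx. rewrite Rmin_left, Rmax_right in Hx by lra.
      destruct (Rle_dec c (u x)) as [i|]; [|easy].
      exfalso. assert (m <= x); [|lra].
      apply Hm2. intros y [Hy Hy2].
      destruct (Rle_dec y x); [lra|]. pose proof (Hu x y); lra.
    - apply (ex_RInt_ext (fun _ => 1)); [|apply ex_RInt_const].
      intros x Hx. rewrite Rmin_left, Rmax_right in Hx by lra.
      destruct (Rle_dec c (u x)) as [|n]; [easy|].
      exfalso. assert (x <= m); [|lra]. apply Hm1. split; lra. }
  destruct (Rle_dec a b).
  - now apply Hab.
  - apply ex_RInt_swap, Hab; lra.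
Qed.

(** Rounds a non-negative [y] down to a multiple of [d], capped at [(n + 1) * d]. It is written as a
    sum of indicators so that integrability reduces to [ex_RInt_threshold]. *)
Definition quantize (d : R) (n : nat) (y : R) : R :=
  d * sum_f_R0 (fun j => if Rle_dec (INR (S j) * d) y then 1 else 0) n.

Lemma quantize_close d n y :
  0 < d -> 0 <= y < INR (S (S n)) * d -> Rabs (quantize d n y - y) <= d.
Proof.
  intros Hd Hy. unfold quantize.
  (* The induction on [n] needs a second fact: once [y] passes the top level, every indicator is
     1. *)
  assert (H : (INR (S n) * d <= y ->
      sum_f_R0 (fun j => if Rle_dec (INR (S j) * d) y then 1 else 0) n = INR (S n)) /\
    (y < INR (S (S n)) * d ->
      Rabs (d * sum_f_R0 (fun j => if Rle_dec (INR (S j) * d) y then 1 else 0) n - y) <= d)).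
  { destruct Hy as [Hy _]. induction n as [|n [IH1 IH2]].
    - simpl. split; intros H; destruct (Rle_dec (1 * d) y); try lra; apply Rabs_le; lra.
    - cbn [sum_f_R0].
      assert (E1 : INR (S (S n)) = INR (S n) + 1) by apply S_INR.
      assert (E2 : INR (S (S (S n))) = INR (S (S n)) + 1) by apply S_INR.
      split; intros H.
      + rewrite IH1 by nra. destruct (Rle_dec (INR (S (S n)) * d) y); [lra|easy].
      + destruct (Rle_dec (INR (S (S n)) * d) y) as [i|i].
        * rewrite IH1 by nra. apply Rabs_le. nra.
        * rewrite Rplus_0_r. apply IH2. lra. }
  apply H, Hy.
Qed.

Lemma ex_RInt_quantize d n u a b : incr u -> ex_RInt (fun x => quantize d n (u x)) a b.
Proof.
  intros Hu. apply (ex_RInt_scal (V := R_NormedModule)).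
  induction n as [|n IH]; cbn [sum_f_R0].
  - now apply ex_RInt_threshold.
  - apply (ex_RInt_plus (V := R_NormedModule)); [exact IH|now apply ex_RInt_threshold].
Qed.

(* A monotone function is a uniform limit of its quantizations, whose level
   sets are intervals. *)
Lemma ex_RInt_incr u a b : incr u -> ex_RInt u a b.
Proof.
  intros Hu.
  assert (Hab : forall a b, a <= b -> ex_RInt u a b).
  { clear a b. intros a b Hab.
    (* The limit theorem for integrals asks for uniform convergence on the whole line, so [u] is
       frozen outside [a, b]; subtracting [u a] puts its range inside [0, D]. *)
    set (v := fun x => u (Rmax a (Rmin b x)) - u a).
    assert (Hv : incr v).
    { intros x y Hxy. unfold v. apply Rplus_le_compat_r, Hu.
      apply Rle_max_compat_l, Rle_min_compat_l, Hxy. }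
    set (D := u b - u a).
    assert (HD : 0 <= D) by (unfold D; pose proof (Hu a b); lra).
    assert (Hv0 : forall x, 0 <= v x <= D).
    { intros x. unfold v, D. split.
      - pose proof (Hu a (Rmax a (Rmin b x)) (Rmax_l _ _)). lra.
      - assert (Rmax a (Rmin b x) <= b) by (apply Rmax_lub; [lra|apply Rmin_l]).
        pose proof (Hu _ _ H). lra. }
    (* The 1 keeps the step positive when [u] is constant on [a, b]; n + 2 steps then exceed [D], as
       [quantize_close] requires. *)
    set (d := fun n : nat => (D + 1) / INR (S n)).
    destruct (filterlim_RInt (V := R_CompleteNormedModule)
       (fun n x => quantize (d n) n (v x)) a b eventually eventually_filter v
       (fun n => RInt (fun x => quantize (d n) n (v x)) a b)) as [I [_ HI]].
    { intros n. apply (RInt_correct (V := R_CompleteNormedModule)).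
      now apply ex_RInt_quantize. }
    { intros P [eps HP].
      destruct (nfloor_ex ((D + 1) / eps)) as [N HN].
      { apply Rlt_le, Rdiv_lt_0_compat; [lra|apply cond_pos]. }
      exists N. intros n Hn. apply HP. intros x.
      assert (Hp : 0 < INR (S n)) by (apply lt_0_INR; lia).
      assert (Hd : 0 < d n) by (apply Rdiv_lt_0_compat; lra).
      apply Rle_lt_trans with (d n).
      - apply quantize_close; [easy|]. split; [apply Hv0|].
        apply Rle_lt_trans with D; [apply Hv0|].
        rewrite (S_INR (S n)). unfold d. unfold d in Hd.
        replace ((INR (S n) + 1) * ((D + 1) / INR (S n)))
          with (D + 1 + (D + 1) / INR (S n)) by (field; lra). lra.
      - unfold d. apply Rlt_div_l; [easy|].
        assert (HN2 : (D + 1) / eps < INR (S n)).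
        { apply Rlt_le_trans with (INR N + 1); [easy|].
          rewrite <- S_INR. apply le_INR. lia. }
        apply Rlt_div_l in HN2; [lra|apply cond_pos]. }
    apply (ex_RInt_ext (fun x => v x + u a)).
    - intros x Hx. rewrite Rmin_left, Rmax_right in Hx by lra. unfold v.
      rewrite Rmin_right, Rmax_right by lra. ring_R.
    - apply (ex_RInt_plus (V := R_NormedModule)); [now exists I|apply ex_RInt_const]. }
  destruct (Rle_dec a b).
  - now apply Hab.
  - apply ex_RInt_swap, Hab; lra.
Qed.

Definition Lip (L : R) (h : R -> R) : Prop :=
  forall x y, Rabs (h x - h y) <= L * Rabs (x - y).

Definition bounded_by (H : R) (h : R -> R) : Prop := forall x, Rabs (h x) <= H.

Lemma bounded_by_nonneg H h : bounded_by H h -> 0 <= H.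
Proof. intros HH. pose proof (HH 0). pose proof (Rabs_pos (h 0)). lra. Qed.

(* A class containing both BV and Lipschitz functions, all of whose products are
   Riemann integrable. *)
Definition DM (f : R -> R) : Prop :=
  exists u v, incr u /\ incr v /\ forall x, f x = u x - v x.

Lemma ex_RInt_DM f a b : DM f -> ex_RInt f a b.
Proof.
  intros [u [v [Hu [Hv H]]]].
  apply (ex_RInt_ext (fun x => u x - v x)); [now intros; rewrite H|].
  apply (ex_RInt_minus (V := R_NormedModule)); now apply ex_RInt_incr.
Qed.

Lemma DM_incr u : incr u -> DM u.
Proof.
  intros Hu. exists u, (fun _ => 0). repeat split; [easy|intros x y _; lra|].
  intros; ring.
Qed.

Lemma DM_opp f : DM f -> DM (fun x => - f x).
Proof.
  intros [u [v [Hu [Hv H]]]]. exists v, u. repeat split; [easy..|].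
  intros x; rewrite H; ring.
Qed.

Lemma DM_plus f g : DM f -> DM g -> DM (fun x => f x + g x).
Proof.
  intros [u [v [Hu [Hv H]]]] [u' [v' [Hu' [Hv' H']]]].
  exists (fun x => u x + u' x), (fun x => v x + v' x). repeat split.
  - intros x y Hxy. specialize (Hu x y Hxy). specialize (Hu' x y Hxy). lra.
  - intros x y Hxy. specialize (Hv x y Hxy). specialize (Hv' x y Hxy). lra.
  - intros x; rewrite H, H'; ring.
Qed.

Lemma DM_minus f g : DM f -> DM g -> DM (fun x => f x - g x).
Proof. intros Hf Hg. apply DM_plus; [easy|now apply DM_opp]. Qed.

Lemma DM_comp f s : DM f -> incr s -> DM (fun x => f (s x)).
Proof.
  intros [u [v [Hu [Hv H]]]] Hs.
  exists (fun x => u (s x)), (fun x => v (s x)). repeat split.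
  - intros x y Hxy. now apply Hu, Hs.
  - intros x y Hxy. now apply Hv, Hs.
  - intros x; apply H.
Qed.

Lemma DM_shift f z : DM f -> DM (fun x => f (z + x)).
Proof. intros Hf. apply (DM_comp f (fun x => z + x)); [easy|]. intros x y; lra. Qed.

Lemma Lip_nonneg L h : Lip L h -> 0 <= L.
Proof.
  intros H. pose proof (H 1 0) as H1. pose proof (Rabs_pos (h 1 - h 0)).
  replace (1 - 0) with 1 in H1 by ring_R. rewrite Rabs_R1 in H1. lra.
Qed.

Lemma Lip_DM L f : Lip L f -> DM f.
Proof.
  intros H. exists (fun x => f x + L * x), (fun x => L * x).
  assert (HL : 0 <= L) by exact (Lip_nonneg _ _ H).
  repeat split.
  - intros x y Hxy. pose proof (H x y) as H1. apply Rabs_le_between in H1.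
    rewrite (Rabs_left1 (x - y)) in H1 by lra. lra.
  - intros x y Hxy. nra.
  - intros x; ring.
Qed.

(** Jordan decomposition: [v] is the variation of [f] on the half-line up to z, finite because the
    total variation is. Extending a partition that ends before x by the points x and y gives
    [v x + Rabs (f y - f x) <= v y], so both [v] and [v - f] increase. *)
Lemma DM_BV f : BV f -> DM f.
Proof.
  intros [C HC].
  set (E := fun z s => exists (x : nat -> R) n,
    (forall k, (k <= n)%nat -> x k <= x (S k)) /\ x (S n) <= z /\
    s = sum_f_R0 (fun k => Rabs (f (x (S k)) - f (x k))) n).
  assert (HE : forall z, {m | is_lub (E z) m}).
  { intros z. apply completeness.
    - exists C. intros s [x [n [H1 [_ H3]]]]. rewrite H3. now apply HC.
    - exists (sum_f_R0 (fun k => Rabs (f z - f z)) 0), (fun _ => z), 0%nat.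
      repeat split; intros; lra. }
  set (v := fun z => proj1_sig (HE z)).
  assert (Hv : forall x y, x <= y -> v x + Rabs (f y - f x) <= v y).
  { intros x y Hxy. unfold v.
    destruct (HE x) as [vx [H1 H2]]; destruct (HE y) as [vy [H3 H4]]; simpl.
    assert (vx <= vy - Rabs (f y - f x)); [|lra].
    apply H2. intros s [p [n [Hp1 [Hp2 Hp3]]]].
    (* [q] appends [x] and [y] to the n + 2 points of [p]. *)
    set (q := fun k => if (k <=? S n)%nat then p k else if (k =? S (S n))%nat then x else y).
    assert (Hq1 : forall k, (k <= S n)%nat -> q k = p k).
    { intros k Hk. unfold q. now apply Nat.leb_le in Hk as ->. }
    assert (Hq2 : q (S (S n)) = x).
    { unfold q. replace (S (S n) <=? S n)%nat with false by (symmetry; apply Nat.leb_gt; lia).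
      now rewrite Nat.eqb_refl. }
    assert (Hq3 : q (S (S (S n))) = y).
    { unfold q. replace (S (S (S n)) <=? S n)%nat with false by (symmetry; apply Nat.leb_gt; lia).
      replace (S (S (S n)) =? S (S n))%nat with false by (symmetry; apply Nat.eqb_neq; lia).
      reflexivity. }
    assert (Hs : sum_f_R0 (fun k => Rabs (f (q (S k)) - f (q k))) (S (S n)) <= vy).
    { apply H3. exists q, (S (S n)). repeat split.
      - intros k Hk. destruct (Nat.le_gt_cases k n).
        + rewrite !Hq1 by lia. now apply Hp1.
        + assert (Hc : k = S n \/ k = S (S n)) by lia. destruct Hc as [-> | ->].
          * rewrite Hq2, Hq1 by lia. easy.
          * now rewrite Hq2, Hq3.
      - rewrite Hq3; lra. }
    cbn [sum_f_R0] in Hs. rewrite Hq2, Hq3 in Hs.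
    rewrite (sum_eq _ (fun k => Rabs (f (p (S k)) - f (p k)))) in Hs.
    2: { intros k Hk. rewrite !Hq1 by lia. reflexivity. }
    rewrite <- Hp3 in Hs.
    pose proof (Rabs_pos (f x - f (q (S n)))). lra. }
  exists v, (fun x => v x - f x). repeat split.
  - intros x y Hxy. pose proof (Hv x y Hxy). pose proof (Rabs_pos (f y - f x)). lra.
  - intros x y Hxy. pose proof (Hv x y Hxy). pose proof (Rle_abs (f y - f x)). lra.
  - intros; ring.
Qed.

Lemma BV_bounded f : BV f -> exists H, forall x, Rabs (f x) <= H.
Proof.
  intros [C HC]. exists (Rabs (f 0) + C). intros x.
  assert (Hx : Rabs (f x - f 0) <= C).
  { destruct (Rle_dec 0 x).
    - apply (HC (fun k => match k with O => 0 | _ => x end) 0%nat).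
      intros k Hk. replace k with 0%nat by lia. easy.
    - rewrite Rabs_minus_sym.
      apply (HC (fun k => match k with O => x | _ => 0 end) 0%nat).
      intros k Hk. replace k with 0%nat by lia. lra. }
  pose proof (Rabs_triang (f x - f 0) (f 0)) as Ht.
  replace (f x - f 0 + f 0) with (f x) in Ht by ring. lra.
Qed.

(** Products of non-negative increasing functions increase. [clip] makes each monotone part
    non-negative by freezing it left of [a] and subtracting its value at [a]; the constants [c] and
    [d] thus removed are restored by terms linear in [f] and [g]. *)
Lemma ex_RInt_DM_mult f g a b : DM f -> DM g -> ex_RInt (fun x => f x * g x) a b.
Proof.
  intros Hf Hg.
  assert (Hab : forall a b, a <= b -> ex_RInt (fun x => f x * g x) a b).
  { clear a b. intros a b Hab.
    pose proof (ex_RInt_DM f a b Hf) as If. pose proof (ex_RInt_DM g a b Hg) as Ig.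
    destruct Hf as [u [v [Hu [Hv Hf]]]]. destruct Hg as [u' [v' [Hu' [Hv' Hg]]]].
    set (clip := fun (s : R -> R) x => s (Rmax a x) - s a).
    assert (Hc : forall s, incr s -> incr (clip s) /\ forall x, 0 <= clip s x).
    { intros s Hs. unfold clip. split.
      - intros x y Hxy. apply Rplus_le_compat_r, Hs, Rle_max_compat_l, Hxy.
      - intros x. pose proof (Hs a (Rmax a x) (Rmax_l _ _)). lra. }
    assert (Hm : forall s s', incr s -> incr s' ->
      ex_RInt (fun x => clip s x * clip s' x) a b).
    { intros s s' Hs Hs'. apply ex_RInt_incr.
      destruct (Hc s Hs) as [H1 H2]. destruct (Hc s' Hs') as [H3 H4].
      intros x y Hxy. apply Rmult_le_compat; [apply H2|apply H4|now apply H1|now apply H3]. }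
    set (c := u a - v a). set (d := u' a - v' a).
    apply (ex_RInt_ext (fun x =>
      ((clip u x * clip u' x + clip v x * clip v' x)
       - (clip u x * clip v' x + clip v x * clip u' x))
      + (c * g x + d * f x) + (- (c * d)))).
    { intros x Hx. rewrite Rmin_left, Rmax_right in Hx by lra.
      unfold clip, c, d. rewrite Hf, Hg, Rmax_right by lra. ring_R. }
    apply (ex_RInt_plus (V := R_NormedModule)); [apply (ex_RInt_plus (V := R_NormedModule))|].
    - apply (ex_RInt_minus (V := R_NormedModule)); apply (ex_RInt_plus (V := R_NormedModule));
      now apply Hm.
    - apply (ex_RInt_plus (V := R_NormedModule)); now apply (ex_RInt_scal (V := R_NormedModule)).
    - apply ex_RInt_const. }
  destruct (Rle_dec a b).
  - now apply Hab.
  - apply ex_RInt_swap, Hab; lra.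
Qed.

(** * Averages against a non-increasing density *)

Lemma RInt_plus_R f g a b : ex_RInt f a b -> ex_RInt g a b ->
  RInt (fun x => f x + g x) a b = RInt f a b + RInt g a b.
Proof. intros Hf Hg. exact (RInt_plus (V := R_CompleteNormedModule) f g a b Hf Hg). Qed.

Lemma RInt_minus_R f g a b : ex_RInt f a b -> ex_RInt g a b ->
  RInt (fun x => f x - g x) a b = RInt f a b - RInt g a b.
Proof. intros Hf Hg. exact (RInt_minus (V := R_CompleteNormedModule) f g a b Hf Hg). Qed.

Lemma RInt_scal_R f a b c : ex_RInt f a b ->
  RInt (fun x => c * f x) a b = c * RInt f a b.
Proof. intros Hf. exact (RInt_scal (V := R_CompleteNormedModule) f a b c Hf). Qed.

Lemma RInt_Chasles_R f a b c : ex_RInt f a b -> ex_RInt f b c ->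
  RInt f a b + RInt f b c = RInt f a c.
Proof. intros Hf Hg. exact (RInt_Chasles (V := R_CompleteNormedModule) f a b c Hf Hg). Qed.

Lemma RInt_const_R a b c : RInt (fun _ => c) a b = (b - a) * c.
Proof. exact (RInt_const (V := R_CompleteNormedModule) a b c). Qed.

Lemma ex_RInt_minus_R (f g : R -> R) a b : ex_RInt f a b -> ex_RInt g a b ->
  ex_RInt (fun x => f x - g x) a b.
Proof. exact (ex_RInt_minus (V := R_NormedModule) f g a b). Qed.

Lemma ex_RInt_scal_R (f : R -> R) a b c : ex_RInt f a b ->
  ex_RInt (fun x => c * f x) a b.
Proof. exact (ex_RInt_scal (V := R_NormedModule) f a b c). Qed.

Lemma RInt_translate (f : R -> R) v a b : ex_RInt f (a + v) (b + v) ->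
  ex_RInt (fun x => f (x + v)) a b /\ RInt (fun x => f (x + v)) a b = RInt f (a + v) (b + v).
Proof.
  intros H.
  replace (a + v) with (1 * a + v) in H by ring_R.
  replace (b + v) with (1 * b + v) in H by ring_R.
  assert (E : forall x, scal 1 (f (1 * x + v)) = f (x + v)).
  { intros x. unfold scal; simpl; unfold mult; simpl.
    replace (1 * x + v) with (x + v) by ring_R. ring_R. }
  split.
  - apply (ex_RInt_ext (fun x => scal 1 (f (1 * x + v)))); [intros; apply E|].
    exact (ex_RInt_comp_lin (V := R_NormedModule) f 1 v a b H).
  - transitivity (RInt (fun x => scal 1 (f (1 * x + v))) a b).
    { apply RInt_ext; intros; symmetry; apply E. }
    etransitivity; [exact (RInt_comp_lin (V := R_CompleteNormedModule) f 1 v a b H)|].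
    f_equal; ring_R.
Qed.

Lemma abs_RInt_le_fun (f g : R -> R) a b : a <= b -> ex_RInt f a b -> ex_RInt g a b ->
  (forall x, a < x < b -> Rabs (f x) <= g x) -> Rabs (RInt f a b) <= RInt g a b.
Proof.
  intros Hab Hf Hg H. apply Rabs_le. split.
  - replace (- RInt g a b) with (RInt (fun x => -1 * g x) a b)
      by (rewrite RInt_scal_R by easy; ring_R).
    apply RInt_le; [easy|now apply ex_RInt_scal_R|easy|].
    intros x Hx. specialize (H x Hx). apply Rabs_le_between in H. lra.
  - apply RInt_le; [easy..|].
    intros x Hx. specialize (H x Hx). apply Rabs_le_between in H. lra.
Qed.

Lemma is_lim_abs_le F l c M : is_lim F p_infty (Finite l) ->
  (forall b, M <= b -> Rabs (F b) <= c) -> Rabs l <= c.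
Proof.
  intros HF H.
  assert (Hl : forall eps, 0 < eps -> Rabs l < c + eps).
  { intros eps Heps. apply is_lim_spec in HF. simpl in HF.
    destruct (HF (mkposreal eps Heps)) as [N HN]. simpl in HN.
    set (b := Rmax M N + 1).
    assert (M <= b) by (unfold b; pose proof (Rmax_l M N); lra).
    assert (N < b) by (unfold b; pose proof (Rmax_r M N); lra).
    specialize (HN b H1). specialize (H b H0).
    pose proof (Rabs_triang (F b) (l - F b)) as Ht.
    replace (F b + (l - F b)) with l in Ht by ring_R.
    rewrite (Rabs_minus_sym l) in Ht. lra. }
  destruct (Rle_dec (Rabs l) c) as [|n]; [easy|].
  specialize (Hl ((Rabs l - c) / 2)). lra.
Qed.

(** Replaces the improper integral along two filters by a limit of proper ones, through which
    inequalities pass. *)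
Lemma is_RInt_gen_is_lim (f : R -> R) l : (forall b, 0 <= b -> ex_RInt f 0 b) ->
  is_RInt_gen f (at_point 0) (Rbar_locally p_infty) l <->
  is_lim (RInt f 0) p_infty (Finite l).
Proof.
  intros Hf. split; intros H.
  - intros P HP. destruct (H P HP) as [Q S HQ [M HM] HQS]. exists M. intros b Hb.
    destruct (HQS 0 b HQ (HM b Hb)) as [y [Hy1 Hy2]]. simpl in Hy1.
    now rewrite (is_RInt_unique _ _ _ _ Hy1).
  - intros P HP. destruct (H P HP) as [M HM].
    exists (fun x => x = 0) (fun b => Rmax M 0 < b).
    + easy.
    + exists (Rmax M 0). easy.
    + intros x b -> Hb. exists (RInt f 0 b). split.
      * apply (RInt_correct (V := R_CompleteNormedModule)). simpl. apply Hf. pose proof (Rmax_r M 0). lra.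
      * apply HM. pose proof (Rmax_l M 0). lra.
Qed.

Definition density (k : R -> R) : Prop :=
  (forall x, 0 <= x -> 0 <= k x) /\
  (forall x y, 0 <= x -> x <= y -> k y <= k x) /\
  is_lim (RInt k 0) p_infty 1.

Definition kavg (k h : R -> R) (z : R) : R :=
  RInt_gen (fun x => k x * h (z + x)) (at_point 0) (Rbar_locally p_infty).

Section Kernel.

Variable k : R -> R.
Hypothesis Hk : density k.

Lemma density_pos x : 0 <= x -> 0 <= k x.
Proof. apply Hk. Qed.

Lemma density_dec x y : 0 <= x -> x <= y -> k y <= k x.
Proof. apply Hk. Qed.

(** [k] is constrained only on [0, oo); freezing it at [k 0] on the left makes it monotone on the
    line without changing any integral over [0, b]. *)
Lemma density_DM : DM (fun x => k (Rmax 0 x)).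
Proof.
  exists (fun _ => 0), (fun x => - k (Rmax 0 x)). repeat split.
  - intros x y _; lra.
  - intros x y Hxy. apply Ropp_le_contravar, density_dec; [apply Rmax_l|].
    now apply Rle_max_compat_l.
  - intros; ring_R.
Qed.

Lemma ex_RInt_kmult h a b : DM h -> 0 <= a -> 0 <= b -> ex_RInt (fun x => k x * h x) a b.
Proof.
  intros Hh Ha Hb.
  apply (ex_RInt_ext (fun x => k (Rmax 0 x) * h x)).
  - intros x [Hx _]. rewrite Rmax_right; [easy|].
    apply Rlt_le. apply Rle_lt_trans with (Rmin a b); [|easy]. now apply Rmin_glb.
  - apply ex_RInt_DM_mult; [apply density_DM|easy].
Qed.

Lemma DM_const c : DM (fun _ => c).
Proof. apply DM_incr. intros x y _; lra. Qed.

Lemma ex_RInt_density a b : 0 <= a -> 0 <= b -> ex_RInt k a b.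
Proof.
  intros Ha Hb. apply (ex_RInt_ext (fun x => k x * 1)).
  - intros; ring_R.
  - apply (ex_RInt_kmult (fun _ => 1)); [apply DM_const|easy|easy].
Qed.

Lemma RInt_density_ge0 a b : 0 <= a <= b -> 0 <= RInt k a b.
Proof.
  intros H. apply RInt_ge_0; [lra|apply ex_RInt_density; lra|].
  intros x Hx. apply density_pos. lra.
Qed.

Lemma RInt_density_le a b : 0 <= a <= b -> RInt k a b <= (b - a) * k a.
Proof.
  intros H. rewrite <- (RInt_const_R a b (k a)).
  apply RInt_le; [lra|apply ex_RInt_density; lra|apply ex_RInt_const|].
  intros x Hx. apply density_dec; lra.
Qed.

Lemma RInt_density_ge a b : 0 <= a <= b -> (b - a) * k b <= RInt k a b.
Proof.
  intros H. rewrite <- (RInt_const_R a b (k b)).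
  apply RInt_le; [lra|apply ex_RInt_const|apply ex_RInt_density; lra|].
  intros x Hx. apply density_dec; lra.
Qed.

Lemma RInt_density_le1 b : 0 <= b -> RInt k 0 b <= 1.
Proof.
  intros Hb.
  destruct (Rle_dec (RInt k 0 b) 1) as [|n]; [easy|].
  destruct Hk as [_ [_ Hl]]. apply is_lim_spec in Hl.
  assert (He : 0 < RInt k 0 b - 1) by lra.
  destruct (Hl (mkposreal _ He)) as [M HM]. simpl in HM.
  set (c := Rmax b M + 1).
  assert (b <= c) by (unfold c; pose proof (Rmax_l b M); lra).
  assert (M < c) by (unfold c; pose proof (Rmax_r b M); lra).
  specialize (HM c H0). apply Rabs_lt_between in HM.
  rewrite <- (RInt_Chasles_R k 0 b c) in HM by (apply ex_RInt_density; lra).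
  pose proof (RInt_density_ge0 b c). lra.
Qed.

Lemma abs_RInt_kmult h H a b : DM h -> bounded_by H h -> 0 <= a <= b ->
  Rabs (RInt (fun x => k x * h x) a b) <= H * RInt k a b.
Proof.
  intros Hh HH Hab. rewrite <- RInt_scal_R by (apply ex_RInt_density; lra).
  apply abs_RInt_le_fun; [lra|apply ex_RInt_kmult; [easy|lra|lra]
    |apply ex_RInt_scal_R, ex_RInt_density; lra|].
  intros x Hx. rewrite Rabs_mult, (Rabs_pos_eq (k x)) by (apply density_pos; lra).
  rewrite Rmult_comm. apply Rmult_le_compat_r; [apply density_pos; lra|apply HH].
Qed.

Lemma kavg_is_lim h H z : DM h -> bounded_by H h ->
  is_lim (RInt (fun x => k x * h (z + x)) 0) p_infty (kavg k h z).
Proof.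
  intros Hh HH.
  assert (Hs : DM (fun x => h (z + x))) by now apply DM_shift.
  assert (HHs : bounded_by H (fun x => h (z + x))) by (intros x; apply HH).
  assert (Hex : exists l : R, is_lim (RInt (fun x => k x * h (z + x)) 0) p_infty l).
  { assert (H0 : 0 <= H) by exact (bounded_by_nonneg _ _ HH).
    apply (filterlim_locally_cauchy (U := R_CompleteSpace) (F := Rbar_locally p_infty)).
    intros eps. destruct Hk as [_ [_ Hl]]. apply is_lim_spec in Hl.
    (* Two tails are compared, hence the 2; [H + 1] avoids a division by zero. *)
    assert (He : 0 < eps / (2 * (H + 1))).
    { apply Rdiv_lt_0_compat; [apply cond_pos|lra]. }
    destruct (Hl (mkposreal _ He)) as [M HM]. simpl in HM.
    exists (fun b => Rmax M 0 < b). split; [exists (Rmax M 0); easy|].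
    assert (Hle : forall u v, Rmax M 0 < u -> u <= v ->
      Rabs (RInt (fun x => k x * h (z + x)) 0 v - RInt (fun x => k x * h (z + x)) 0 u) < eps).
    { intros u v Hu Hv. pose proof (Rmax_l M 0). pose proof (Rmax_r M 0).
      rewrite <- (RInt_Chasles_R _ 0 u v) by (apply (ex_RInt_kmult (fun x => h (z + x))); [easy|lra|lra]).
      match goal with |- Rabs ?e < _ => replace e with (RInt (fun x => k x * h (z + x)) u v) by (ring_R) end.
      apply Rle_lt_trans with (H * RInt k u v).
      { apply (abs_RInt_kmult (fun x => h (z + x))); [easy|easy|lra]. }
      assert (E : RInt k u v = (RInt k 0 v - 1) - (RInt k 0 u - 1)).
      { rewrite <- (RInt_Chasles_R k 0 u v) by (apply ex_RInt_density; lra). ring_R. }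
      assert (HI : RInt k u v < 2 * (eps / (2 * (H + 1)))).
      { rewrite E. assert (A1 := HM u ltac:(lra)). assert (A2 := HM v ltac:(lra)).
        apply Rabs_lt_between in A1. apply Rabs_lt_between in A2. lra. }
      pose proof (RInt_density_ge0 u v).
      apply Rle_lt_trans with ((H + 1) * RInt k u v); [nra|].
      replace (pos eps) with ((H + 1) * (2 * (eps / (2 * (H + 1))))) by (field; lra).
      apply Rmult_lt_compat_l; lra. }
    intros u v Hu Hv. change (Rabs (RInt (fun x => k x * h (z + x)) 0 v - RInt (fun x => k x * h (z + x)) 0 u) < eps).
    destruct (Rle_dec u v) as [Huv|Huv].
    - now apply Hle.
    - rewrite Rabs_minus_sym. apply Hle; [easy|lra]. }
  destruct Hex as [l Hl].
  assert (E : kavg k h z = l); [|now rewrite E].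
  apply (is_RInt_gen_unique (V := R_CompleteNormedModule) (fun x => k x * h (z + x))). apply is_RInt_gen_is_lim; [|easy].
  intros b Hb. apply (ex_RInt_kmult (fun x => h (z + x))); [easy|lra|lra].
Qed.

Lemma bounded_minus h g H G : bounded_by H h -> bounded_by G g ->
  bounded_by (H + G) (fun x => h x - g x).
Proof.
  intros Hh Hg x. pose proof (Rabs_triang (h x) (- g x)).
  rewrite Rabs_Ropp in H0. specialize (Hh x). specialize (Hg x).
  unfold Rminus. lra.
Qed.

Lemma kavg_minus h g H G z : DM h -> bounded_by H h -> DM g -> bounded_by G g ->
  kavg k (fun x => h x - g x) z = kavg k h z - kavg k g z.
Proof.
  intros Hh HH Hg HG.
  pose proof (kavg_is_lim h H z Hh HH) as L1.
  pose proof (kavg_is_lim g G z Hg HG) as L2.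
  pose proof (kavg_is_lim _ _ z (DM_minus h g Hh Hg) (bounded_minus h g H G HH HG)) as L3.
  pose proof (is_lim_minus' _ _ _ _ _ L1 L2) as L4.
  apply is_lim_unique in L3. 
  assert (L5 : is_lim (RInt (fun x => k x * (h (z + x) - g (z + x))) 0) p_infty
     (kavg k h z - kavg k g z)).
  { eapply is_lim_ext_loc; [|exact L4]. exists 0. intros b Hb. simpl.
    rewrite <- RInt_minus_R by (apply (ex_RInt_kmult (fun x => _ (z + x))); [now apply DM_shift|lra|lra]).
    apply RInt_ext. intros x _. ring_R. }
  apply is_lim_unique in L5. rewrite L3 in L5. now injection L5.
Qed.

Lemma kavg_shift h z d : kavg k h (z + d) = kavg k (fun x => h (x + d)) z.
Proof.
  unfold kavg. f_equal. apply functional_extensionality. intros x.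
  do 2 f_equal. ring_R.
Qed.

(** After a substitution the shift falls on the kernel, and the difference is the integral of
    [(k (x - d) - k x) * g x] over [d, oo) minus that of [k * g] over [0, d]. By monotonicity the
    first weight is non-negative, and its mass telescopes to at most the mass of [k] on [0, d],
    itself at most [k 0 * d]; hence the factor 2. *)
Lemma kavg_translate_le h H z d : DM h -> bounded_by H h -> 0 <= d ->
  Rabs (kavg k h (z + d) - kavg k h z) <= 2 * k 0 * H * d.
Proof.
  intros Hh HH Hd.
  assert (H0 : 0 <= H) by exact (bounded_by_nonneg _ _ HH).
  pose proof (kavg_is_lim h H z Hh HH) as L1.
  pose proof (kavg_is_lim h H (z + d) Hh HH) as L2.
  (* Ending the unshifted integral at [b + d] lets it share its upper limit with the translated
     one. *)
  assert (L1' : is_lim (fun b => RInt (fun x => k x * h (z + x)) 0 (b + d)) p_infty (kavg k h z)).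
  { intros P HP. destruct (L1 P HP) as [M HM]. exists M. intros b Hb. apply HM. lra. }
  pose proof (is_lim_minus' _ _ _ _ _ L2 L1') as L3.
  apply (is_lim_abs_le _ _ _ 0 L3). intros b Hb.
  set (g := fun x => h (z + x)).
  assert (Hg : DM g) by now apply DM_shift.
  assert (HG : bounded_by H g) by (intros x; apply HH).
  set (kd := fun x => k (Rmax 0 (x - d))).
  assert (Hkd : DM kd).
  { apply (DM_comp (fun x => k (Rmax 0 x)) (fun x => x - d)); [apply density_DM|].
    intros x y; lra. }
  assert (E1 : RInt (fun x => k x * h (z + d + x)) 0 b = RInt (fun x => kd x * g x) d (b + d)).
  { transitivity (RInt (fun x => kd (x + d) * g (x + d)) 0 b).
    - apply RInt_ext. intros x Hx. rewrite Rmin_left in Hx by lra. unfold kd, g.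
      replace (x + d - d) with x by ring_R. rewrite Rmax_right by lra.
      replace (z + (x + d)) with (z + d + x) by ring_R. easy.
    - destruct (RInt_translate (fun x => kd x * g x) d 0 b) as [_ ->];
        [now apply ex_RInt_DM_mult|]. now rewrite Rplus_0_l. }
  assert (E2 : RInt kd d (b + d) = RInt k 0 b).
  { transitivity (RInt (fun x => kd (x + d)) 0 b).
    - destruct (RInt_translate kd d 0 b) as [_ ->]; [now apply ex_RInt_DM|]. now rewrite Rplus_0_l.
    - apply RInt_ext. intros x Hx. rewrite Rmin_left in Hx by lra. unfold kd.
      replace (x + d - d) with x by ring_R. now rewrite Rmax_right by lra. }
  change (Rabs (RInt (fun x => k x * h (z + d + x)) 0 b - RInt (fun x => k x * g x) 0 (b + d))
    <= 2 * k 0 * H * d).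
  rewrite E1, <- (RInt_Chasles_R (fun x => k x * g x) 0 d (b + d)) by (apply ex_RInt_kmult; [easy|lra|lra]).
  assert (I1 : Rabs (RInt (fun x => kd x * g x - k x * g x) d (b + d)) <= H * k 0 * d).
  { apply Rle_trans with (RInt (fun x => H * (kd x - k x)) d (b + d)).
    - apply abs_RInt_le_fun; [lra| | |].
      + apply ex_RInt_minus_R; [now apply ex_RInt_DM_mult|apply ex_RInt_kmult; [easy|lra|lra]].
      + apply ex_RInt_scal_R, ex_RInt_minus_R; [now apply ex_RInt_DM|apply ex_RInt_density; lra].
      + intros x Hx. assert (k x <= kd x).
        { unfold kd. rewrite Rmax_right by lra. apply density_dec; lra. }
        rewrite <- Rmult_minus_distr_r, Rabs_mult, Rabs_pos_eq by lra.
        rewrite Rmult_comm. apply Rmult_le_compat_r; [lra|apply HG].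
    - rewrite RInt_scal_R, RInt_minus_R, E2; try (now apply ex_RInt_DM); try (apply ex_RInt_density; lra).
      2: { apply ex_RInt_minus_R; [now apply ex_RInt_DM|apply ex_RInt_density; lra]. }
      rewrite Rmult_assoc. apply Rmult_le_compat_l; [easy|].
      pose proof (RInt_Chasles_R k 0 d (b + d)) as C1.
      pose proof (RInt_Chasles_R k 0 b (b + d)) as C2.
      rewrite <- C1 in C2 by (apply ex_RInt_density; lra).
      assert (C3 := C2 ltac:(apply ex_RInt_density; lra) ltac:(apply ex_RInt_density; lra)).
      pose proof (RInt_density_le 0 d ltac:(lra)).
      pose proof (RInt_density_ge0 b (b + d) ltac:(lra)). lra. }
  rewrite RInt_minus_R in I1; [|now apply ex_RInt_DM_mult|apply ex_RInt_kmult; [easy|lra|lra]].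
  pose proof (abs_RInt_kmult g H 0 d Hg HG ltac:(lra)) as I2.
  pose proof (RInt_density_le 0 d ltac:(lra)) as I3.
  assert (I4 : H * RInt k 0 d <= H * k 0 * d) by (rewrite Rmult_assoc; apply Rmult_le_compat_l; lra).
  match goal with |- Rabs ?e <= _ =>
    replace e with ((RInt (fun x => kd x * g x) d (b + d) - RInt (fun x => k x * g x) d (b + d))
      + - RInt (fun x => k x * g x) 0 d) by (ring_R) end.
  eapply Rle_trans; [apply Rabs_triang|]. rewrite Rabs_Ropp. lra.
Qed.

Lemma kavg_Lip h H : DM h -> bounded_by H h -> Lip (2 * k 0 * H) (kavg k h).
Proof.
  intros Hh HH x y. destruct (Rle_dec x y) as [Hxy|Hxy].
  - rewrite Rabs_minus_sym, (Rabs_minus_sym x), (Rabs_pos_eq (y - x)) by lra.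
    replace y with (x + (y - x)) at 1 by ring_R. apply kavg_translate_le; [easy..|lra].
  - rewrite (Rabs_pos_eq (x - y)) by lra.
    replace x with (y + (x - y)) at 1 by ring_R. apply kavg_translate_le; [easy..|lra].
Qed.

End Kernel.

(** * Differentiability of averages of Lipschitz functions *)

Lemma Lip_continuous L h x : Lip L h -> continuous h x.
Proof.
  intros H. pose proof (Lip_nonneg _ _ H) as HL.
  apply continuity_pt_filterlim. intros eps Heps.
  exists (eps / (L + 1)). split; [apply Rdiv_lt_0_compat; lra|].
  intros y [_ Hy]. simpl in Hy. unfold R_dist in Hy. simpl. unfold R_dist.
  apply Rle_lt_trans with ((L + 1) * Rabs (y - x)).
  - pose proof (H y x). pose proof (Rabs_pos (y - x)). nra.
  - apply Rlt_le_trans with ((L + 1) * (eps / (L + 1))); [apply Rmult_lt_compat_l; lra|].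
    right. field. lra.
Qed.

Lemma Lip_ex_RInt L h a b : Lip L h -> ex_RInt h a b.
Proof.
  intros H. apply (ex_RInt_continuous (V := R_CompleteNormedModule)).
  intros z _. exact (Lip_continuous L h z H).
Qed.

Lemma le_of_forall_eps a b : (forall eps, 0 < eps -> a <= b + eps) -> a <= b.
Proof.
  intros H. destruct (Rle_dec a b); [easy|]. specialize (H ((a - b) / 2)). lra.
Qed.

Lemma is_lim_seq_abs_le (u : nat -> R) (l a c : R) : is_lim_seq u l ->
  (forall eps, 0 < eps -> exists N, forall n, (N <= n)%nat -> Rabs (u n - a) <= c + eps) ->
  Rabs (l - a) <= c.
Proof.
  intros Hu H. apply le_of_forall_eps. intros eps Heps.
  destruct (H (eps / 2)) as [N HN]; [lra|].
  apply is_lim_seq_spec in Hu.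
  destruct (Hu (mkposreal (eps / 2) ltac:(lra))) as [M HM]. simpl in HM.
  specialize (HN (N + M)%nat ltac:(lia)). specialize (HM (N + M)%nat ltac:(lia)).
  rewrite Rabs_minus_sym in HM.
  pose proof (Rabs_triang (l - u (N + M)%nat) (u (N + M)%nat - a)) as Ht.
  replace (l - u (N + M)%nat + (u (N + M)%nat - a)) with (l - a) in Ht by ring_R. lra.
Qed.

Lemma inv_INR_small eps : 0 < eps -> exists N, forall n, (N <= n)%nat -> / INR (S n) < eps.
Proof.
  intros H. destruct (nfloor_ex (/ eps)) as [N HN].
  { apply Rlt_le, Rinv_0_lt_compat, H. }
  exists N. intros n Hn.
  assert (/ eps < INR (S n)).
  { apply Rlt_le_trans with (INR N + 1); [easy|]. rewrite <- S_INR. apply le_INR. lia. }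
  rewrite <- (Rinv_inv eps). apply Rinv_lt_contravar; [|easy].
  apply Rmult_lt_0_compat; [now apply Rinv_0_lt_compat|apply lt_0_INR; lia].
Qed.

Lemma is_derive_quadratic F z l C :
  (forall d, Rabs (F (z + d) - F z - d * l) <= C * (d * d)) -> is_derive F z l.
Proof.
  intros H. apply is_derive_Reals. intros eps Heps.
  assert (HC : 0 <= C).
  { pose proof (H 1). pose proof (Rabs_pos (F (z + 1) - F z - 1 * l)). lra. }
  assert (Hd : 0 < eps / (C + 1)) by (apply Rdiv_lt_0_compat; lra).
  exists (mkposreal _ Hd). simpl. intros h Hh Hhd.
  replace ((F (z + h) - F z) / h - l) with ((F (z + h) - F z - h * l) / h) by (field; easy).
  unfold Rdiv. rewrite Rabs_mult, Rabs_inv.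
  assert (Hp : 0 < Rabs h) by now apply Rabs_pos_lt.
  apply Rmult_lt_reg_r with (Rabs h); [easy|].
  rewrite Rmult_assoc, Rinv_l, Rmult_1_r by lra.
  eapply Rle_lt_trans; [apply H|].
  replace (h * h) with (Rabs h * Rabs h) by (rewrite <- Rabs_mult; apply Rabs_pos_eq; nra).
  rewrite <- Rmult_assoc. apply Rmult_lt_compat_r; [easy|].
  apply Rle_lt_trans with ((C + 1) * Rabs h); [nra|].
  apply Rlt_le_trans with ((C + 1) * (eps / (C + 1))); [apply Rmult_lt_compat_l; lra|].
  right; field; lra.
Qed.

Lemma derive_bounded_by_Lip F C z l : Lip C F -> is_derive F z l -> Rabs l <= C.
Proof.
  intros HF Hl. apply le_of_forall_eps. intros eps Heps.
  apply is_derive_Reals in Hl. destruct (Hl eps Heps) as [d Hd].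
  pose proof (cond_pos d) as Hdp.
  assert (Hq : Rabs (d / 2) < d) by (rewrite Rabs_pos_eq; lra).
  specialize (Hd (d / 2) ltac:(lra) Hq).
  set (q := (F (z + d / 2) - F z) / (d / 2)) in *.
  assert (Hqb : Rabs q <= C).
  { unfold q, Rdiv at 1. rewrite Rabs_mult, (Rabs_pos_eq (/ (d / 2))).
    2: { apply Rlt_le, Rinv_0_lt_compat; lra. }
    apply Rmult_le_reg_r with (d / 2); [lra|].
    rewrite Rmult_assoc, Rinv_l, Rmult_1_r by lra.
    eapply Rle_trans; [apply HF|]. replace (z + d / 2 - z) with (d / 2) by ring_R.
    rewrite Rabs_pos_eq by lra. lra. }
  pose proof (Rabs_triang q (l - q)) as Ht. replace (q + (l - q)) with l in Ht by ring_R.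
  rewrite (Rabs_minus_sym l) in Ht. lra.
Qed.

(** * Bounded second differences imply differentiability *)

Section SecondDifference.

Variables (F : R -> R) (K C : R).
Hypothesis HF : Lip C F.
Hypothesis H2 : forall z s d, 0 <= s -> 0 <= d ->
  Rabs (F (z + s + d) - F (z + s) - F (z + d) + F z) <= K * s * d.

(** The integral over [z, z + s] of the difference [F (x + d) - F x], written with [F] alone so that
    its symmetry in [s] and [d] follows from additivity of the integral. *)
Let Q z s d := RInt F (z + d) (z + s + d) - RInt F z (z + s).

Lemma second_difference_integral z s d : 0 < s -> 0 < d ->
  Rabs (Q z s d - s * (F (z + d) - F z)) <= K * s * s * d.
Proof.
  intros Hs Hd.
  assert (Hex : forall a b, ex_RInt F a b) by (intros; now apply (Lip_ex_RInt C)).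
  assert (E : Q z s d - s * (F (z + d) - F z)
    = RInt (fun x => (F (x + (z + d)) - F (x + z)) - (F (z + d) - F z)) 0 s).
  { assert (T1 := RInt_translate F (z + d) 0 s (Hex _ _)).
    assert (T2 := RInt_translate F z 0 s (Hex _ _)).
    rewrite RInt_minus_R; [rewrite RInt_minus_R|apply ex_RInt_minus_R|apply ex_RInt_const];
      try apply T1; try apply T2.
    destruct T1 as [_ ->]. destruct T2 as [_ ->]. rewrite RInt_const_R. unfold Q.
    replace (0 + (z + d)) with (z + d) by ring_R. replace (0 + z) with z by ring_R.
    replace (s + (z + d)) with (z + s + d) by ring_R. replace (s + z) with (z + s) by ring_R.
    ring_R. }
  rewrite E. replace (K * s * s * d) with ((s - 0) * (K * s * d)) by ring_R.
  apply abs_RInt_le_const; [lra| |].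
  - assert (T1 := RInt_translate F (z + d) 0 s (Hex _ _)).
    assert (T2 := RInt_translate F z 0 s (Hex _ _)).
    apply ex_RInt_minus_R; [apply ex_RInt_minus_R; [apply T1|apply T2]|apply ex_RInt_const].
  - intros t Ht.
    pose proof (H2 z t d (proj1 Ht) (Rlt_le _ _ Hd)) as Hb.
    replace (F (t + (z + d)) - F (t + z) - (F (z + d) - F z))
      with (F (z + t + d) - F (z + t) - F (z + d) + F z)
      by (replace (t + (z + d)) with (z + t + d) by ring_R; replace (t + z) with (z + t) by ring_R; ring_R).
    eapply Rle_trans; [exact Hb|].
    assert (HK : 0 <= K).
    { pose proof (H2 0 1 1). pose proof (Rabs_pos (F (0 + 1 + 1) - F (0 + 1) - F (0 + 1) + F 0)). lra. }
    apply Rmult_le_compat_r; [lra|]. apply Rmult_le_compat_l; lra.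
Qed.

Lemma second_difference_symm z s d : Q z s d = Q z d s.
Proof.
  assert (Hex : forall a b, ex_RInt F a b) by (intros; now apply (Lip_ex_RInt C)).
  unfold Q.
  pose proof (RInt_Chasles_R F z (z + d) (z + s + d) (Hex _ _) (Hex _ _)).
  pose proof (RInt_Chasles_R F z (z + s) (z + s + d) (Hex _ _) (Hex _ _)).
  replace (z + d + s) with (z + s + d) by ring_R. lra.
Qed.

(* Averaging the difference quotient of step [d] over an interval of length [s]
   is symmetric in [d] and [s], so quotients of different steps are close. *)
Lemma difference_quotients_close z s d : 0 < s -> 0 < d ->
  Rabs ((F (z + d) - F z) / d - (F (z + s) - F z) / s) <= K * (s + d).
Proof.
  intros Hs Hd.
  pose proof (second_difference_integral z s d Hs Hd) as A.
  pose proof (second_difference_integral z d s Hd Hs) as B.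
  rewrite second_difference_symm in B.
  set (a := F (z + d) - F z) in *. set (b := F (z + s) - F z) in *.
  assert (Hsd : 0 < s * d) by now apply Rmult_lt_0_compat.
  assert (E : a / d - b / s = (s * a - d * b) / (s * d)) by (field; lra).
  rewrite E. unfold Rdiv. rewrite Rabs_mult, Rabs_inv, (Rabs_pos_eq (s * d)) by lra.
  apply Rmult_le_reg_r with (s * d); [easy|].
  rewrite Rmult_assoc, Rinv_l, Rmult_1_r by lra.
  apply Rabs_le_between in A. apply Rabs_le_between in B. apply Rabs_le. nra.
Qed.

(** Difference quotients of steps 1/(n + 1) form a Cauchy sequence by [difference_quotients_close].
    The one-sided estimate with constant [K] is kept in the conclusion because the consistency error
    of the scheme uses it with step [dz]. *)
Lemma second_difference_ex_derive z : exists l,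
  (forall d, 0 < d -> Rabs (F (z + d) - F z - d * l) <= K * (d * d)) /\ is_derive F z l.
Proof.
  assert (HK : 0 <= K).
  { pose proof (H2 0 1 1). pose proof (Rabs_pos (F (0 + 1 + 1) - F (0 + 1) - F (0 + 1) + F 0)). lra. }
  set (u := fun n => (F (z + / INR (S n)) - F z) / (/ INR (S n))).
  assert (Hi : forall n, 0 < / INR (S n)) by (intros n; apply Rinv_0_lt_compat, lt_0_INR; lia).
  assert (Hsm : forall eps, 0 < eps -> exists N, forall n, (N <= n)%nat -> K * / INR (S n) <= eps).
  { intros eps Heps. destruct (inv_INR_small (eps / (K + 1))) as [N HN].
    { apply Rdiv_lt_0_compat; lra. }
    exists N. intros n Hn. specialize (HN n Hn). specialize (Hi n).
    apply Rle_trans with ((K + 1) * (eps / (K + 1))); [nra|]. right; field; lra. }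
  assert (Hc : ex_finite_lim_seq u).
  { apply ex_lim_seq_cauchy_corr. intros eps.
    destruct (Hsm (eps / 3)) as [N HN]; [apply Rdiv_lt_0_compat; [apply cond_pos|lra]|].
    exists N. intros n m Hn Hm. unfold u.
    eapply Rle_lt_trans; [apply difference_quotients_close; apply Hi|].
    pose proof (HN n Hn). pose proof (HN m Hm). pose proof (cond_pos eps). lra. }
  destruct Hc as [l Hl]. exists l.
  assert (Hr : forall d, 0 < d -> Rabs (F (z + d) - F z - d * l) <= K * (d * d)).
  { intros d Hd.
    assert (Hq : Rabs (l - (F (z + d) - F z) / d) <= K * d).
    { apply (is_lim_seq_abs_le u); [easy|]. intros eps Heps.
      destruct (Hsm eps Heps) as [N HN]. exists N. intros n Hn. specialize (HN n Hn).
      eapply Rle_trans; [apply difference_quotients_close; [easy|apply Hi]|]. lra. }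
    replace (F (z + d) - F z - d * l) with (- d * (l - (F (z + d) - F z) / d)) by (field; lra).
    rewrite Rabs_mult, Rabs_Ropp, (Rabs_pos_eq d) by lra. nra. }
  split; [easy|].
  apply (is_derive_quadratic _ _ _ (2 * K)). intros d.
  destruct (Rtotal_order d 0) as [Hd|[->|Hd]].
  (* For d < 0 a second difference centred at z reflects the step to the right-hand side; this
     doubles the constant. *)
  - pose proof (Hr (- d) ltac:(lra)) as A.
    pose proof (H2 (z + d) (- d) (- d) ltac:(lra) ltac:(lra)) as B.
    replace (z + d + - d + - d) with (z + - d) in B by ring_R.
    replace (z + d + - d) with z in B by ring_R.
    apply Rabs_le_between in A. apply Rabs_le_between in B. apply Rabs_le. nra.
  - rewrite Rplus_0_r. replace (F z - F z - 0 * l) with 0 by ring_R. rewrite Rabs_R0. lra.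
  - pose proof (Hr d Hd). nra.
Qed.

End SecondDifference.

Definition dkavg (k h : R -> R) (z : R) : R := Derive (kavg k h) z.

Lemma bounded_shift H h d : bounded_by H h -> bounded_by H (fun x => h (x + d)).
Proof. intros Hh x; apply Hh. Qed.

Lemma Lip_shift L h d : Lip L h -> Lip L (fun x => h (x + d)).
Proof.
  intros Hh x y. replace (x - y) with (x + d - (y + d)) by ring_R. apply Hh.
Qed.

Lemma Lip_minus L L' h g : Lip L h -> Lip L' g -> Lip (L + L') (fun x => h x - g x).
Proof.
  intros Hh Hg x y. specialize (Hh x y). specialize (Hg x y).
  replace (h x - g x - (h y - g y)) with ((h x - h y) + - (g x - g y)) by ring_R.
  eapply Rle_trans; [apply Rabs_triang|]. rewrite Rabs_Ropp. lra.
Qed.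

Section KernelDerivative.

Variable k : R -> R.
Hypothesis Hk : density k.

Lemma kavg_second_difference h H L z s d : Lip L h -> bounded_by H h -> 0 <= s -> 0 <= d ->
  Rabs (kavg k h (z + s + d) - kavg k h (z + s) - kavg k h (z + d) + kavg k h z)
  <= 2 * k 0 * L * s * d.
Proof.
  intros HL HH Hs Hd.
  assert (Hh : DM h) by now apply (Lip_DM L).
  assert (Hhd : DM (fun x => h (x + d))) by now apply (Lip_DM L), Lip_shift.
  set (g := fun x => h (x + d) - h x).
  assert (Eg : forall y, kavg k g y = kavg k h (y + d) - kavg k h y).
  { intros y. unfold g.
    rewrite (kavg_minus k Hk (fun x => h (x + d)) h H H); [|easy|now apply bounded_shift|easy|easy].
    now rewrite <- kavg_shift. }
  assert (Hg : DM g) by now apply DM_minus.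
  assert (HG : bounded_by (L * d) g).
  { intros x. unfold g. eapply Rle_trans; [apply HL|].
    replace (x + d - x) with d by ring_R. rewrite Rabs_pos_eq; lra. }
  pose proof (kavg_translate_le k Hk g (L * d) z s Hg HG Hs) as B.
  rewrite !Eg in B.
  match type of B with Rabs ?e <= _ => match goal with |- Rabs ?e' <= _ => replace e' with e by ring_R end end.
  eapply Rle_trans; [exact B|]. right; ring_R.
Qed.

Lemma dkavg_spec h H L z : Lip L h -> bounded_by H h ->
  (forall d, 0 < d -> Rabs (kavg k h (z + d) - kavg k h z - d * dkavg k h z) <= 2 * k 0 * L * (d * d))
  /\ is_derive (kavg k h) z (dkavg k h z).
Proof.
  intros HL HH.
  destruct (second_difference_ex_derive (kavg k h) (2 * k 0 * L) (2 * k 0 * H)) with (z := z)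
    as [l [H1 H2]].
  - apply kavg_Lip; [easy|now apply (Lip_DM L)|easy].
  - intros. now apply (kavg_second_difference h H).
  - unfold dkavg. now rewrite (is_derive_unique _ _ _ H2).
Qed.

Lemma dkavg_bound h H L z : Lip L h -> bounded_by H h -> Rabs (dkavg k h z) <= 2 * k 0 * H.
Proof.
  intros HL HH. apply (derive_bounded_by_Lip (kavg k h) _ z).
  - apply kavg_Lip; [easy|now apply (Lip_DM L)|easy].
  - now apply (dkavg_spec h H L).
Qed.

(** The difference of the derivatives is the derivative of the average of [h - g], whose Lipschitz
    constant involves only the sup norm of [h - g]; so [L] and [L'] do not enter the bound. *)
Lemma dkavg_close h g H G L L' D z :
  Lip L h -> bounded_by H h -> Lip L' g -> bounded_by G g ->
  (forall x, Rabs (h x - g x) <= D) ->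
  Rabs (dkavg k h z - dkavg k g z) <= 2 * k 0 * D.
Proof.
  intros HL HH HL' HG HD.
  assert (E : kavg k (fun x => h x - g x) = fun y => kavg k h y - kavg k g y).
  { apply functional_extensionality. intros y.
    apply (kavg_minus k Hk h g H G); [now apply (Lip_DM L)|easy|now apply (Lip_DM L')|easy]. }
  apply (derive_bounded_by_Lip (kavg k (fun x => h x - g x)) _ z).
  - apply kavg_Lip; [easy| |easy]. now apply (Lip_DM (L + L')), Lip_minus.
  - rewrite E. apply (is_derive_minus (V := R_NormedModule));
      [now apply (dkavg_spec h H L)|now apply (dkavg_spec g G L')].
Qed.

Lemma dkavg_shift h H L z d : Lip L h -> bounded_by H h ->
  dkavg k h (z + d) = dkavg k (fun x => h (x + d)) z.
Proof.
  intros HL HH. unfold dkavg.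
  assert (E : kavg k (fun x => h (x + d)) = fun y => kavg k h (y + d)).
  { apply functional_extensionality. intros y. symmetry. apply kavg_shift. }
  rewrite E. symmetry. apply is_derive_unique.
  pose proof (proj2 (dkavg_spec h H L (z + d) HL HH)) as Hd.
  replace (Derive (kavg k h) (z + d)) with (scal 1 (dkavg k h (z + d))).
  2: { unfold scal; simpl; unfold mult; simpl. unfold dkavg. ring_R. }
  apply (is_derive_comp (kavg k h) (fun y => y + d)); [easy|].
  auto_derive; [easy|ring_R].
Qed.

(** Averages commute with translations, so an increment of the derivative is the difference of the
    derivatives for [h] and for its translate, which are at most [L * Rabs (x - y)] apart. *)
Lemma dkavg_Lip h H L : Lip L h -> bounded_by H h -> Lip (2 * k 0 * L) (dkavg k h).
Proof.
  intros HL HH x y. replace x with (y + (x - y)) at 1 by ring_R.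
  rewrite (dkavg_shift h H L) by easy. rewrite Rmult_assoc.
  apply (dkavg_close _ _ H H L L); [now apply Lip_shift|now apply bounded_shift|easy|easy|].
  intros t. eapply Rle_trans; [apply HL|]. replace (t + (x - y) - t) with (x - y) by ring_R. lra.
Qed.

End KernelDerivative.

(** * The evolution equation as a Lipschitz ODE in the sup norm *)

Lemma exp_ge_1 x : 0 <= x -> 1 <= exp x.
Proof.
  intros [Hx| <-]; [|rewrite exp_0; lra].
  pose proof (exp_ineq1 x ltac:(lra)). lra.
Qed.

Lemma is_RInt_exp_weight C m b : 
  is_RInt (fun s => C * m * exp (2 * C * s)) 0 b (m / 2 * (exp (2 * C * b) - 1)).
Proof.
  replace (m / 2 * (exp (2 * C * b) - 1))
    with (minus (m / 2 * exp (2 * C * b)) (m / 2 * exp (2 * C * 0))).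
  - apply (is_RInt_derive (V := R_CompleteNormedModule) (fun s => m / 2 * exp (2 * C * s))).
    + intros x _. auto_derive; [easy|field].
    + intros x _. apply (ex_derive_continuous (V := R_NormedModule)). auto_derive. easy.
  - change (m / 2 * exp (2 * C * b) - m / 2 * exp (2 * C * 0) = m / 2 * (exp (2 * C * b) - 1)).
    rewrite (Rmult_0_r (2 * C)), exp_0. ring.
Qed.

(* Halving against the weight [exp (2 C t)] is what makes the integral operator
   of a [C]-Lipschitz evolution a contraction for all times. *)
Lemma weighted_integral_bound (f : R -> R) C m b : 0 <= m -> 0 <= b -> ex_RInt f 0 b ->
  (forall s, 0 <= s <= b -> Rabs (f s) <= C * m * exp (2 * C * s)) ->
  Rabs (RInt f 0 b) <= m / 2 * exp (2 * C * b).
Proof.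
  intros Hm Hb Hf H. pose proof (is_RInt_exp_weight C m b) as I.
  apply Rle_trans with (m / 2 * (exp (2 * C * b) - 1)); [|nra].
  rewrite <- (is_RInt_unique _ _ _ _ I).
  apply abs_RInt_le_fun; [easy|easy|eexists; exact I|]. intros s Hs. apply H. lra.
Qed.

Lemma Lip_comp L L' G h : Lip L G -> Lip L' h -> Lip (L * L') (fun x => G (h x)).
Proof.
  intros HG Hh x y. pose proof (Lip_nonneg _ _ HG). specialize (HG (h x) (h y)).
  specialize (Hh x y). rewrite Rmult_assoc. nra.
Qed.

Lemma Lip_le L L' h : L <= L' -> Lip L h -> Lip L' h.
Proof.
  intros HL Hh x y. specialize (Hh x y). pose proof (Rabs_pos (x - y)). nra.
Qed.

Section Evolution.

Variables (k G w0 : R -> R) (LG HG L0 : R).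
Hypothesis Hk : density k.
Hypothesis HLG : Lip LG G.
Hypothesis HHG : bounded_by HG G.
Hypothesis Hw0 : Lip L0 w0.

Definition rhs (u : R -> R) (z : R) : R := dkavg k (fun x => G (u x)) z.

(** A Lipschitz constant of [rhs] in the sup norm, see [rhs_close]. The added 1 keeps it at least 1,
    so that [exp (2 * rate * t)] is strictly increasing and dominates t. *)
Definition rate : R := 2 * k 0 * LG + 1.
Definition speed : R := 2 * k 0 * HG.

Lemma density_0_nonneg : 0 <= k 0.
Proof. apply Hk. lra. Qed.

Lemma rate_ge_1 : 1 <= rate.
Proof. unfold rate. pose proof density_0_nonneg. pose proof (Lip_nonneg _ _ HLG). nra. Qed.

Lemma speed_nonneg : 0 <= speed.
Proof. unfold speed. pose proof density_0_nonneg. pose proof (bounded_by_nonneg _ _ HHG). nra. Qed.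

Lemma bounded_comp u : bounded_by HG (fun x => G (u x)).
Proof. intros x; apply HHG. Qed.

Lemma rhs_bound L u z : Lip L u -> Rabs (rhs u z) <= speed.
Proof.
  intros Hu. apply (dkavg_bound k Hk _ HG (LG * L)); [now apply Lip_comp|apply bounded_comp].
Qed.

Lemma rhs_close L L' u v D z : Lip L u -> Lip L' v ->
  (forall x, Rabs (u x - v x) <= D) -> Rabs (rhs u z - rhs v z) <= rate * D.
Proof.
  intros Hu Hv HD.
  apply Rle_trans with (2 * k 0 * (LG * D)).
  - apply (dkavg_close k Hk _ _ HG HG (LG * L) (LG * L'));
      [now apply Lip_comp|apply bounded_comp|now apply Lip_comp|apply bounded_comp|].
    intros x. eapply Rle_trans; [apply HLG|].
    apply Rmult_le_compat_l; [exact (Lip_nonneg _ _ HLG)|apply HD].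
  - assert (0 <= D) by (pose proof (HD 0); pose proof (Rabs_pos (u 0 - v 0)); lra).
    unfold rate. nra.
Qed.

Lemma rhs_Lip L u : Lip L u -> Lip (rate * L) (rhs u).
Proof.
  intros Hu. apply Lip_le with (2 * k 0 * (LG * L)).
  - pose proof (Lip_nonneg _ _ Hu). unfold rate. nra.
  - apply (dkavg_Lip k Hk _ HG); [now apply Lip_comp|apply bounded_comp].
Qed.

(* Functions of [(z, t)] are kept constant for [t <= 0], which makes them
   Lipschitz in [t] on the whole line. *)
Definition weight (t : R) : R := exp (2 * rate * Rmax 0 t).

Lemma weight_ge_1 t : 1 <= weight t.
Proof.
  apply exp_ge_1. pose proof rate_ge_1. pose proof (Rmax_l 0 t). nra.
Qed.

(** Bounds chosen to be invariant under [picard]: a Lipschitz constant [2 * L0 * weight] in z comes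
    back as [L0] plus half of itself, and [weight] is at least 1. *)
Definition regular (w : R -> R -> R) : Prop :=
  (forall t, Lip (2 * L0 * weight t) (fun z => w z t)) /\
  (forall z, Lip speed (w z)).

Definition picard (w : R -> R -> R) (z t : R) : R :=
  w0 z + RInt (fun s => rhs (fun x => w x s) z) 0 (Rmax 0 t).

Lemma rhs_time_Lip w z : regular w ->
  Lip (rate * speed) (fun s => rhs (fun x => w x s) z).
Proof.
  intros [H1 H2] s s'. rewrite Rmult_assoc.
  apply (rhs_close (2 * L0 * weight s) (2 * L0 * weight s')); [apply H1|apply H1|].
  intros x. apply H2.
Qed.

Lemma rhs_ex_RInt w z a b : regular w -> ex_RInt (fun s => rhs (fun x => w x s) z) a b.
Proof. intros Hw. apply (Lip_ex_RInt (rate * speed)). now apply rhs_time_Lip. Qed.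

Lemma Lip_Rmax0 : Lip 1 (Rmax 0).
Proof.
  intros x y. unfold Rmax. destruct (Rle_dec 0 x), (Rle_dec 0 y);
    apply Rabs_le; pose proof (Rle_abs (x - y)); pose proof (Rle_abs (- (x - y)));
    rewrite Rabs_Ropp in *; lra.
Qed.

Lemma picard_regular w : regular w -> regular (picard w).
Proof.
  intros Hw. pose proof Hw as [H1 H2]. pose proof (Lip_nonneg _ _ Hw0) as HL0. split.
  - intros t z z'. unfold picard.
    set (b := Rmax 0 t). assert (Hb : 0 <= b) by apply Rmax_l.
    pose proof (rhs_ex_RInt w z 0 b Hw) as I. pose proof (rhs_ex_RInt w z' 0 b Hw) as I'.
    match goal with |- Rabs ?e <= _ => replace e with ((w0 z - w0 z') +
      RInt (fun s => rhs (fun x => w x s) z - rhs (fun x => w x s) z') 0 b)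
      by (rewrite RInt_minus_R by easy; ring_R) end.
    eapply Rle_trans; [apply Rabs_triang|].
    assert (A : Rabs (RInt (fun s => rhs (fun x => w x s) z - rhs (fun x => w x s) z') 0 b)
      <= (2 * L0 * Rabs (z - z')) / 2 * exp (2 * rate * b)).
    { pose proof (Rabs_pos (z - z')). apply weighted_integral_bound; [nra|easy| |].
      - now apply ex_RInt_minus_R.
      - intros s Hs. pose proof (rhs_Lip _ _ (H1 s) z z') as HR.
        unfold weight in HR. rewrite Rmax_right in HR by lra.
        eapply Rle_trans; [exact HR|]. right; ring_R. }
    pose proof (Hw0 z z') as B. pose proof (weight_ge_1 t) as Hwt.
    change (exp (2 * rate * b)) with (weight t) in A. pose proof (Rabs_pos (z - z')).
    assert (L0 * Rabs (z - z') <= L0 * Rabs (z - z') * weight t).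
    { rewrite <- (Rmult_1_r (L0 * Rabs (z - z'))) at 1. apply Rmult_le_compat_l; [nra|easy]. }
    lra.
  - intros z t t'. unfold picard.
    replace (w0 z + RInt (fun s => rhs (fun x => w x s) z) 0 (Rmax 0 t) -
      (w0 z + RInt (fun s => rhs (fun x => w x s) z) 0 (Rmax 0 t')))
      with (RInt (fun s => rhs (fun x => w x s) z) (Rmax 0 t') (Rmax 0 t)).
    2: { pose proof (RInt_Chasles_R (fun s => rhs (fun x => w x s) z) 0 (Rmax 0 t') (Rmax 0 t)
           (rhs_ex_RInt _ _ _ _ Hw) (rhs_ex_RInt _ _ _ _ Hw)). lra. }
    apply Rle_trans with (speed * Rabs (Rmax 0 t - Rmax 0 t')).
    + destruct (Rle_dec (Rmax 0 t') (Rmax 0 t)) as [Hle|Hle].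
      * rewrite (Rabs_pos_eq (Rmax 0 t - Rmax 0 t')), Rmult_comm by lra.
        apply abs_RInt_le_const; [easy|now apply rhs_ex_RInt|].
        intros s _. exact (rhs_bound _ _ z (H1 s)).
      * pose proof (opp_RInt_swap (V := R_CompleteNormedModule)
          (fun s => rhs (fun x => w x s) z) (Rmax 0 t) (Rmax 0 t') (rhs_ex_RInt _ _ _ _ Hw)) as E.
        rewrite <- E. change (Rabs (- RInt (fun s => rhs (fun x => w x s) z) (Rmax 0 t) (Rmax 0 t'))
          <= speed * Rabs (Rmax 0 t - Rmax 0 t')).
        rewrite Rabs_Ropp, Rabs_minus_sym, (Rabs_pos_eq (Rmax 0 t' - Rmax 0 t)), Rmult_comm by lra.
        apply abs_RInt_le_const; [lra|now apply rhs_ex_RInt|].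
        intros s _. exact (rhs_bound _ _ z (H1 s)).
    + apply Rmult_le_compat_l; [apply speed_nonneg|].
      pose proof (Lip_Rmax0 t t'). lra.
Qed.

Lemma picard_contraction w v m : regular w -> regular v ->
  (forall z t, Rabs (w z t - v z t) <= m * weight t) ->
  forall z t, Rabs (picard w z t - picard v z t) <= m / 2 * weight t.
Proof.
  intros Hw Hv H z t. unfold picard.
  set (b := Rmax 0 t). assert (Hb : 0 <= b) by apply Rmax_l.
  pose proof (rhs_ex_RInt w z 0 b Hw) as I. pose proof (rhs_ex_RInt v z 0 b Hv) as I'.
  match goal with |- Rabs ?e <= _ => replace e with
    (RInt (fun s => rhs (fun x => w x s) z - rhs (fun x => v x s) z) 0 b)
    by (rewrite RInt_minus_R by easy; ring_R) end.
  apply weighted_integral_bound; [|easy|now apply ex_RInt_minus_R|].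
  - pose proof (H z t). pose proof (Rabs_pos (w z t - v z t)). pose proof (weight_ge_1 t).
    destruct (Rle_dec 0 m); [easy|nra].
  - intros s Hs. rewrite Rmult_assoc.
    apply (rhs_close (2 * L0 * weight s) (2 * L0 * weight s)); [apply Hw|apply Hv|].
    intros x. pose proof (H x s) as Hx. unfold weight in Hx. now rewrite Rmax_right in Hx by lra.
Qed.

Fixpoint iterate (n : nat) : R -> R -> R :=
  match n with
  | O => fun z _ => w0 z
  | S n => picard (iterate n)
  end.

Lemma iterate_regular n : regular (iterate n).
Proof.
  induction n as [|n IH]; [|now apply picard_regular].
  pose proof (Lip_nonneg _ _ Hw0) as HL0. split.
  - intros t. apply Lip_le with L0; [|exact Hw0]. pose proof (weight_ge_1 t). nra.
  - intros z t t'. simpl. replace (w0 z - w0 z) with 0 by ring. rewrite Rabs_R0.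
    pose proof speed_nonneg. pose proof (Rabs_pos (t - t')). nra.
Qed.

Lemma iterate_step n z t :
  Rabs (iterate (S n) z t - iterate n z t) <= speed * (/ 2) ^ n * weight t.
Proof.
  revert z t. induction n as [|n IH]; intros z t.
  - pose proof (iterate_regular 1) as [_ H].
    (* The constant start is the first iterate at time 0, so the first step is at most
       [speed * Rmax 0 t], and [Rmax 0 t <= weight t]. *)
    assert (E : iterate 0 z t = iterate 1 z 0).
    { simpl. unfold picard. rewrite Rmax_left by lra.
      pose proof (RInt_point (V := R_CompleteNormedModule) 0
        (fun s => rhs (fun x => iterate 0 x s) z)) as HP. simpl in HP.
      rewrite HP. unfold zero; simpl. ring_R. }
    assert (E2 : iterate 1 z t = iterate 1 z (Rmax 0 t)).
    { simpl. unfold picard. now rewrite (Rmax_right 0 (Rmax 0 t)) by apply Rmax_l. }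
    rewrite E, E2. eapply Rle_trans; [apply H|]. simpl. rewrite Rmult_1_r.
    apply Rmult_le_compat_l; [apply speed_nonneg|].
    pose proof (Rmax_l 0 t). rewrite Rminus_0_r, Rabs_pos_eq by easy.
    unfold weight. pose proof rate_ge_1.
    apply Rle_trans with (2 * rate * Rmax 0 t); [nra|].
    destruct (Req_dec (2 * rate * Rmax 0 t) 0) as [->|Hn]; [left; apply exp_pos|].
    pose proof (exp_ineq1 _ Hn). lra.
  - replace (speed * (/ 2) ^ S n * weight t) with (speed * (/ 2) ^ n / 2 * weight t)
      by (simpl; field).
    apply picard_contraction; [apply (iterate_regular (S n))|apply iterate_regular|exact IH].
Qed.

Lemma iterate_far n p z t :
  Rabs (iterate (n + p) z t - iterate n z t) <= 2 * speed * (/ 2) ^ n * weight t.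
Proof.
  (* The partial geometric sum is kept exact so that the induction on [p] closes. *)
  assert (H : Rabs (iterate (n + p) z t - iterate n z t)
    <= 2 * speed * ((/ 2) ^ n - (/ 2) ^ (n + p)) * weight t).
  { induction p as [|p IH].
    - rewrite Nat.add_0_r. replace (iterate n z t - iterate n z t) with 0 by ring.
      rewrite Rabs_R0. lra.
    - replace (n + S p)%nat with (S (n + p)) by lia.
      pose proof (iterate_step (n + p) z t) as Hs.
      pose proof (Rabs_triang (iterate (S (n + p)) z t - iterate (n + p) z t)
        (iterate (n + p) z t - iterate n z t)) as Ht.
      match type of Ht with Rabs ?e <= _ =>
        replace e with (iterate (S (n + p)) z t - iterate n z t) in Ht by ring end.
      eapply Rle_trans; [exact Ht|]. eapply Rle_trans; [apply Rplus_le_compat; [exact Hs|exact IH]|].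
      right. simpl. field. }
  eapply Rle_trans; [exact H|].
  assert (0 <= (/ 2) ^ (n + p)) by (apply pow_le; lra).
  pose proof speed_nonneg. pose proof (weight_ge_1 t).
  apply Rmult_le_compat_r; [lra|]. apply Rmult_le_compat_l; lra.
Qed.

Lemma half_pow_small c eps : 0 <= c -> 0 < eps ->
  exists N, forall n, (N <= n)%nat -> c * (/ 2) ^ n <= eps.
Proof.
  intros Hc Heps.
  destruct (pow_lt_1_zero (/ 2)) with (y := eps / (c + 1)) as [N HN].
  - rewrite Rabs_pos_eq; lra.
  - apply Rdiv_lt_0_compat; lra.
  - exists N. intros n Hn. specialize (HN n ltac:(lia)).
    assert (0 <= (/ 2) ^ n) by (apply pow_le; lra).
    rewrite Rabs_pos_eq in HN by easy.
    apply Rle_trans with ((c + 1) * (eps / (c + 1))); [nra|]. right; field; lra.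
Qed.

Definition evol (z t : R) : R := real (Lim_seq (fun n => iterate n z t)).

Lemma evol_lim z t : is_lim_seq (fun n => iterate n z t) (evol z t).
Proof.
  unfold evol. apply Lim_seq_correct'. apply ex_lim_seq_cauchy_corr. intros eps.
  pose proof speed_nonneg. pose proof (weight_ge_1 t).
  destruct (half_pow_small (2 * speed * weight t) (eps / 3)) as [N HN];
    [nra|pose proof (cond_pos eps); lra|].
  assert (Hc : forall n, (N <= n)%nat -> Rabs (iterate n z t - iterate N z t) <= eps / 3).
  { intros n Hn. replace n with (N + (n - N))%nat by lia.
    eapply Rle_trans; [apply iterate_far|]. specialize (HN N ltac:(lia)). lra. }
  exists N. intros n m Hn Hm. pose proof (Hc n Hn) as A. pose proof (Hc m Hm) as B.
  pose proof (cond_pos eps).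
  apply Rabs_le_between in A. apply Rabs_le_between in B. apply Rabs_lt_between. lra.
Qed.

Lemma evol_iterate_close n z t :
  Rabs (evol z t - iterate n z t) <= 2 * speed * (/ 2) ^ n * weight t.
Proof.
  apply (is_lim_seq_abs_le _ _ _ _ (evol_lim z t)). intros eps Heps.
  exists n. intros m Hm. replace m with (n + (m - n))%nat by lia.
  eapply Rle_trans; [apply iterate_far|]. lra.
Qed.

Lemma is_lim_seq_minus_le (u v : nat -> R) (l l' c : R) : is_lim_seq u l -> is_lim_seq v l' ->
  (forall n, Rabs (u n - v n) <= c) -> Rabs (l - l') <= c.
Proof.
  intros Hu Hv H.
  pose proof (is_lim_seq_minus' _ _ _ _ Hu Hv) as Hm.
  rewrite <- (Rminus_0_r (l - l')). apply (is_lim_seq_abs_le _ _ _ _ Hm).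
  intros eps Heps. exists 0%nat. intros n _. rewrite Rminus_0_r. specialize (H n). lra.
Qed.

Lemma evol_regular : regular evol.
Proof.
  split.
  - intros t z z'. apply (is_lim_seq_minus_le _ _ _ _ _ (evol_lim z t) (evol_lim z' t)).
    intros n. apply (iterate_regular n).
  - intros z t t'. apply (is_lim_seq_minus_le _ _ _ _ _ (evol_lim z t) (evol_lim z t')).
    intros n. apply (iterate_regular n).
Qed.

(** At a fixed point, both sides lie within a multiple of [(/ 2) ^ n] of the iterate [S n], the
    right-hand side by the contraction. *)
Lemma evol_fixpoint z t : evol z t = picard evol z t.
Proof.
  assert (H : Rabs (evol z t - picard evol z t) <= 0).
  { apply le_of_forall_eps. intros eps Heps.
    pose proof speed_nonneg. pose proof (weight_ge_1 t).
    destruct (half_pow_small (2 * speed * weight t) eps) as [n Hn]; [nra|easy|].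
    specialize (Hn n ltac:(lia)).
    pose proof (evol_iterate_close (S n) z t) as A.
    assert (B : Rabs (picard (iterate n) z t - picard evol z t)
      <= (2 * speed * (/ 2) ^ n) / 2 * weight t).
    { apply picard_contraction; [apply iterate_regular|apply evol_regular|].
      intros x s. rewrite Rabs_minus_sym. apply evol_iterate_close. }
    pose proof (Rabs_triang (evol z t - iterate (S n) z t)
      (picard (iterate n) z t - picard evol z t)) as Ht.
    replace (evol z t - iterate (S n) z t + (picard (iterate n) z t - picard evol z t))
      with (evol z t - picard evol z t) in Ht by (simpl; ring).
    replace (2 * speed * (/ 2) ^ S n * weight t) with ((2 * speed * (/ 2) ^ n) / 2 * weight t) in A
      by (simpl; field). lra. }
  pose proof (Rabs_pos (evol z t - picard evol z t)).
  apply Rminus_diag_uniq. destruct (Req_dec (evol z t - picard evol z t) 0) as [|Hn]; [easy|].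
  apply Rabs_pos_lt in Hn. lra.
Qed.

Lemma evol_initial z t : t <= 0 -> evol z t = w0 z.
Proof.
  intros Ht. rewrite evol_fixpoint. unfold picard. rewrite Rmax_left by lra.
  pose proof (RInt_point (V := R_CompleteNormedModule) 0
        (fun s => rhs (fun x => evol x s) z)) as HP.
  rewrite HP. unfold zero; simpl. ring_R.
Qed.

Lemma evol_increment z t s : 0 <= t -> 0 <= s ->
  evol z s - evol z t = RInt (fun s => rhs (fun x => evol x s) z) t s.
Proof.
  intros Ht Hs. rewrite (evol_fixpoint z s), (evol_fixpoint z t). unfold picard.
  rewrite !Rmax_right by easy.
  pose proof (RInt_Chasles_R (fun s => rhs (fun x => evol x s) z) 0 t s
    (rhs_ex_RInt _ _ _ _ evol_regular) (rhs_ex_RInt _ _ _ _ evol_regular)). lra.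
Qed.

End Evolution.

(** * Averages on a grid *)

Lemma series_partial_sums (a : nat -> R) (l : R) :
  is_lim_seq (sum_f_R0 a) l -> is_series a l.
Proof.
  intros H. apply is_lim_seq_ext with (2 := H). intros n. now rewrite sum_n_Reals.
Qed.

Lemma partial_sums_series (a : nat -> R) (l : R) :
  is_series a l -> is_lim_seq (sum_f_R0 a) l.
Proof.
  intros H. apply is_lim_seq_ext with (u := sum_n a); [|exact H]. intros n. apply sum_n_Reals.
Qed.

Section Discrete.

Variables (k : R -> R) (d : R).
Hypothesis Hk : density k.
Hypothesis Hd : 0 < d.

(** The weights [Phi_ij] depend only on j - i and are these cell masses of the kernel, see
    [sum_ge_dsum]. *)
Definition cellw (n : nat) : R := RInt k (INR n * d) (INR (S n) * d).

Lemma cell_le n : 0 <= INR n * d <= INR (S n) * d.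
Proof. rewrite S_INR. pose proof (pos_INR n). nra. Qed.

Lemma cellw_pos n : 0 <= cellw n.
Proof. apply RInt_density_ge0; [easy|apply cell_le]. Qed.

Lemma cellw_between n : d * k (INR (S n) * d) <= cellw n <= d * k (INR n * d).
Proof.
  pose proof (cell_le n). unfold cellw. pose proof (RInt_density_le k Hk _ _ H).
  pose proof (RInt_density_ge k Hk _ _ H).
  replace (INR (S n) * d - INR n * d) with d in * by (rewrite S_INR; ring). lra.
Qed.

Lemma cellw_dec n : cellw (S n) <= cellw n.
Proof. pose proof (cellw_between n). pose proof (cellw_between (S n)). lra. Qed.

Lemma cellw_0 : cellw 0 <= k 0 * d.
Proof. pose proof (cellw_between 0) as H. simpl (INR 0) in H. rewrite Rmult_0_l in H. lra. Qed.

Lemma sum_cells (f : R -> R) n : (forall a b, 0 <= a -> 0 <= b -> ex_RInt f a b) ->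
  sum_f_R0 (fun n => RInt f (INR n * d) (INR (S n) * d)) n = RInt f 0 (INR (S n) * d).
Proof.
  intros Hf. induction n as [|n IH].
  - simpl. now rewrite Rmult_0_l.
  - cbn [sum_f_R0]. rewrite IH. pose proof (cell_le n). pose proof (cell_le (S n)).
    apply RInt_Chasles_R; apply Hf; lra.
Qed.

Lemma is_lim_seq_cells (F : R -> R) (l : R) :
  is_lim F p_infty l -> is_lim_seq (fun n => F (INR (S n) * d)) l.
Proof.
  intros H P HP. destruct (H P HP) as [M HM].
  destruct (nfloor_ex (Rmax 0 (M / d))) as [N HN]; [apply Rmax_l|].
  exists N. intros n Hn. apply HM.
  assert (M / d < INR (S n)).
  { apply Rle_lt_trans with (Rmax 0 (M / d)); [apply Rmax_r|].
    apply Rlt_le_trans with (INR N + 1); [easy|]. rewrite <- S_INR. apply le_INR. lia. }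
  apply Rlt_div_l in H0; lra.
Qed.

Lemma cellw_series : is_series cellw 1.
Proof.
  apply series_partial_sums.
  apply (is_lim_seq_ext (fun n => RInt k 0 (INR (S n) * d))).
  - intros n. symmetry. apply sum_cells. intros a b Ha Hb. now apply ex_RInt_density.
  - apply is_lim_seq_cells. apply Hk.
Qed.

Lemma cellw_le_1 n : cellw n <= 1.
Proof.
  apply Rle_trans with (cellw 0).
  - induction n as [|n IH]; [lra|]. pose proof (cellw_dec n). lra.
  - unfold cellw. simpl (INR 0). rewrite Rmult_0_l. apply RInt_density_le1; [easy|].
    pose proof (cell_le 0). lra.
Qed.

Definition dsum (u : Z -> R) (i : Z) : R :=
  Series (fun n => cellw n * u (i + Z.of_nat n)%Z).

Lemma cellw_mult_ex_series u H : (forall n, Rabs (u n) <= H) ->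
  ex_series (fun n => cellw n * u n).
Proof.
  intros HH. apply (ex_series_le (V := R_CompleteNormedModule) _ (fun n => cellw n * H)).
  - intros n. change (Rabs (cellw n * u n) <= cellw n * H).
    rewrite Rabs_mult, (Rabs_pos_eq (cellw n)) by apply cellw_pos.
    apply Rmult_le_compat_l; [apply cellw_pos|apply HH].
  - apply (ex_series_scal_r H). eexists; apply cellw_series.
Qed.

Lemma cellw_incr_series : is_series (fun n => cellw n - cellw (S n)) (cellw 0).
Proof.
  pose proof cellw_series as A.
  pose proof (is_series_incr_1 cellw (1 - cellw 0)) as B.
  assert (B' : is_series (fun n => cellw (S n)) (1 - cellw 0)).
  { apply B. refine (eq_ind 1 (fun x : R => is_series cellw x) A _ _).
    change (1 = 1 - cellw 0 + cellw 0). ring. }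
  pose proof (is_series_minus _ _ _ _ A B') as C.
  refine (eq_ind _ (fun x : R => is_series _ x) C _ _).
  change (1 - (1 - cellw 0) = cellw 0). ring.
Qed.

Lemma cellw_incr_mult_ex_series u H : (forall n, Rabs (u n) <= H) ->
  ex_series (fun n => (cellw n - cellw (S n)) * u n).
Proof.
  intros HH. apply (ex_series_le (V := R_CompleteNormedModule) _ (fun n => (cellw n - cellw (S n)) * H)).
  - intros n. change (Rabs ((cellw n - cellw (S n)) * u n) <= (cellw n - cellw (S n)) * H).
    pose proof (cellw_dec n).
    rewrite Rabs_mult, (Rabs_pos_eq (cellw n - _)) by lra.
    apply Rmult_le_compat_l; [lra|apply HH].
  - apply (ex_series_scal_r H). eexists; apply cellw_incr_series.
Qed.

(** Summation by parts. Since the weights decrease, only [u i] can have a negative coefficient,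
    [- cellw 0]; the other coefficients are non-negative with total [cellw 0]. The stability of the
    scheme rests on this. *)
Lemma dsum_diff u H i : (forall j, Rabs (u j) <= H) ->
  dsum u (i + 1) - dsum u i
  = - cellw 0 * u i + Series (fun n => (cellw n - cellw (S n)) * u (i + 1 + Z.of_nat n)%Z).
Proof.
  intros HH. unfold dsum at 2.
  rewrite Series_incr_1 by (apply (cellw_mult_ex_series (fun n => u (i + Z.of_nat n)%Z) H); intros; apply HH).
  assert (E : Series (fun n => (cellw n - cellw (S n)) * u (i + 1 + Z.of_nat n)%Z) =
    dsum u (i + 1) - Series (fun n => cellw (S n) * u (i + 1 + Z.of_nat n)%Z)).
  { unfold dsum. rewrite <- Series_minus.
    - apply Series_ext. intros n. ring.
    - apply (cellw_mult_ex_series (fun n => u (i + 1 + Z.of_nat n)%Z) H); intros; apply HH.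
    - apply (ex_series_ext (fun n => cellw (S n) * u (i + Z.of_nat (S n))%Z)).
      { intros n. do 2 f_equal. lia. }
      apply (ex_series_incr_1 (fun n => cellw n * u (i + Z.of_nat n)%Z)).
      apply (cellw_mult_ex_series (fun n => u (i + Z.of_nat n)%Z) H); intros; apply HH. }
  rewrite E. simpl (Z.of_nat 0). rewrite Z.add_0_r.
  rewrite (Series_ext (fun n => cellw (S n) * u (i + 1 + Z.of_nat n)%Z)
    (fun n => cellw (S n) * u (i + Z.of_nat (S n))%Z)).
  - ring.
  - intros n. do 2 f_equal. lia.
Qed.

Lemma Series_le_bounded a b : ex_series a -> ex_series b -> (forall n, a n <= b n) ->
  Series a <= Series b.
Proof.
  intros Ha Hb H.
  pose proof (partial_sums_series _ _ (Series_correct _ Ha)) as A.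
  pose proof (partial_sums_series _ _ (Series_correct _ Hb)) as B.
  apply (is_lim_seq_le _ _ (Series a) (Series b)) with (2 := A) (3 := B).
  intros n. apply sum_Rle. intros; apply H.
Qed.

(** Bounding every value to the right of [i] below by [m] leaves exactly [cellw 0 * m], because of
    the total of the coefficients. *)
Lemma dsum_diff_ge u H m i : (forall j, Rabs (u j) <= H) -> (forall j, m <= u j) ->
  - cellw 0 * (u i - m) <= dsum u (i + 1) - dsum u i.
Proof.
  intros HH Hm. rewrite (dsum_diff u H) by easy.
  assert (A : Series (fun n => (cellw n - cellw (S n)) * m)
    <= Series (fun n => (cellw n - cellw (S n)) * u (i + 1 + Z.of_nat n)%Z)).
  { apply Series_le_bounded.
    - apply (cellw_incr_mult_ex_series (fun _ => m) (Rabs m)). intros; lra.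
    - apply (cellw_incr_mult_ex_series (fun n => u (i + 1 + Z.of_nat n)%Z) H). intros; apply HH.
    - intros n. pose proof (cellw_dec n). apply Rmult_le_compat_l; [lra|apply Hm]. }
  rewrite Series_scal_r, (is_series_unique _ _ cellw_incr_series) in A. lra.
Qed.

(** Discrete counterpart of [kavg_translate_le] for a shift by one cell: the coefficients in
    [dsum_diff] have absolute sum [2 * cellw 0], at most [2 * k 0 * d]. *)
Lemma dsum_diff_bound u D i : (forall j, Rabs (u j) <= D) ->
  Rabs (dsum u (i + 1) - dsum u i) <= 2 * k 0 * d * D.
Proof.
  intros HD.
  assert (HD0 : 0 <= D) by (pose proof (HD 0%Z); pose proof (Rabs_pos (u 0%Z)); lra).
  assert (A : forall v, (forall j, Rabs (v j) <= D) -> - (2 * k 0 * d * D) <= dsum v (i + 1) - dsum v i).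
  { intros v Hv. pose proof (dsum_diff_ge v D (- D) i Hv) as A.
    assert (A' := A ltac:(intros j; specialize (Hv j); apply Rabs_le_between in Hv; lra)).
    pose proof cellw_0. pose proof (cellw_pos 0). specialize (Hv i).
    apply Rabs_le_between in Hv. nra. }
  pose proof (A u HD) as B.
  assert (C := A (fun j => - u j) ltac:(intros j; cbv beta; rewrite Rabs_Ropp; apply HD)).
  assert (E : forall i, dsum (fun j => - u j) i = - dsum u i).
  { intros l. unfold dsum. rewrite <- Series_opp. apply Series_ext. intros; ring. }
  rewrite !E in C. apply Rabs_le. lra.
Qed.

Lemma dsum_minus u v H G i : (forall j, Rabs (u j) <= H) -> (forall j, Rabs (v j) <= G) ->
  dsum (fun j => u j - v j) i = dsum u i - dsum v i.
Proof.
  intros Hu Hv. unfold dsum. rewrite <- Series_minus.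
  - apply Series_ext. intros n. ring.
  - apply (cellw_mult_ex_series (fun n => u (i + Z.of_nat n)%Z) H); intros; apply Hu.
  - apply (cellw_mult_ex_series (fun n => v (i + Z.of_nat n)%Z) G); intros; apply Hv.
Qed.

Lemma kavg_cells g H z : DM g -> bounded_by H g ->
  is_lim_seq (sum_f_R0 (fun n => RInt (fun x => k x * g (z + x)) (INR n * d) (INR (S n) * d)))
    (kavg k g z).
Proof.
  intros Hg HH.
  apply (is_lim_seq_ext (fun n => RInt (fun x => k x * g (z + x)) 0 (INR (S n) * d))).
  - intros n. symmetry. apply (sum_cells (fun x => k x * g (z + x))). intros a b Ha Hb.
    apply (ex_RInt_kmult k Hk (fun x => g (z + x))); [now apply DM_shift|easy|easy].
  - apply is_lim_seq_cells. now apply (kavg_is_lim k Hk g H).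
Qed.

(** The left edge z_{i-1/2} of cell i, not its centre z_i: the averages of the scheme start at left
    edges, and errors are measured there. *)
Definition gridpt (i : Z) : R := (IZR i - 1) * d.

Lemma gridpt_add i n : gridpt (i + Z.of_nat n) = gridpt i + INR n * d.
Proof. unfold gridpt. rewrite plus_IZR, <- INR_IZR_INZ. ring. Qed.

Lemma gridpt_succ i : gridpt (i + 1) = gridpt i + d.
Proof. unfold gridpt. rewrite plus_IZR. ring. Qed.

(** On functions constant inside each cell the quadrature is exact, since the weights are the
    integrals of [k] over cells. This turns discrete sums into averages of step functions. *)
Lemma dsum_step_function g H i : DM g -> bounded_by H g ->
  (forall j x, gridpt j < x < gridpt (j + 1) -> g x = g (gridpt j)) ->
  dsum (fun j => g (gridpt j)) i = kavg k g (gridpt i).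
Proof.
  intros Hg HH Hc. apply is_series_unique, series_partial_sums.
  apply is_lim_seq_ext with (2 := kavg_cells g H (gridpt i) Hg HH).
  intros n. apply sum_eq. intros m _.
  pose proof (cell_le m) as Hm.
  rewrite (Rmult_comm (cellw m)). unfold cellw. rewrite <- RInt_scal_R by (apply ex_RInt_density; [easy|lra|lra]).
  apply RInt_ext. intros x Hx. rewrite Rmin_left, Rmax_right in Hx by lra.
  rewrite (Hc (i + Z.of_nat m)%Z).
  - ring_R.
  - rewrite gridpt_succ, gridpt_add. rewrite S_INR in Hx. lra.
Qed.

Definition gridfloor (x : R) : R := IZR (Int_part (x / d)) * d.

Lemma Int_part_le x y : x <= y -> (Int_part x <= Int_part y)%Z.
Proof.
  intros H. pose proof (base_Int_part x). pose proof (base_Int_part y).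
  assert (Int_part x < Int_part y + 1)%Z; [|lia].
  apply lt_IZR. rewrite plus_IZR. lra.
Qed.

Lemma gridfloor_incr : incr gridfloor.
Proof.
  intros x y H. unfold gridfloor. apply Rmult_le_compat_r; [lra|].
  apply IZR_le, Int_part_le. unfold Rdiv. apply Rmult_le_compat_r; [|easy].
  apply Rlt_le, Rinv_0_lt_compat, Hd.
Qed.

Lemma gridfloor_cell j x : gridpt j <= x < gridpt (j + 1) -> gridfloor x = gridpt j.
Proof.
  intros H. unfold gridfloor, gridpt in *. rewrite plus_IZR in H.
  rewrite <- (Int_part_spec (x / d) (j - 1)).
  - now rewrite minus_IZR.
  - rewrite minus_IZR.
    assert (E : x / d * d = x) by (field; lra). split.
    + apply Rmult_lt_reg_r with d; [easy|]. rewrite Rmult_minus_distr_r, E. lra.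
    + apply Rmult_le_reg_r with d; [easy|]. rewrite E. lra.
Qed.

Lemma gridfloor_close x : Rabs (gridfloor x - x) <= d.
Proof.
  unfold gridfloor. pose proof (base_Int_part (x / d)).
  assert (E : x / d * d = x) by (field; lra).
  replace (IZR (Int_part (x / d)) * d - x) with ((IZR (Int_part (x / d)) - x / d) * d).
  2: { rewrite Rmult_minus_distr_r, E. easy. }
  apply Rabs_le. nra.
Qed.

(* Sampling [h] on the grid changes it by at most [L d] in sup norm, and the
   increment of an average over one cell gains another factor [d]. *)
Lemma dsum_consistent h H L i : Lip L h -> bounded_by H h ->
  Rabs (dsum (fun j => h (gridpt j)) (i + 1) - dsum (fun j => h (gridpt j)) i
    - (kavg k h (gridpt (i + 1)) - kavg k h (gridpt i))) <= 2 * k 0 * L * (d * d).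
Proof.
  intros HL HH.
  set (g := fun x => h (gridfloor x)).
  assert (Hh : DM h) by now apply (Lip_DM L).
  assert (Hg : DM g) by (apply (DM_comp h gridfloor); [easy|apply gridfloor_incr]).
  assert (HG : bounded_by H g) by (intros x; apply HH).
  assert (Hgp : forall j, g (gridpt j) = h (gridpt j)).
  { intros j. unfold g. rewrite (gridfloor_cell j (gridpt j)); [easy|]. rewrite gridpt_succ. lra. }
  assert (E : forall j, dsum (fun j => h (gridpt j)) j = kavg k g (gridpt j)).
  { intros j. rewrite <- (dsum_step_function g H j Hg HG).
    - unfold dsum. apply Series_ext. intros n. now rewrite Hgp.
    - intros l x Hx. rewrite Hgp. unfold g. rewrite (gridfloor_cell l x); [easy|lra]. }
  rewrite !E, gridpt_succ.
  assert (B := kavg_translate_le k Hk (fun x => g x - h x) (L * d) (gridpt i) d).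
  rewrite !(kavg_minus k Hk g h H H) in B by easy.
  match type of B with _ -> _ -> _ -> Rabs ?e <= _ =>
    match goal with |- Rabs ?e' <= _ => replace e' with e by ring end end.
  apply Rle_trans with (2 * k 0 * (L * d) * d); [|right; ring].
  apply B; [now apply DM_minus| |lra].
  intros x. unfold g. eapply Rle_trans; [apply HL|].
  apply Rmult_le_compat_l; [exact (Lip_nonneg _ _ HL)|apply gridfloor_close].
Qed.

Definition cellmean (f : R -> R) (i : Z) : R := / d * RInt f (gridpt i) (gridpt (i + 1)).

Lemma cellmean_bound f H i : DM f -> bounded_by H f -> Rabs (cellmean f i) <= H.
Proof.
  intros Hf HH. unfold cellmean. rewrite gridpt_succ, Rabs_mult, Rabs_inv, (Rabs_pos_eq d) by lra.
  apply Rmult_le_reg_l with d; [easy|]. rewrite <- Rmult_assoc, Rinv_r, Rmult_1_l by lra.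
  eapply Rle_trans; [apply (abs_RInt_le_const _ _ _ H)|].
  - lra.
  - now apply ex_RInt_DM.
  - intros; apply HH.
  - lra.
Qed.

Lemma cellmean_ge f m i : DM f -> (forall x, m <= f x) -> m <= cellmean f i.
Proof.
  intros Hf Hm. unfold cellmean. rewrite gridpt_succ.
  apply Rmult_le_reg_l with d; [easy|]. rewrite <- Rmult_assoc, Rinv_r, Rmult_1_l by lra.
  replace (d * m) with (RInt (fun _ => m) (gridpt i) (gridpt i + d)) by (rewrite RInt_const_R; ring_R).
  apply RInt_le; [lra|apply ex_RInt_const|now apply ex_RInt_DM|intros; apply Hm].
Qed.

Lemma dsum_ge u H m i : (forall j, Rabs (u j) <= H) -> (forall j, m <= u j) -> m <= dsum u i.
Proof.
  intros HH Hm. unfold dsum.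
  replace m with (Series (fun n => cellw n * m)).
  2: { rewrite Series_scal_r, (is_series_unique _ _ cellw_series). ring. }
  apply Series_le_bounded.
  - apply (cellw_mult_ex_series (fun _ => m) (Rabs m)). intros; lra.
  - apply (cellw_mult_ex_series (fun n => u (i + Z.of_nat n)%Z) H). intros; apply HH.
  - intros n. apply Rmult_le_compat_l; [apply cellw_pos|apply Hm].
Qed.

(** Here the kernel is discretized instead of [f]: on each cell [k] is replaced by its mean, and
    both lie between the end values of the monotone [k]. The cell errors, [H * d] times the drop of
    [k] across the cell, telescope to at most [H * k 0 * d], with no Lipschitz bound on [f]. *)
Lemma dsum_cellmean_consistent f H i : DM f -> bounded_by H f ->
  Rabs (dsum (cellmean f) i - kavg k f (gridpt i)) <= H * k 0 * d.
Proof.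
  intros Hf HH.
  assert (H0 : 0 <= H) by exact (bounded_by_nonneg _ _ HH).
  assert (A : ex_series (fun n => cellw n * cellmean f (i + Z.of_nat n))).
  { apply (cellw_mult_ex_series (fun n => cellmean f (i + Z.of_nat n)) H).
    intros; now apply cellmean_bound. }
  pose proof (partial_sums_series _ _ (Series_correct _ A)) as L1.
  pose proof (kavg_cells f H (gridpt i) Hf HH) as L2.
  apply (is_lim_seq_minus_le _ _ _ _ _ L1 L2). intros n.
  apply Rle_trans with (H * d * (k 0 - k (INR (S n) * d))).
  2: { assert (0 <= k (INR (S n) * d)) by (apply Hk; apply Rmult_le_pos; [apply pos_INR|lra]).
       assert (0 <= H * d) by nra. nra. }
  assert (C : forall m, Rabs (cellw m * cellmean f (i + Z.of_nat m)
      - RInt (fun x => k x * f (gridpt i + x)) (INR m * d) (INR (S m) * d))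
      <= H * d * (k (INR m * d) - k (INR (S m) * d))).
  { intros m. pose proof (cell_le m) as Hm.
    assert (Hfs : DM (fun x => f (gridpt i + x))) by now apply DM_shift.
    assert (E : cellmean f (i + Z.of_nat m) = / d * RInt (fun x => f (gridpt i + x)) (INR m * d) (INR (S m) * d)).
    { unfold cellmean. f_equal. rewrite gridpt_succ, gridpt_add.
      destruct (RInt_translate f (gridpt i) (INR m * d) (INR (S m) * d)) as [_ T].
      { now apply ex_RInt_DM. }
      rewrite (RInt_ext (fun x => f (gridpt i + x)) (fun x => f (x + gridpt i))).
      - rewrite T. f_equal; rewrite ?S_INR; ring.
      - intros; f_equal; ring_R. }
    assert (Ik : ex_RInt (fun x => k x * f (gridpt i + x)) (INR m * d) (INR (S m) * d)).
    { apply (ex_RInt_kmult k Hk (fun x => f (gridpt i + x))); [easy|lra|lra]. }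
    rewrite E.
    (* The factor [/ d] is moved from the mean of [f] to the mean of the kernel. *)
    replace (cellw m * (/ d * RInt (fun x => f (gridpt i + x)) (INR m * d) (INR (S m) * d)))
      with (RInt (fun x => cellw m / d * f (gridpt i + x)) (INR m * d) (INR (S m) * d)).
    2: { rewrite RInt_scal_R by now apply ex_RInt_DM. unfold Rdiv. ring_R. }
    rewrite <- RInt_minus_R; [|now apply ex_RInt_scal_R, ex_RInt_DM|easy].
    replace (H * d * (k (INR m * d) - k (INR (S m) * d)))
      with ((INR (S m) * d - INR m * d) * (H * (k (INR m * d) - k (INR (S m) * d))))
      by (rewrite (S_INR m); ring).
    apply abs_RInt_le_const; [lra| |].
    - apply ex_RInt_minus_R; [now apply ex_RInt_scal_R, ex_RInt_DM|easy].
    - intros x Hx. rewrite <- Rmult_minus_distr_r, Rabs_mult, Rmult_comm.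
      apply Rmult_le_compat; [apply Rabs_pos|apply Rabs_pos|apply HH|].
      pose proof (cellw_between m) as [B1 B2].
      assert (k (INR (S m) * d) <= cellw m / d) by (apply Rle_div_r; lra).
      assert (cellw m / d <= k (INR m * d)) by (apply Rle_div_l; lra).
      assert (k x <= k (INR m * d)) by (apply Hk; lra).
      assert (k (INR (S m) * d) <= k x) by (apply Hk; lra).
      apply Rabs_le. lra. }
  induction n as [|n IH].
  - cbn [sum_f_R0]. specialize (C 0%nat). simpl (INR 0) in C. rewrite Rmult_0_l in C.
    simpl (INR 0). rewrite Rmult_0_l. exact C.
  - cbn [sum_f_R0]. specialize (C (S n)).
    match goal with |- Rabs ?e <= _ => match type of C with Rabs ?e1 <= _ =>
      match type of IH with Rabs ?e2 <= _ => replace e with (e2 + e1) by ring_R end end end.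
    eapply Rle_trans; [apply Rabs_triang|]. lra.
Qed.

End Discrete.

(** * Flux, stability and convergence of the scheme *)

Lemma density_Phia Phi alpha : kernel_hyp Phi -> 0 < alpha -> density (Phia Phi alpha).
Proof.
  intros [H1 [H2 [H3 _]]] Ha.
  assert (Hia : 0 < / alpha) by now apply Rinv_0_lt_compat.
  assert (Hdiv : forall x, 0 <= x -> 0 <= x / alpha).
  { intros x Hx. apply Rmult_le_pos; lra. }
  repeat split.
  - intros x Hx. unfold Phia. apply Rmult_le_pos; [lra|]. now apply H1, Hdiv.
  - intros x y Hx Hxy. unfold Phia. apply Rmult_le_compat_l; [lra|].
    apply H2; [now apply Hdiv|]. apply Rmult_le_compat_r; lra.
  - assert (HD : DM (fun x => Phi (Rmax 0 x))).
    { exists (fun _ => 0), (fun x => - Phi (Rmax 0 x)). repeat split.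
      - intros x y _; lra.
      - intros x y Hxy. apply Ropp_le_contravar, H2; [apply Rmax_l|]. now apply Rle_max_compat_l.
      - intros; ring. }
    assert (Hex : forall b, 0 <= b -> ex_RInt Phi 0 b).
    { intros b Hb. apply (ex_RInt_ext (fun x => Phi (Rmax 0 x))); [|now apply ex_RInt_DM].
      intros x Hx. rewrite Rmin_left in Hx by lra. now rewrite Rmax_right by lra. }
    apply is_RInt_gen_is_lim in H3; [|easy].
    intros P HP. destruct (H3 P HP) as [M HM]. exists (Rmax 0 (M * alpha)). intros b Hb.
    pose proof (Rmax_l 0 (M * alpha)). pose proof (Rmax_r 0 (M * alpha)).
    replace (RInt (Phia Phi alpha) 0 b) with (RInt Phi 0 (b / alpha)).
    + apply HM. apply Rlt_div_r; lra.
    + pose proof (RInt_comp_lin (V := R_CompleteNormedModule) Phi (/ alpha) 0 0 b) as E.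
      rewrite Rmult_0_r, Rplus_0_r, Rplus_0_r in E.
      replace (b / alpha) with (/ alpha * b) by (unfold Rdiv; ring).
      rewrite <- E.
      * apply RInt_ext. intros x _. unfold scal; simpl; unfold mult; simpl. unfold Phia.
        f_equal. f_equal. unfold Rdiv. ring_R.
      * apply Hex. apply Rmult_le_pos; lra.
Qed.

(* Truncation at 1 makes the flux globally Lipschitz; solutions stay above 1. *)
Definition flux (V : R -> R) (w : R) : R := Wf V (Rmax 1 w).

Lemma flux_eq V w : 1 <= w -> flux V w = Wf V w.
Proof. intros H. unfold flux. now rewrite Rmax_right. Qed.

(** For w >= 1 the argument 1/w lies in (0, 1], where the monotone [V] stays between [V 1] and
    [V 0]. *)
Lemma flux_bounded V : nonincr_nonneg V -> bounded_by (Rabs (V 0) + Rabs (V 1)) (flux V).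
Proof.
  intros HV w. unfold flux, Wf.
  assert (H1 : 1 <= Rmax 1 w) by apply Rmax_l.
  assert (H2 : 0 < / Rmax 1 w) by (apply Rinv_0_lt_compat; lra).
  assert (H3 : / Rmax 1 w <= 1) by (rewrite <- Rinv_1 at 2; apply Rinv_le_contravar; lra).
  pose proof (HV 0 (/ Rmax 1 w) ltac:(lra) ltac:(lra)).
  pose proof (HV (/ Rmax 1 w) 1 ltac:(lra) ltac:(lra)).
  pose proof (Rle_abs (V 0)). pose proof (Rle_abs (- V 1)). rewrite Rabs_Ropp in *.
  pose proof (Rabs_pos (V 0)). pose proof (Rabs_pos (V 1)). apply Rabs_le. lra.
Qed.

Lemma Lip_of_ordered L h : 
  (forall x y, x <= y -> Rabs (h y - h x) <= L * (y - x)) -> Lip L h.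
Proof.
  intros H x y. destruct (Rle_dec x y).
  - rewrite Rabs_minus_sym, (Rabs_minus_sym x), (Rabs_pos_eq (y - x)) by lra. now apply H.
  - rewrite (Rabs_pos_eq (x - y)) by lra. apply H. lra.
Qed.

Lemma Lip_Rmax1 : Lip 1 (Rmax 1).
Proof.
  apply Lip_of_ordered. intros x y Hxy. unfold Rmax.
  destruct (Rle_dec 1 x), (Rle_dec 1 y); apply Rabs_le; lra.
Qed.

(** Precomposing with [Rmax 0] turns continuity relative to [0, oo) into ordinary continuity, to
    which the extreme value theorem on [0, 1] applies. *)
Lemma C1_deriv_bounded (dV : R -> R) :
  (forall x, 0 <= x -> filterlim dV (within (fun y => 0 <= y) (locally x)) (locally (dV x))) ->
  exists L, forall x, 0 <= x <= 1 -> Rabs (dV x) <= L.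
Proof.
  intros H. set (f := fun x => Rabs (dV (Rmax 0 x))).
  assert (Hf : forall c, 0 <= c <= 1 -> continuity_pt f c).
  { intros c Hc. apply continuity_pt_filterlim. unfold f.
    apply (filterlim_comp _ _ _ (fun x => dV (Rmax 0 x)) Rabs _ (locally (dV c))).
    - apply (filterlim_comp _ _ _ (Rmax 0) dV _ (within (fun y => 0 <= y) (locally c))); [|now apply H].
      intros P HP.
      assert (Hm : filterlim (Rmax 0) (locally c) (locally (Rmax 0 c))).
      { exact (Lip_continuous 1 (Rmax 0) c Lip_Rmax0). }
      rewrite Rmax_right in Hm by easy.
      specialize (Hm _ HP). unfold filtermap in *. revert Hm. apply filter_imp.
      intros x Hx. apply Hx, Rmax_l.
    - rewrite Rmax_right by easy. apply (filterlim_Rabs (Finite _)). }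
  destruct (continuity_ab_maj f 0 1 ltac:(lra) Hf) as [M [HM _]].
  exists (f M). intros x Hx. specialize (HM x Hx). unfold f in HM at 1.
  now rewrite Rmax_right in HM.
Qed.

(** Inversion is 1-Lipschitz on [1, oo), so a bound for the derivative of [V] on [0, 1] is a
    Lipschitz constant of the flux. *)
Lemma flux_Lip V : C1_nonneg V -> exists L, Lip L (flux V).
Proof.
  intros [dV [H1 [_ H3]]].
  destruct (C1_deriv_bounded dV H3) as [L HL].
  assert (HL0 : 0 <= L) by (pose proof (HL 0); pose proof (Rabs_pos (dV 0)); lra).
  exists L.
  apply Lip_of_ordered. intros x y Hxy. unfold flux, Wf.
  set (a := Rmax 1 x). set (b := Rmax 1 y).
  assert (Ha : 1 <= a) by apply Rmax_l.
  assert (Hab : a <= b) by now apply Rle_max_compat_l.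
  assert (Hba : b - a <= y - x).
  { pose proof (Lip_Rmax1 y x) as H. fold a b in H. rewrite !Rabs_pos_eq in H; lra. }
  assert (Ha' : 0 < / a <= 1).
  { split; [apply Rinv_0_lt_compat; lra|]. rewrite <- Rinv_1. apply Rinv_le_contravar; lra. }
  assert (Hb' : 0 < / b <= / a).
  { split; [apply Rinv_0_lt_compat; lra|]. apply Rinv_le_contravar; lra. }
  destruct (MVT_gen V (/ b) (/ a) dV) as [c [Hc E]].
  - intros t Ht. rewrite Rmin_left in Ht by lra. apply H1. lra.
  - intros t Ht. rewrite Rmin_left in Ht by lra. apply continuity_pt_filterlim.
    apply (ex_derive_continuous (V := R_NormedModule)). exists (dV t). apply H1. lra.
  - rewrite Rmin_left, Rmax_right in Hc by lra.
    rewrite Rabs_minus_sym, E, Rabs_mult, (Rabs_pos_eq (/ a - / b)) by lra.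
    apply Rmult_le_compat; [apply Rabs_pos|lra|apply HL; lra|].
    apply Rle_trans with (b - a); [|easy].
    replace (/ a - / b) with ((b - a) * (/ a * / b)) by (field; lra).
    rewrite <- (Rmult_1_r (b - a)) at 2. apply Rmult_le_compat_l; [lra|].
    rewrite <- (Rmult_1_r 1). apply Rmult_le_compat; lra.
Qed.

(* The CFL condition keeps the scheme above 1. *)
Lemma Wf_CFL V c w : C1_nonneg V -> (forall w, 1 <= w -> 0 <= c * Derive (Wf V) w <= 1) ->
  1 <= w -> c * (Wf V w - Wf V 1) <= w - 1.
Proof.
  intros [dV [H1 _]] HC Hw.
  assert (Hd : forall x, 1 <= x -> ex_derive (Wf V) x).
  { intros x Hx. unfold Wf. apply (ex_derive_comp V Rinv).
    - exists (dV (/ x)). apply H1, Rinv_0_lt_compat. lra.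
    - auto_derive. lra. }
  destruct (MVT_gen (Wf V) 1 w (Derive (Wf V))) as [x [Hx E]].
  - intros t Ht. rewrite Rmin_left in Ht by lra. apply Derive_correct, Hd. lra.
  - intros t Ht. rewrite Rmin_left in Ht by lra. apply continuity_pt_filterlim.
    apply (ex_derive_continuous (V := R_NormedModule)), Hd. lra.
  - rewrite Rmin_left in Hx by lra. rewrite E, <- Rmult_assoc.
    pose proof (HC x ltac:(lra)). nra.
Qed.

(** * Lower bound for the scheme and its error against the ODE solution *)

Section Scheme.

Variables (Phi V y0 : R -> R) (alpha dt dz H LG HG : R).
Hypothesis hPhi : kernel_hyp Phi.
Hypothesis hV : C1_nonneg V.
Hypothesis hVdec : nonincr_nonneg V.
Hypothesis halpha : 0 < alpha.
Hypothesis Hdt : 0 < dt.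
Hypothesis Hdz : 0 < dz.
Hypothesis Hy0 : DM y0.
Hypothesis Hy0H : bounded_by H y0.
Hypothesis Hy0ge : forall z, 1 <= y0 z.
Hypothesis HCFL : forall w, 1 <= w -> 0 <= dt / dz * Derive (Wf V) w <= 1.
Hypothesis HLG : Lip LG (flux V).
Hypothesis HHG : bounded_by HG (flux V).

Let k := Phia Phi alpha.
Let Hk : density k := density_Phia Phi alpha hPhi halpha.
Let w := wsch Phi V y0 alpha dt dz.

Lemma sum_ge_dsum u i : sum_ge Phi alpha dz u i = dsum k dz u i.
Proof.
  unfold sum_ge, dsum. apply Series_ext. intros n. f_equal.
  unfold Phi_ij, cellw, zpt. rewrite plus_IZR, <- INR_IZR_INZ.
  set (c := (IZR i - / 2 - / 2) * dz).
  pose proof (cell_le dz Hdz n).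
  destruct (RInt_translate k (- c) (INR n * dz + c) (INR (S n) * dz + c)) as [_ E].
  { apply ex_RInt_density; [easy|lra|lra]. }
  replace (INR n * dz + c + - c) with (INR n * dz) in E by ring.
  replace (INR (S n) * dz + c + - c) with (INR (S n) * dz) in E by ring.
  rewrite <- E. unfold Rminus at 1.
  f_equal; unfold c; rewrite ?S_INR; field.
Qed.

Lemma y0cell_cellmean i : y0cell y0 dz i = cellmean dz y0 i.
Proof.
  unfold y0cell, cellmean, zpt, gridpt. rewrite plus_IZR. do 2 f_equal; field.
Qed.

Lemma wsch_0 i : w 0%nat i = dsum k dz (cellmean dz y0) i.
Proof.
  unfold w. simpl. rewrite sum_ge_dsum. unfold dsum. apply Series_ext. intros n.
  now rewrite y0cell_cellmean.
Qed.

(** The two claims are intertwined: the flux may be truncated in the update only at a level whose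
    values are at least 1. In one step [w n i] loses at most [dt / dz * cellw 0] times
    [flux V (w n i) - flux V 1]; by [cellw 0 <= 1] and [Wf_CFL] this is at most [w n i - 1]. *)
Lemma wsch_ge_1_and_step n : (forall i, 1 <= w n i) /\
  (forall i, w (S n) i = w n i + dt / dz *
    (dsum k dz (fun j => flux V (w n j)) (i + 1) - dsum k dz (fun j => flux V (w n j)) i)).
Proof.
  assert (Hl : 0 < dt / dz) by now apply Rdiv_lt_0_compat.
  assert (Hstep : forall n, (forall i, 1 <= w n i) ->
    (forall i, w (S n) i = w n i + dt / dz *
    (dsum k dz (fun j => flux V (w n j)) (i + 1) - dsum k dz (fun j => flux V (w n j)) i))).
  { clear n. intros n Hn i. unfold w. simpl. rewrite !sum_ge_dsum.
    assert (E : (fun j => Wf V (wsch Phi V y0 alpha dt dz n j)) = (fun j => flux V (w n j))).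
    { apply functional_extensionality. intros j. symmetry. apply flux_eq, Hn. }
    now rewrite E. }
  assert (Hge : forall i, 1 <= w n i).
  { induction n as [|n IH]; intros i.
    - rewrite wsch_0. apply (dsum_ge k dz Hk Hdz _ H).
      + intros j. now apply cellmean_bound.
      + intros j. now apply cellmean_ge.
    - rewrite (Hstep n IH).
      assert (A := dsum_diff_ge k dz Hk Hdz (fun j => flux V (w n j)) HG (flux V 1) i).
      assert (Hmon : forall j, flux V 1 <= flux V (w n j)).
      { intros j. rewrite !flux_eq by (try apply IH; lra). unfold Wf.
        specialize (IH j). apply hVdec.
        - apply Rlt_le, Rinv_0_lt_compat; lra.
        - apply Rinv_le_contravar; lra. }
      specialize (A ltac:(intros j; apply HHG) Hmon).
      assert (B := Wf_CFL V (dt / dz) (w n i) hV HCFL (IH i)).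
      rewrite <- (flux_eq V 1), <- (flux_eq V (w n i)) in B by (try apply IH; lra).
      pose proof (cellw_pos k dz Hk Hdz 0). pose proof (cellw_le_1 k dz Hk Hdz 0).
      specialize (Hmon i). specialize (IH i).
      set (p := cellw k dz 0) in *. set (D := flux V (w n i) - flux V 1) in *.
      set (X := dsum _ _ _ (i + 1)%Z - dsum _ _ _ i) in *.
      assert (0 <= dt / dz * D) by (apply Rmult_le_pos; unfold D; lra).
      assert (dt / dz * (- p * D) <= dt / dz * X) by (apply Rmult_le_compat_l; lra).
      nra. }
  split; [easy|]. now apply Hstep.
Qed.

Variables (L0 T1 Wm : R).
Let w0 := kavg k y0.
Hypothesis Hw0 : Lip L0 w0.
Let W := evol k (flux V) w0.
Hypothesis HWm : forall t, t <= T1 -> weight k LG t <= Wm.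

Let c := rate k LG.
Let sp := speed k HG.
Let Lz := 2 * L0 * Wm.

Lemma evol_Lip_z t : t <= T1 -> Lip Lz (fun z => W z t).
Proof.
  intros Ht. apply Lip_le with (2 * L0 * weight k LG t).
  - pose proof (Lip_nonneg _ _ Hw0). apply Rmult_le_compat_l; [lra|now apply HWm].
  - apply (evol_regular k (flux V) w0 LG HG L0 Hk HLG HHG Hw0).
Qed.

Lemma evol_Lip_t z : Lip sp (W z).
Proof. apply (evol_regular k (flux V) w0 LG HG L0 Hk HLG HHG Hw0). Qed.

Lemma euler_consistent z t : 0 <= t -> t <= T1 ->
  Rabs (W z (t + dt) - W z t - dt * rhs k (flux V) (fun x => W x t) z) <= c * sp * dt * dt.
Proof.
  intros Ht HtT. pose proof (evol_regular k (flux V) w0 LG HG L0 Hk HLG HHG Hw0) as Hreg.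
  unfold W. rewrite (evol_increment k (flux V) w0 LG HG L0) by (try easy; lra).
  set (r := fun s => rhs k (flux V) (fun x => evol k (flux V) w0 x s) z).
  assert (Hr : Lip (c * sp) r) by exact (rhs_time_Lip k (flux V) LG HG L0 Hk HLG HHG _ z Hreg).
  change (Rabs (RInt r t (t + dt) - dt * r t) <= c * sp * dt * dt).
  replace (dt * r t) with (RInt (fun _ => r t) t (t + dt)) by (rewrite RInt_const_R; ring_R).
  rewrite <- RInt_minus_R; [|now apply (Lip_ex_RInt (c * sp))|apply ex_RInt_const].
  replace (c * sp * dt * dt) with ((t + dt - t) * (c * sp * dt)) by ring.
  apply abs_RInt_le_const; [lra| |].
  - apply ex_RInt_minus_R; [now apply (Lip_ex_RInt (c * sp))|apply ex_RInt_const].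
  - intros s Hs. eapply Rle_trans; [apply Hr|].
    apply Rmult_le_compat_l; [exact (Lip_nonneg _ _ Hr)|]. rewrite Rabs_pos_eq; lra.
Qed.

(** The increments of scheme and ODE are compared in four stages: propagated error [S1 - S2],
    sampling of the flux [S2 - F], difference quotient against derivative [F - dz * r], and explicit
    Euler in time. The first is of order [dz * E] and the next two of order [dz * dz], so the factor
    [dt / dz] leaves [dt * E] and [dt * dz]. *)
Lemma scheme_step_error n E : 0 <= INR n * dt <= T1 ->
  (forall i, Rabs (w n i - W (gridpt dz i) (INR n * dt)) <= E) ->
  forall i, Rabs (w (S n) i - W (gridpt dz i) (INR (S n) * dt))
    <= E + c * dt * (E + (2 * Lz * dz + sp * dt)).
Proof.
  intros Hn HE i. destruct (wsch_ge_1_and_step n) as [Hge Hst]. rewrite Hst.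
  set (t := INR n * dt) in *.
  replace (INR (S n) * dt) with (t + dt) by (rewrite S_INR; unfold t; ring).
  assert (HE0 : 0 <= E).
  { specialize (HE 0%Z). pose proof (Rabs_pos (w n 0%Z - W (gridpt dz 0) t)). lra. }
  assert (HL0 : 0 <= L0) by exact (Lip_nonneg _ _ Hw0).
  assert (HLG0 : 0 <= LG) by exact (Lip_nonneg _ _ HLG).
  assert (Hk0 : 0 <= k 0) by (apply Hk; lra).
  assert (HLz : Lip Lz (fun z => W z t)) by now apply evol_Lip_z.
  assert (HLz0 : 0 <= Lz) by exact (Lip_nonneg _ _ HLz).
  set (h := fun x => flux V (W x t)).
  assert (Hh : Lip (LG * Lz) h) by exact (Lip_comp LG Lz (flux V) (fun z => W z t) HLG HLz).
  assert (HhH : bounded_by HG h) by (intros x; apply HHG).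
  set (u := fun j => flux V (w n j)). set (v := fun j => h (gridpt dz j)).
  assert (Hu : forall j, Rabs (u j) <= HG) by (intros; apply HHG).
  assert (Hv : forall j, Rabs (v j) <= HG) by (intros; apply HHG).
  set (S1 := dsum k dz u (i + 1) - dsum k dz u i).
  set (S2 := dsum k dz v (i + 1) - dsum k dz v i).
  set (F := kavg k h (gridpt dz (i + 1)) - kavg k h (gridpt dz i)).
  set (r := rhs k (flux V) (fun x => W x t) (gridpt dz i)).
  assert (A1 : Rabs (S1 - S2) <= 2 * k 0 * dz * (LG * E)).
  { assert (B := dsum_diff_bound k dz Hk Hdz (fun j => u j - v j) (LG * E) i).
    rewrite !(dsum_minus k dz Hk Hdz u v HG HG) in B by easy.
    unfold S1, S2. match type of B with _ -> Rabs ?e <= _ =>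
      match goal with |- Rabs ?e' <= _ => replace e' with e by ring end end.
    apply B. intros j. unfold u, v, h. eapply Rle_trans; [apply HLG|].
    apply Rmult_le_compat_l; [easy|apply HE]. }
  assert (A2 : Rabs (S2 - F) <= 2 * k 0 * (LG * Lz) * (dz * dz)).
  { exact (dsum_consistent k dz Hk Hdz h HG (LG * Lz) i Hh HhH). }
  assert (A3 : Rabs (F - dz * r) <= 2 * k 0 * (LG * Lz) * (dz * dz)).
  { unfold F. rewrite gridpt_succ. exact (proj1 (dkavg_spec k Hk h HG (LG * Lz) _ Hh HhH) dz Hdz). }
  assert (A4 : Rabs (W (gridpt dz i) (t + dt) - W (gridpt dz i) t - dt * r) <= c * sp * dt * dt).
  { apply euler_consistent; lra. }
  specialize (HE i).
  assert (Hl : 0 < dt / dz) by now apply Rdiv_lt_0_compat.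
  replace (w n i + dt / dz * S1 - W (gridpt dz i) (t + dt)) with
    ((w n i - W (gridpt dz i) t) + dt / dz * ((S1 - S2) + (S2 - F) + (F - dz * r))
      - (W (gridpt dz i) (t + dt) - W (gridpt dz i) t - dt * r)) by (field; lra).
  assert (A5 : Rabs (dt / dz * ((S1 - S2) + (S2 - F) + (F - dz * r)))
     <= dt / dz * (2 * k 0 * dz * (LG * E) + 2 * (2 * k 0 * (LG * Lz) * (dz * dz)))).
  { rewrite Rabs_mult, (Rabs_pos_eq (dt / dz)) by lra. apply Rmult_le_compat_l; [lra|].
    pose proof (Rabs_triang (S1 - S2 + (S2 - F)) (F - dz * r)).
    pose proof (Rabs_triang (S1 - S2) (S2 - F)). lra. }
  replace (dt / dz * (2 * k 0 * dz * (LG * E) + 2 * (2 * k 0 * (LG * Lz) * (dz * dz))))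
    with (2 * k 0 * LG * dt * (E + 2 * Lz * dz)) in A5 by (field; lra).
  assert (A6 : 2 * k 0 * LG * dt * (E + 2 * Lz * dz) <= c * dt * (E + 2 * Lz * dz)).
  { apply Rmult_le_compat_r; [nra|]. apply Rmult_le_compat_r; [lra|]. unfold c, rate. lra. }
  set (X := dt / dz * ((S1 - S2) + (S2 - F) + (F - dz * r))) in *.
  set (Y := W (gridpt dz i) (t + dt) - W (gridpt dz i) t - dt * r) in *.
  set (Z0 := w n i - W (gridpt dz i) t) in *.
  pose proof (Rabs_triang (Z0 + X) (- Y)) as T2. pose proof (Rabs_triang Z0 X) as T3.
  rewrite Rabs_Ropp in T2. unfold Rminus.
  eapply Rle_trans; [exact T2|]. nra.
Qed.

(** The initial error plus the defect that accompanies [E] in [scheme_step_error]; including the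
    defect makes the error recursion homogeneous. *)
Let e0 := H * k 0 * dz + (2 * Lz * dz + sp * dt).

Lemma scheme_error n : INR n * dt <= T1 ->
  forall i, Rabs (w n i - W (gridpt dz i) (INR n * dt)) <= e0 * exp (c * T1).
Proof.
  intros Hn.
  assert (Hk0 : 0 <= k 0) by (apply Hk; lra).
  assert (HH0 : 0 <= H) by exact (bounded_by_nonneg _ _ Hy0H).
  assert (HT1 : 0 <= T1).
  { pose proof (pos_INR n). nra. }
  assert (HLz0 : 0 <= Lz) by exact (Lip_nonneg _ _ (evol_Lip_z 0 HT1)).
  assert (Hsp0 : 0 <= sp) by exact (Lip_nonneg _ _ (evol_Lip_t 0)).
  assert (Hc : 1 <= c) by (apply (rate_ge_1 k (flux V)); easy).
  set (de := 2 * Lz * dz + sp * dt) in *.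
  assert (Hde : 0 <= de).
  { unfold de. assert (0 <= Lz * dz) by (apply Rmult_le_pos; lra).
    assert (0 <= sp * dt) by (apply Rmult_le_pos; lra). lra. }
  assert (He0 : 0 <= e0).
  { unfold e0. fold de. assert (0 <= H * k 0 * dz) by (apply Rmult_le_pos; [now apply Rmult_le_pos|lra]). lra. }
  (* With [de] added, errors grow by at most the factor [1 + c * dt <= exp (c * dt)] per step: a
     discrete Gronwall inequality. *)
  assert (G : forall m, INR m * dt <= T1 ->
    forall i, Rabs (w m i - W (gridpt dz i) (INR m * dt)) <= e0 * exp (c * (INR m * dt)) - de).
  { induction m as [|m IH]; intros Hm i.
    - simpl (INR 0). rewrite Rmult_0_l, Rmult_0_r, exp_0. unfold W.
      rewrite (evol_initial k (flux V) w0 LG HG L0) by (try easy; lra).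
      rewrite wsch_0.
      pose proof (dsum_cellmean_consistent k dz Hk Hdz y0 H i Hy0 Hy0H). unfold w0, e0. lra.
    - assert (Hm' : 0 <= INR m * dt <= T1).
      { pose proof (pos_INR m). rewrite S_INR in Hm. nra. }
      eapply Rle_trans; [apply (scheme_step_error m _ Hm' (IH (proj2 Hm')))|].
      fold de.
      replace (c * (INR (S m) * dt)) with (c * (INR m * dt) + c * dt) by (rewrite S_INR; ring).
      rewrite exp_plus.
      set (X := e0 * exp (c * (INR m * dt))) in *.
      assert (HX : 0 <= X).
      { apply Rmult_le_pos; [easy|left; apply exp_pos]. }
      rewrite <- Rmult_assoc. fold X.
      assert (He : 1 + c * dt <= exp (c * dt)).
      { left. apply exp_ineq1. nra. }
      nra. }
  intros i. rename Hn into Hn'.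
  eapply Rle_trans; [apply (G n Hn' i)|].
  assert (exp (c * (INR n * dt)) <= exp (c * T1)).
  { destruct (Rle_lt_or_eq_dec _ _ Hn') as [Hlt| ->]; [|lra].
    left. apply exp_increasing. nra. }
  nra.
Qed.

(** Interpolation nodes are cell centres, whereas [scheme_error] refers to left edges; the half-cell
    offset is why distances up to [2 * dz] are allowed. *)
Lemma winterp_cell z t : 0 <= t -> exists n i th s, 0 <= th <= 1 /\ 0 <= s <= 1 /\
  INR n * dt <= t /\ t - dt <= INR n * dt /\
  Rabs (z - gridpt dz i) <= 2 * dz /\ Rabs (z - gridpt dz (i + 1)) <= 2 * dz /\
  winterp Phi V y0 alpha dt dz z t =
  (1 - th) * (1 - s) * w n i + th * (1 - s) * w n (i + 1)%Z
  + (1 - th) * s * w (S n) i + th * s * w (S n) (i + 1)%Z.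
Proof.
  intros Ht. unfold winterp.
  pose proof (base_Int_part (t / dt)) as [B1 B2].
  assert (Htd : t / dt * dt = t) by (field; lra).
  assert (Ht0 : 0 <= t / dt) by (apply Rmult_le_pos; [easy|left; now apply Rinv_0_lt_compat]).
  assert (Hip : (0 <= Int_part (t / dt))%Z).
  { assert (-1 < Int_part (t / dt))%Z; [|lia]. apply lt_IZR. lra. }
  set (n := Z.to_nat (Int_part (t / dt))).
  assert (En : INR n = IZR (Int_part (t / dt))) by (unfold n; rewrite INR_IZR_INZ, Z2Nat.id; easy).
  pose proof (base_Int_part (z / dz + / 2)) as [B3 B4].
  set (i := Int_part (z / dz + / 2)) in *.
  assert (Hzd : z / dz * dz = z) by (field; lra).
  exists n, i, ((z - zpt dz (IZR i)) / dz), ((t - INR n * dt) / dt).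
  assert (X1 : IZR i * dz <= z + / 2 * dz) by (apply Rmult_le_compat_r with (r := dz) in B3; lra).
  assert (X2 : z + / 2 * dz <= IZR i * dz + dz).
  { assert (z / dz + / 2 <= IZR i + 1) as B5 by lra. apply Rmult_le_compat_r with (r := dz) in B5; lra. }
  assert (X3 : INR n * dt <= t).
  { rewrite En. apply Rmult_le_compat_r with (r := dt) in B1; lra. }
  assert (X4 : t - dt <= INR n * dt).
  { rewrite En. assert (t / dt <= IZR (Int_part (t / dt)) + 1) as B5 by lra.
    apply Rmult_le_compat_r with (r := dt) in B5; lra. }
  unfold zpt, gridpt. rewrite plus_IZR.
  split; [|split; [|split; [|split; [|split; [|split]]]]]; try easy.
  - split; [apply Rle_div_r|apply Rle_div_l]; lra.
  - split; [apply Rle_div_r|apply Rle_div_l]; lra.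
  - apply Rabs_le. lra.
  - apply Rabs_le. lra.
Qed.

Lemma winterp_ge_1 z t : 0 <= t -> 1 <= winterp Phi V y0 alpha dt dz z t.
Proof.
  intros Ht. destruct (winterp_cell z t Ht) as (n & i & th & s & H1 & H2 & _ & _ & _ & _ & ->).
  pose proof (proj1 (wsch_ge_1_and_step n)) as A. pose proof (proj1 (wsch_ge_1_and_step (S n))) as B.
  pose proof (A i). pose proof (A (i + 1)%Z). pose proof (B i). pose proof (B (i + 1)%Z).
  assert (0 <= (1 - th) * (1 - s)) by nra. assert (0 <= th * (1 - s)) by nra.
  assert (0 <= (1 - th) * s) by nra. assert (0 <= th * s) by nra. nra.
Qed.

(** The interpolant is a convex combination of four nodal values, each within [D] of [W z t]. It
    uses the time level [S n], which may lie up to [dt] after t; hence [t <= T1 - dt]. *)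
Lemma winterp_error z t : 0 <= t -> t <= T1 - dt ->
  Rabs (winterp Phi V y0 alpha dt dz z t - W z t)
  <= e0 * exp (c * T1) + (2 * Lz * dz + sp * dt).
Proof.
  intros Ht HtT.
  destruct (winterp_cell z t Ht) as (n & i & th & s & H1 & H2 & H3 & H4 & H5 & H6 & ->).
  assert (Hsp0 : 0 <= sp) by exact (Lip_nonneg _ _ (evol_Lip_t 0)).
  set (D := e0 * exp (c * T1) + (2 * Lz * dz + sp * dt)).
  assert (A : forall m j, INR m * dt <= T1 -> Rabs (t - INR m * dt) <= dt ->
     Rabs (z - gridpt dz j) <= 2 * dz -> Rabs (w m j - W z t) <= D).
  { intros m j Hm Hmt Hj.
    pose proof (scheme_error m Hm j) as A1.
    pose proof (evol_Lip_z (INR m * dt) ltac:(lra) (gridpt dz j) z) as A2. simpl in A2.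
    pose proof (evol_Lip_t z (INR m * dt) t) as A3.
    rewrite Rabs_minus_sym in Hmt. rewrite Rabs_minus_sym in Hj.
    assert (HLz0 : 0 <= Lz) by exact (Lip_nonneg _ _ (evol_Lip_z t ltac:(lra))).
    assert (A4 : Lz * Rabs (gridpt dz j - z) <= Lz * (2 * dz)) by now apply Rmult_le_compat_l.
    assert (A5 : sp * Rabs (INR m * dt - t) <= sp * dt) by now apply Rmult_le_compat_l.
    pose proof (Rabs_triang (w m j - W (gridpt dz j) (INR m * dt))
      (W (gridpt dz j) (INR m * dt) - W z t)) as T2.
    pose proof (Rabs_triang (W (gridpt dz j) (INR m * dt) - W z (INR m * dt))
      (W z (INR m * dt) - W z t)) as T3.
    replace (w m j - W (gridpt dz j) (INR m * dt) + (W (gridpt dz j) (INR m * dt) - W z t))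
      with (w m j - W z t) in T2 by ring.
    replace (W (gridpt dz j) (INR m * dt) - W z (INR m * dt) + (W z (INR m * dt) - W z t))
      with (W (gridpt dz j) (INR m * dt) - W z t) in T3 by ring.
    unfold D. lra. }
  assert (B1 : INR n * dt <= T1) by lra.
  assert (B2 : INR (S n) * dt <= T1) by (rewrite S_INR; lra).
  assert (B3 : Rabs (t - INR n * dt) <= dt) by (apply Rabs_le; lra).
  assert (B4 : Rabs (t - INR (S n) * dt) <= dt) by (rewrite S_INR; apply Rabs_le; lra).
  pose proof (A n i B1 B3 H5) as C1. pose proof (A n (i + 1)%Z B1 B3 H6) as C2.
  pose proof (A (S n) i B2 B4 H5) as C3. pose proof (A (S n) (i + 1)%Z B2 B4 H6) as C4.
  apply Rabs_le_between in C1. apply Rabs_le_between in C2.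
  apply Rabs_le_between in C3. apply Rabs_le_between in C4.
  assert (0 <= (1 - th) * (1 - s)) by nra. assert (0 <= th * (1 - s)) by nra.
  assert (0 <= (1 - th) * s) by nra. assert (0 <= th * s) by nra.
  set (q := W z t) in *.
  set (a1 := (1 - th) * (1 - s)) in *. set (a2 := th * (1 - s)) in *.
  set (a3 := (1 - th) * s) in *. set (a4 := th * s) in *.
  assert (Ea : a1 + a2 + a3 + a4 = 1) by (unfold a1, a2, a3, a4; ring).
  replace (a1 * w n i + a2 * w n (i + 1)%Z + a3 * w (S n) i + a4 * w (S n) (i + 1)%Z - q)
    with (a1 * (w n i - q) + a2 * (w n (i + 1)%Z - q) + a3 * (w (S n) i - q) + a4 * (w (S n) (i + 1)%Z - q)
      + (a1 + a2 + a3 + a4 - 1) * q) by ring.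
  rewrite Ea. replace ((1 - 1) * q) with 0 by ring. rewrite Rplus_0_r.
  replace D with ((a1 + a2 + a3 + a4) * D) by (rewrite Ea; ring).
  apply Rabs_le. split; nra.
Qed.

End Scheme.

(** * Weak form of the evolution equation *)

Lemma intR_compact (f : R -> R) r : 0 <= r -> (forall z, r < Rabs z -> f z = 0) ->
  ex_RInt f (- r) r -> intR f = RInt f (- r) r.
Proof.
  intros Hr Hf Hex. unfold intR.
  apply (is_RInt_gen_unique (V := R_CompleteNormedModule) f).
  intros P HP.
  exists (fun a => a < - r) (fun b => r < b); [exists (- r); easy|exists r; easy|].
  intros a b Ha Hb. exists (RInt f (- r) r). split; [|now apply locally_singleton].
  simpl.
  assert (Z : forall u v, (forall z, Rmin u v < z < Rmax u v -> r < Rabs z) -> is_RInt f u v 0).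
  { intros u v H. apply (is_RInt_ext (fun _ => 0)).
    - intros z Hz. symmetry. apply Hf, H, Hz.
    - refine (eq_ind _ (fun l : R => is_RInt _ u v l)
        (is_RInt_const (V := R_NormedModule) u v 0) 0 _).
      change ((v - u) * 0 = 0). ring. }
  refine (eq_ind (plus 0 (plus (RInt f (- r) r) 0)) (fun l : R => is_RInt f a b l) _ _ _).
  2: { change (0 + (RInt f (- r) r + 0) = RInt f (- r) r). ring_R. }
  apply (is_RInt_Chasles (V := R_NormedModule) f a (- r)).
  - apply Z. intros z Hz. rewrite Rmin_left, Rmax_right in Hz by lra. rewrite Rabs_left; lra.
  - apply (is_RInt_Chasles (V := R_NormedModule) f (- r) r).
    + now apply (RInt_correct (V := R_CompleteNormedModule)).
    + apply Z. intros z Hz. rewrite Rmin_left, Rmax_right in Hz by lra. rewrite Rabs_pos_eq; lra.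
Qed.

Lemma continuity_2d_swap f x y : continuity_2d_pt f x y -> continuity_2d_pt (fun u v => f v u) y x.
Proof.
  intros H eps. destruct (H eps) as [d Hd]. exists d. intros u v Hu Hv. now apply Hd.
Qed.

Lemma continuity_2d_continuous_1 f x y : continuity_2d_pt f x y -> continuous (fun u => f u y) x.
Proof.
  intros H. apply continuity_pt_filterlim. intros eps Heps.
  destruct (H (mkposreal eps Heps)) as [d Hd]. exists d. split; [apply cond_pos|].
  intros u [_ Hu]. apply Hd; [exact Hu|]. replace (y - y) with 0 by ring. rewrite Rabs_R0. apply cond_pos.
Qed.

Lemma continuity_2d_continuous_2 f x y : continuity_2d_pt f x y -> continuous (f x) y.
Proof. intros H. now apply (continuity_2d_continuous_1 (fun u v => f v u)), continuity_2d_swap. Qed.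

Lemma continuity_2d_Lipschitz f x y A B : 
  (forall u v, Rabs (f u v - f x y) <= A * Rabs (u - x) + B * Rabs (v - y)) ->
  continuity_2d_pt f x y.
Proof.
  intros H eps.
  set (M := Rabs A + Rabs B + 1).
  assert (HM : 0 < M) by (unfold M; pose proof (Rabs_pos A); pose proof (Rabs_pos B); lra).
  exists (mkposreal (eps / M) (Rdiv_lt_0_compat _ _ (cond_pos eps) HM)). simpl.
  intros u v Hu Hv. eapply Rle_lt_trans; [apply H|].
  pose proof (Rle_abs A). pose proof (Rle_abs B).
  pose proof (Rabs_pos (u - x)). pose proof (Rabs_pos (v - y)).
  pose proof (Rabs_pos A). pose proof (Rabs_pos B).
  assert (He : 0 < eps / M) by (apply Rdiv_lt_0_compat; [apply cond_pos|easy]).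
  apply Rle_lt_trans with ((Rabs A + Rabs B) * (eps / M)).
  - assert (A * Rabs (u - x) <= Rabs A * (eps / M)).
    { apply Rle_trans with (Rabs A * Rabs (u - x));
        [apply Rmult_le_compat_r; lra|apply Rmult_le_compat_l; lra]. }
    assert (B * Rabs (v - y) <= Rabs B * (eps / M)).
    { apply Rle_trans with (Rabs B * Rabs (v - y));
        [apply Rmult_le_compat_r; lra|apply Rmult_le_compat_l; lra]. }
    lra.
  - apply Rlt_le_trans with (M * (eps / M)); [apply Rmult_lt_compat_r; [exact He|unfold M; lra]|].
    right; field; lra.
Qed.

Lemma continuous_RInt_param_fixed (f : R -> R -> R) a b t : a <= b ->
  (forall s x, a <= x <= b -> continuity_2d_pt f s x) ->
  continuous (fun s => RInt (f s) a b) t.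
Proof.
  intros Hab Hf.
  assert (Hex : forall s, ex_RInt (f s) a b).
  { intros s. apply (ex_RInt_continuous (V := R_CompleteNormedModule)). intros x Hx.
    rewrite Rmin_left, Rmax_right in Hx by easy.
    apply continuity_2d_continuous_2. now apply Hf. }
  apply continuity_pt_filterlim. intros eps Heps.
  assert (He : 0 < eps / (b - a + 1)) by (apply Rdiv_lt_0_compat; lra).
  destruct (uniform_continuity_2d_1d' f a b t (fun x Hx => Hf t x Hx) (mkposreal _ He)) as [d Hd].
  simpl in Hd. exists d. split; [apply cond_pos|].
  intros s [_ Hs]. simpl in Hs. unfold R_dist in Hs. simpl. unfold R_dist.
  rewrite <- RInt_minus_R by apply Hex.
  apply Rle_lt_trans with ((b - a) * (eps / (b - a + 1))).
  - apply abs_RInt_le_const; [easy|now apply ex_RInt_minus_R|].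
    intros x Hx. left. pose proof (cond_pos d). apply Rabs_lt_between in Hs.
    apply (Hd x t x s); try lra. replace (x - x) with 0 by ring. rewrite Rabs_R0. lra.
  - apply Rlt_le_trans with ((b - a + 1) * (eps / (b - a + 1))).
    + apply Rmult_lt_compat_r; lra.
    + right; field; lra.
Qed.

Lemma smooth2_pderiv_continuous phi l z t : smooth2 phi -> continuity_2d_pt (pderiv l phi) z t.
Proof.
  intros H. apply continuity_2d_pt_filterlim. exact (proj1 (H l z t)).
Qed.

Lemma is_derive_Dz phi z t : smooth2 phi -> is_derive (fun x => phi x t) z (Dz phi z t).
Proof. intros H. apply Derive_correct. exact (proj1 (proj2 (H nil z t))). Qed.

Lemma is_derive_Dt phi z t : smooth2 phi -> is_derive (fun s => phi z s) t (Dt phi z t).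
Proof. intros H. apply Derive_correct. exact (proj2 (proj2 (H nil z t))). Qed.

Lemma Dz_outside phi t r z : (forall x, r < Rabs x -> phi x t = 0) -> r < Rabs z -> Dz phi z t = 0.
Proof.
  intros H Hz. unfold Dz. rewrite (Derive_ext_loc _ (fun _ => 0)); [apply Derive_const|].
  assert (Hd : 0 < Rabs z - r) by lra. exists (mkposreal _ Hd). intros x Hx. apply H.
  change (Rabs (x - z) < Rabs z - r) in Hx.
  pose proof (Rabs_triang_inv z x). rewrite Rabs_minus_sym in Hx. lra.
Qed.

(** [test_fun] asks for vanishing only at times in [0, T], so the time derivative is known to vanish
    only at interior times; this is enough under the integral. *)
Lemma Dt_outside phi T z t : (forall s, 0 <= s <= T -> phi z s = 0) -> 0 < t < T ->
  Dt phi z t = 0.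
Proof.
  intros H Ht. unfold Dt. rewrite (Derive_ext_loc _ (fun _ => 0)); [apply Derive_const|].
  assert (Hd : 0 < Rmin t (T - t)) by (apply Rmin_glb_lt; lra).
  exists (mkposreal _ Hd). intros s Hs. apply H.
  change (Rabs (s - t) < Rmin t (T - t)) in Hs.
  pose proof (Rmin_l t (T - t)). pose proof (Rmin_r t (T - t)).
  apply Rabs_lt_between in Hs. lra.
Qed.

Lemma RInt_by_parts (F dF p dp : R -> R) a b : a <= b ->
  (forall x, is_derive F x (dF x)) -> (forall x, continuous dF x) ->
  (forall x, is_derive p x (dp x)) -> (forall x, continuous dp x) ->
  F b * p b = F a * p a ->
  RInt (fun x => F x * dp x) a b = - RInt (fun x => dF x * p x) a b.
Proof.
  intros Hab HF HdF Hp Hdp Hend.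
  assert (CF : forall x, continuous F x).
  { intros x. apply (ex_derive_continuous (V := R_NormedModule)). now exists (dF x). }
  assert (Cp : forall x, continuous p x).
  { intros x. apply (ex_derive_continuous (V := R_NormedModule)). now exists (dp x). }
  assert (I1 : ex_RInt (fun x => F x * dp x) a b).
  { apply (ex_RInt_continuous (V := R_CompleteNormedModule)). intros x _.
    apply (continuous_mult (K := R_AbsRing)); easy. }
  assert (I2 : ex_RInt (fun x => dF x * p x) a b).
  { apply (ex_RInt_continuous (V := R_CompleteNormedModule)). intros x _.
    apply (continuous_mult (K := R_AbsRing)); easy. }
  assert (E : RInt (fun x => dF x * p x + F x * dp x) a b = F b * p b - F a * p a).
  { apply is_RInt_unique.
    apply (is_RInt_derive (V := R_CompleteNormedModule) (fun x => F x * p x)).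
    - intros x _. apply (is_derive_mult (K := R_AbsRing)); [easy|easy|].
      intros; apply Rmult_comm.
    - intros x _. apply (continuous_plus (V := R_NormedModule));
        apply (continuous_mult (K := R_AbsRing)); easy. }
  rewrite RInt_plus_R in E by easy. lra.
Qed.

Section WeakSolution.

Variables (k G w0 : R -> R) (LG HG L0 : R) (W : R -> R -> R).
Hypothesis Hk : density k.
Hypothesis HLG : Lip LG G.
Hypothesis HHG : bounded_by HG G.
Hypothesis Hreg : regular k LG HG L0 W.
Hypothesis Hfix : forall z t, W z t = picard k G w0 W z t.

Let r z s := rhs k G (fun x => W x s) z.

Lemma fixpoint_rate_continuous z t : continuity_2d_pt r z t.
Proof.
  apply (continuity_2d_Lipschitz _ _ _ (rate k LG * (2 * L0 * weight k LG t)) (rate k LG * speed k HG)).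
  intros u v.
  pose proof (rhs_time_Lip k G LG HG L0 Hk HLG HHG W u Hreg v t) as A.
  pose proof (rhs_Lip k G LG HG Hk HLG HHG _ _ (proj1 Hreg t) u z) as B.
  pose proof (Rabs_triang (r u v - r u t) (r u t - r z t)) as C.
  replace (r u v - r u t + (r u t - r z t)) with (r u v - r z t) in C by ring.
  unfold r in *. cbv beta in *. lra.
Qed.

Lemma fixpoint_continuous z t : continuity_2d_pt W z t.
Proof.
  apply (continuity_2d_Lipschitz _ _ _ (2 * L0 * weight k LG t) (speed k HG)).
  intros u v. pose proof (proj2 Hreg u v t) as A. pose proof (proj1 Hreg t u z) as B.
  pose proof (Rabs_triang (W u v - W u t) (W u t - W z t)) as C.
  replace (W u v - W u t + (W u t - W z t)) with (W u v - W z t) in C by ring. lra.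
Qed.

Lemma fixpoint_nonpos_time z t : t <= 0 -> W z t = W z 0.
Proof.
  intros Ht. rewrite (Hfix z t), (Hfix z 0). unfold picard. now rewrite !Rmax_left by lra.
Qed.

(* Continues [W] linearly to negative times, so that it is differentiable in
   time on the whole line. *)
Definition extend z t := W z t + Rmin t 0 * r z 0.

Lemma extend_nonneg_time z t : 0 <= t -> extend z t = W z t.
Proof. intros Ht. unfold extend. rewrite Rmin_right by easy. ring. Qed.

Lemma fixpoint_rate_ex_RInt z a b : ex_RInt (r z) a b.
Proof. exact (rhs_ex_RInt k G LG HG L0 Hk HLG HHG W z a b Hreg). Qed.

Lemma extend_integral z t : extend z t = w0 z + RInt (r z) 0 t.
Proof.
  unfold extend. destruct (Rle_dec 0 t) as [Ht|Ht].
  - rewrite Rmin_right by easy. rewrite (Hfix z t). unfold picard. rewrite Rmax_right by easy.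
    fold (r z). unfold r. ring_R.
  - rewrite Rmin_left by lra. rewrite (Hfix z t). unfold picard. rewrite Rmax_left by lra.
    rewrite (RInt_ext (r z) (fun _ => r z 0) 0 t).
    + rewrite RInt_const_R.
      pose proof (RInt_point (V := R_CompleteNormedModule) 0 (r z)) as HP.
      unfold r in HP. rewrite HP. unfold zero; simpl. ring_R.
    + intros s Hs. rewrite Rmax_left in Hs by lra. unfold r. f_equal.
      apply functional_extensionality. intros x. apply fixpoint_nonpos_time. lra.
Qed.

Lemma extend_derive z t : is_derive (extend z) t (r z t).
Proof.
  apply (is_derive_ext (fun t => w0 z + RInt (r z) 0 t)).
  - intros s. symmetry. apply extend_integral.
  - replace (r z t) with (plus 0 (r z t)) by (unfold plus; simpl; ring_R).
    apply (is_derive_plus (V := R_NormedModule)); [apply (is_derive_const (V := R_NormedModule))|].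
    apply (is_derive_RInt (V := R_NormedModule) (r z) _ 0).
    + apply filter_forall. intros s. apply (RInt_correct (V := R_CompleteNormedModule)).
      apply fixpoint_rate_ex_RInt.
    + apply (continuity_2d_continuous_2 r), fixpoint_rate_continuous.
Qed.

Lemma extend_continuous z t : continuity_2d_pt extend z t.
Proof.
  unfold extend. apply continuity_2d_pt_plus; [apply fixpoint_continuous|].
  apply continuity_2d_pt_mult.
  - apply (continuity_2d_Lipschitz _ _ _ 0 1). intros u v. rewrite Rmult_0_l, Rplus_0_l, Rmult_1_l.
    unfold Rmin. destruct (Rle_dec v 0), (Rle_dec t 0); apply Rabs_le;
      pose proof (Rle_abs (v - t)); pose proof (Rle_abs (- (v - t))); rewrite Rabs_Ropp in *; lra.
  - intros eps. destruct (fixpoint_rate_continuous z 0 eps) as [d Hd]. exists d.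
    intros u v Hu _. apply Hd; [easy|]. replace (0 - 0) with 0 by ring. rewrite Rabs_R0. apply cond_pos.
Qed.

(** Differentiating the integral of [extend * phi] in time and integrating over [0, T] yields the
    terminal and initial terms. The part containing [r], the z-derivative of the averaged flux,
    becomes the flux term after an integration by parts in z. *)
Lemma fixpoint_weak phi T : 0 < T -> test_fun T phi ->
  RInt (fun t => intR (fun z => W z t * Dt phi z t
     - kavg k (fun x => G (W x t)) z * Dz phi z t)) 0 T
  = intR (fun z => W z T * phi z T - W z 0 * phi z 0).
Proof.
  intros HT [Hs [Rs HRs]].
  (* [b] is positive and exceeds [Rs], whatever the sign of [Rs], so [phi] vanishes at both ends of
     [-b, b]. *)
  set (b := Rabs Rs + 1).
  assert (Hb : Rs < b) by (unfold b; pose proof (Rle_abs Rs); lra).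
  assert (Hb0 : 0 < b) by (unfold b; pose proof (Rabs_pos Rs); lra).
  set (f := fun t z => extend z t * phi z t).
  set (df := fun t z => r z t * phi z t + extend z t * Dt phi z t).
  assert (Cphi : forall z t, continuity_2d_pt phi z t)
    by (intros; apply (smooth2_pderiv_continuous phi nil); easy).
  assert (CDt : forall z t, continuity_2d_pt (Dt phi) z t)
    by (intros; apply (smooth2_pderiv_continuous phi (false :: nil)); easy).
  assert (CDz : forall z t, continuity_2d_pt (Dz phi) z t)
    by (intros; apply (smooth2_pderiv_continuous phi (true :: nil)); easy).
  assert (Cf : forall t z, continuity_2d_pt f t z).
  { intros t z. apply (continuity_2d_swap (fun z t => extend z t * phi z t)).
    apply continuity_2d_pt_mult; [apply extend_continuous|apply Cphi]. }
  assert (Cdf : forall t z, continuity_2d_pt df t z).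
  { intros t z. apply (continuity_2d_swap (fun z t => r z t * phi z t + extend z t * Dt phi z t)).
    apply continuity_2d_pt_plus; apply continuity_2d_pt_mult;
      [apply fixpoint_rate_continuous|apply Cphi|apply extend_continuous|apply CDt]. }
  assert (Hdf : forall t z, is_derive (fun s => f s z) t (df t z)).
  { intros t z. apply (is_derive_mult (K := R_AbsRing) (extend z) (phi z) t (r z t) (Dt phi z t)).
    - apply extend_derive.
    - now apply is_derive_Dt.
    - intros; apply Rmult_comm. }
  assert (EDf : forall t z, Derive (fun s => f s z) t = df t z)
    by (intros; now apply is_derive_unique).
  assert (If : forall t, ex_RInt (f t) (- b) b).
  { intros t. apply (ex_RInt_continuous (V := R_CompleteNormedModule)). intros z _.
    apply continuity_2d_continuous_2, Cf. }
  assert (Hg : forall t, is_derive (fun s => RInt (f s) (- b) b) t (RInt (df t) (- b) b)).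
  { intros t.
    rewrite (RInt_ext (df t) (fun z => Derive (fun s => f s z) t)) by (intros; now rewrite EDf).
    apply (is_derive_RInt_param f (- b) b t).
    - apply filter_forall. intros s z _. now exists (df s z).
    - intros z _. apply (continuity_2d_pt_ext df); [intros; now rewrite EDf|apply Cdf].
    - apply filter_forall. apply If. }
  assert (E1 : RInt (fun t => RInt (df t) (- b) b) 0 T = RInt (f T) (- b) b - RInt (f 0) (- b) b).
  { apply is_RInt_unique.
    apply (is_RInt_derive (V := R_CompleteNormedModule) (fun s => RInt (f s) (- b) b)).
    - intros t _. apply Hg.
    - intros t _. apply (continuous_RInt_param_fixed df); [lra|]. intros; apply Cdf. }
  assert (E2 : intR (fun z => W z T * phi z T - W z 0 * phi z 0) = RInt (f T) (- b) b - RInt (f 0) (- b) b).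
  { rewrite <- RInt_minus_R by apply If.
    assert (Ee : forall z, f T z - f 0 z = W z T * phi z T - W z 0 * phi z 0).
    { intros z. unfold f. rewrite !extend_nonneg_time by lra. easy. }
    rewrite (intR_compact _ b).
    - apply RInt_ext. intros; symmetry; apply Ee.
    - lra.
    - intros z Hz. rewrite !HRs by lra. ring.
    - apply (ex_RInt_ext (fun z => f T z - f 0 z)); [intros; apply Ee|].
      apply ex_RInt_minus_R; apply If. }
  rewrite E2, <- E1. apply RInt_ext. intros t Ht. rewrite Rmin_left, Rmax_right in Ht by lra.
  set (h := fun x => G (W x t)).
  assert (Hh : Lip (LG * (2 * L0 * weight k LG t)) h)
    by exact (Lip_comp LG _ G (fun z => W z t) HLG (proj1 Hreg t)).
  assert (HhH : bounded_by HG h) by (intros x; apply HHG).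
  assert (Hder : forall z, is_derive (kavg k h) z (r z t))
    by (intros z; exact (proj2 (dkavg_spec k Hk h HG _ z Hh HhH))).
  assert (Cr : forall z, continuous (fun z => r z t) z)
    by (intros z; apply (continuity_2d_continuous_1 r), fixpoint_rate_continuous).
  assert (Cphi1 : forall z, continuous (fun z => phi z t) z)
    by (intros z; apply (continuity_2d_continuous_1 phi), Cphi).
  assert (CDz1 : forall z, continuous (fun z => Dz phi z t) z)
    by (intros z; apply (continuity_2d_continuous_1 (Dz phi)), CDz).
  assert (CDt1 : forall z, continuous (fun z => Dt phi z t) z)
    by (intros z; apply (continuity_2d_continuous_1 (Dt phi)), CDt).
  assert (CW1 : forall z, continuous (fun z => W z t) z)
    by (intros z; apply (continuity_2d_continuous_1 W), fixpoint_continuous).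
  assert (Ck : forall z, continuous (kavg k h) z).
  { intros z. apply (ex_derive_continuous (V := R_NormedModule)). exists (r z t). apply Hder. }
  assert (I1 : ex_RInt (fun z => W z t * Dt phi z t) (- b) b).
  { apply (ex_RInt_continuous (V := R_CompleteNormedModule)). intros z _.
    apply (continuous_mult (K := R_AbsRing)); [apply CW1|apply CDt1]. }
  assert (I2 : ex_RInt (fun z => kavg k h z * Dz phi z t) (- b) b).
  { apply (ex_RInt_continuous (V := R_CompleteNormedModule)). intros z _.
    apply (continuous_mult (K := R_AbsRing)); [apply Ck|apply CDz1]. }
  assert (I3 : ex_RInt (fun z => r z t * phi z t) (- b) b).
  { apply (ex_RInt_continuous (V := R_CompleteNormedModule)). intros z _.
    apply (continuous_mult (K := R_AbsRing)); [apply Cr|apply Cphi1]. }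
  rewrite (intR_compact _ b).
  - rewrite (RInt_minus_R _ _ _ _ I1 I2).
    rewrite (RInt_by_parts (kavg k h) (fun z => r z t) (fun z => phi z t) (fun z => Dz phi z t)).
    + transitivity (RInt (fun z => r z t * phi z t) (- b) b + RInt (fun z => W z t * Dt phi z t) (- b) b).
      { ring_R. }
      rewrite <- RInt_plus_R by easy. apply RInt_ext. intros z _. unfold df.
      rewrite extend_nonneg_time by lra. easy.
    + lra.
    + apply Hder.
    + apply Cr.
    + intros z. now apply is_derive_Dz.
    + apply CDz1.
    + rewrite !HRs; [ring|lra|rewrite Rabs_Ropp, Rabs_pos_eq; lra|lra|rewrite Rabs_pos_eq; lra].
  - lra.
  - intros z Hz. rewrite (Dz_outside phi t Rs), (Dt_outside phi T); try lra.
    + intros s Hs'. apply HRs; [easy|lra].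
    + intros x Hx. apply HRs; [lra|easy].
  - now apply ex_RInt_minus_R.
Qed.

End WeakSolution.

(** * Smooth test functions *)

(** An explicit chain of derivatives rather than iterated [Derive]: inductions then supply each
    derivative by a formula, and its existence comes along. *)
Fixpoint smooth_upto (n : nat) (f : R -> R) : Prop :=
  match n with
  | O => True
  | S n => exists f' : R -> R, (forall x, is_derive f x (f' x)) /\ smooth_upto n f'
  end.

Definition smooth (f : R -> R) : Prop := forall n, smooth_upto n f.

Lemma smooth_upto_pred n f : smooth_upto (S n) f -> smooth_upto n f.
Proof.
  revert f. induction n as [|n IH]; intros f; [easy|].
  intros [f' [H1 H2]]. exists f'. split; [easy|]. now apply IH.
Qed.

Lemma smooth_upto_const n c : smooth_upto n (fun _ => c).
Proof.
  revert c. induction n as [|n IH]; intros c; [easy|].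
  exists (fun _ => 0). split; [|apply IH].
  intros x. apply (is_derive_const (V := R_NormedModule)).
Qed.

Lemma smooth_upto_plus n f g : smooth_upto n f -> smooth_upto n g ->
  smooth_upto n (fun x => f x + g x).
Proof.
  revert f g. induction n as [|n IH]; intros f g; [easy|].
  intros [f' [H1 H2]] [g' [H3 H4]]. exists (fun x => f' x + g' x). split; [|now apply IH].
  intros x. now apply (is_derive_plus (V := R_NormedModule)).
Qed.

Lemma smooth_upto_mult n f g : smooth_upto n f -> smooth_upto n g ->
  smooth_upto n (fun x => f x * g x).
Proof.
  revert f g. induction n as [|n IH]; intros f g; [easy|].
  intros Hf Hg. pose proof (smooth_upto_pred _ _ Hf). pose proof (smooth_upto_pred _ _ Hg).
  destruct Hf as [f' [H1 H2]]. destruct Hg as [g' [H3 H4]].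
  exists (fun x => f' x * g x + f x * g' x). split.
  - intros x. apply (is_derive_mult (K := R_AbsRing)); [easy|easy|intros; apply Rmult_comm].
  - apply smooth_upto_plus; now apply IH.
Qed.

Lemma smooth_upto_affine n f c d : smooth_upto n f -> smooth_upto n (fun x => f (c * x + d)).
Proof.
  revert f. induction n as [|n IH]; intros f; [easy|].
  intros [f' [H1 H2]]. exists (fun x => c * f' (c * x + d)). split.
  - intros x. apply (is_derive_comp f (fun x => c * x + d)); [apply H1|].
    auto_derive; [easy|ring_R].
  - apply (smooth_upto_mult n (fun _ => c)); [apply smooth_upto_const|now apply IH].
Qed.

Lemma smooth_derive f : smooth f -> (forall x, is_derive f x (Derive f x)) /\ smooth (Derive f).
Proof.
  intros H. split.
  - intros x. destruct (H 1%nat) as [f' [H1 _]]. apply Derive_correct. now exists (f' x).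
  - intros n. destruct (H (S n)) as [f' [H1 H2]].
    replace (Derive f) with f'; [easy|].
    apply functional_extensionality. intros x. symmetry. now apply is_derive_unique.
Qed.

Lemma smooth_continuous f x : smooth f -> continuous f x.
Proof.
  intros H. apply (ex_derive_continuous (V := R_NormedModule)).
  exists (Derive f x). now apply smooth_derive.
Qed.

Lemma smooth_primitive f a : smooth f -> smooth (fun x => RInt f a x).
Proof.
  intros H n. apply smooth_upto_pred. exists f. split; [|apply H].
  intros x. apply (is_derive_RInt (V := R_NormedModule) f _ a).
  - apply filter_forall. intros y. apply (RInt_correct (V := R_CompleteNormedModule)).
    apply (ex_RInt_continuous (V := R_CompleteNormedModule)). intros; now apply smooth_continuous.
  - now apply smooth_continuous.
Qed.

(** Products of a function of z and a function of t are stable under both partial derivatives, so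
    every mixed derivative demanded by [smooth2] is again such a product. *)
Lemma pderiv_product psi chi l : smooth psi -> smooth chi ->
  exists psi' chi', smooth psi' /\ smooth chi' /\
    pderiv l (fun z t => psi z * chi t) = fun z t => psi' z * chi' t.
Proof.
  intros Hp Hc. induction l as [|b l [p [c [H1 [H2 H3]]]]]; [now exists psi, chi|].
  destruct b; simpl; rewrite H3.
  - exists (Derive p), c. split; [now apply smooth_derive|split; [easy|]].
    apply functional_extensionality; intros z. apply functional_extensionality; intros t.
    unfold Dz. now rewrite Derive_scal_l.
  - exists p, (Derive c). split; [easy|split; [now apply smooth_derive|]].
    apply functional_extensionality; intros z. apply functional_extensionality; intros t.
    unfold Dt. now rewrite Derive_scal.
Qed.

Lemma smooth2_product psi chi : smooth psi -> smooth chi -> smooth2 (fun z t => psi z * chi t).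
Proof.
  intros Hp Hc l z t.
  destruct (pderiv_product psi chi l Hp Hc) as [p [c [H1 [H2 ->]]]].
  split; [|split].
  - apply (continuous_mult (K := R_AbsRing) (fun q : R * R => p (fst q)) (fun q => c (snd q))).
    + apply (continuous_comp fst p); [apply continuous_fst|now apply smooth_continuous].
    + apply (continuous_comp snd c); [apply continuous_snd|now apply smooth_continuous].
  - apply ex_derive_mult; [eexists; now apply smooth_derive|apply ex_derive_const].
  - apply ex_derive_mult; [apply ex_derive_const|eexists; now apply smooth_derive].
Qed.

(** * A smooth function flat at the origin, and bumps *)

Lemma exp_INR_mult n x : exp (INR n * x) = exp x ^ n.
Proof.
  induction n as [|n IH]; [now rewrite Rmult_0_l, exp_0|].
  rewrite S_INR. simpl. rewrite <- IH, <- exp_plus. f_equal. ring.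
Qed.

(** With y = 1/x and N = m + 2, the bound reads y^N <= N^N exp y, the N-th power of y/N <= exp
    (y/N). The two surplus powers of y give the factor [x * x], which makes the derivative at 0
    vanish. *)
Lemma pow_exp_bound m : exists C, forall x, 0 < x -> (/ x) ^ m * exp (- / x) <= C * (x * x).
Proof.
  set (N := S (S m)).
  assert (HN : 0 < INR N) by (apply lt_0_INR; unfold N; lia).
  exists (INR N ^ N). intros x Hx.
  set (y := / x). assert (Hy : 0 < y) by now apply Rinv_0_lt_compat.
  assert (E : y ^ N <= INR N ^ N * exp y).
  { replace y with (INR N * (y / INR N)) by (field; lra).
    rewrite exp_INR_mult, Rpow_mult_distr. apply Rmult_le_compat_l; [apply pow_le; lra|].
    assert (0 < y / INR N) by now apply Rdiv_lt_0_compat.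
    apply pow_incr. split; [lra|]. pose proof (exp_ineq1 (y / INR N) ltac:(lra)). lra. }
  rewrite exp_Ropp. pose proof (exp_pos y).
  apply Rmult_le_reg_r with (exp y * (y * y)); [apply Rmult_lt_0_compat; nra|].
  replace (y ^ m * / exp y * (exp y * (y * y))) with (y ^ N) by (unfold N; simpl; field; lra).
  assert (Exy : x * y = 1) by (unfold y; field; lra).
  replace (INR N ^ N * (x * x) * (exp y * (y * y))) with (INR N ^ N * exp y * ((x * y) * (x * y))) by ring.
  now rewrite Exy, !Rmult_1_r.
Qed.

(** The classical exp(-1/x) together with its multiples by negative powers: the span of this family
    is closed under differentiation, as the induction on the order of smoothness needs. *)
Definition flat (m : nat) (x : R) : R :=
  if Rle_dec x 0 then 0 else (/ x) ^ m * exp (- / x).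

Lemma flat_nonpos m x : x <= 0 -> flat m x = 0.
Proof. intros H. unfold flat. now destruct (Rle_dec x 0). Qed.

Lemma flat_positive m x : 0 < x -> flat m x = (/ x) ^ m * exp (- / x).
Proof. intros H. unfold flat. destruct (Rle_dec x 0); [lra|easy]. Qed.

Lemma flat_0_pos x : 0 < x -> 0 < flat 0 x.
Proof. intros H. rewrite flat_positive by easy. simpl. rewrite Rmult_1_l. apply exp_pos. Qed.

Lemma flat_derive m x : is_derive (flat m) x (- INR m * flat (S m) x + flat (S (S m)) x).
Proof.
  destruct (Rtotal_order x 0) as [Hx|[->|Hx]].
  - rewrite !flat_nonpos by lra. replace (- INR m * 0 + 0) with 0 by ring.
    apply (is_derive_ext_loc (fun _ => 0)); [|apply (is_derive_const (V := R_NormedModule))].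
    exists (mkposreal (- x) ltac:(lra)). intros y Hy. change (Rabs (y - x) < - x) in Hy.
    apply Rabs_lt_between in Hy. now rewrite flat_nonpos by lra.
  - rewrite !flat_nonpos by lra. replace (- INR m * 0 + 0) with 0 by ring.
    destruct (pow_exp_bound m) as [C HC].
    apply (is_derive_quadratic _ _ _ C). intros d. rewrite Rplus_0_l, (flat_nonpos m 0) by lra.
    replace (flat m d - 0 - d * 0) with (flat m d) by ring.
    assert (HC0 : 0 <= C).
    { pose proof (HC 1 ltac:(lra)) as H1. pose proof (exp_pos (- / 1)).
      assert (0 <= (/ 1) ^ m) by (apply pow_le; lra). nra. }
    destruct (Rle_dec d 0) as [Hd|Hd].
    + rewrite flat_nonpos, Rabs_R0 by easy. nra.
    + rewrite flat_positive by lra. rewrite Rabs_pos_eq; [apply HC; lra|].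
      apply Rmult_le_pos; [apply pow_le; left; apply Rinv_0_lt_compat; lra|left; apply exp_pos].
  - rewrite !flat_positive by easy.
    apply (is_derive_ext_loc (fun x => (/ x) ^ m * exp (- / x))).
    + exists (mkposreal x Hx). intros y Hy. change (Rabs (y - x) < x) in Hy.
      apply Rabs_lt_between in Hy. now rewrite flat_positive by lra.
    + auto_derive; [lra|].
      destruct m as [|m]; [simpl; field; lra|].
      rewrite S_INR. simpl pred. simpl pow. field. lra.
Qed.

Lemma smooth_flat m : smooth (flat m).
Proof.
  intros n. revert m. induction n as [|n IH]; intros m; [easy|].
  exists (fun x => - INR m * flat (S m) x + flat (S (S m)) x). split; [apply flat_derive|].
  apply smooth_upto_plus; [|apply IH].
  apply (smooth_upto_mult n (fun _ => - INR m)); [apply smooth_upto_const|apply IH].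
Qed.

Definition bump (a b x : R) : R := flat 0 (x - a) * flat 0 (b - x).

Lemma smooth_bump a b : smooth (bump a b).
Proof.
  intros n.
  assert (E : bump a b = fun x => flat 0 (1 * x + - a) * flat 0 (-1 * x + b)).
  { apply functional_extensionality. intros x. unfold bump. f_equal; f_equal; ring. }
  rewrite E. apply smooth_upto_mult; apply (smooth_upto_affine n (flat 0)), smooth_flat.
Qed.

Lemma bump_pos a b x : a < x < b -> 0 < bump a b x.
Proof. intros H. apply Rmult_lt_0_compat; apply flat_0_pos; lra. Qed.

Lemma bump_out a b x : x <= a \/ b <= x -> bump a b x = 0.
Proof.
  intros [H|H]; unfold bump.
  - rewrite (flat_nonpos 0 (x - a)) by lra. ring.
  - rewrite (flat_nonpos 0 (b - x)) by lra. ring.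
Qed.

Lemma bump_nonneg a b x : 0 <= bump a b x.
Proof.
  destruct (Rlt_dec a x), (Rlt_dec x b); try (rewrite bump_out; lra).
  left. apply bump_pos. lra.
Qed.

(* The fundamental lemma of the calculus of variations, one-sided. *)
Lemma nonpos_of_bump_tests F A B : (forall x, continuous F x) ->
  (forall a b, A <= a -> a < b -> b <= B -> RInt (fun x => bump a b x * F x) A B <= 0) ->
  forall x, A < x < B -> F x <= 0.
Proof.
  intros HF H x Hx. destruct (Rle_dec (F x) 0) as [|Hn]; [easy|exfalso].
  assert (HFx : 0 < F x) by lra.
  pose proof (proj2 (continuity_pt_filterlim F x) (HF x) (F x) HFx) as [d [Hd1 Hd2]].
  simpl in Hd2. unfold R_dist in Hd2.
  (* [e] keeps the bump inside [A, B] and inside a neighbourhood of x where [F] is positive. *)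
  set (e := Rmin (d / 2) (Rmin ((x - A) / 2) ((B - x) / 2))).
  assert (He : 0 < e) by (unfold e; repeat apply Rmin_glb_lt; lra).
  assert (He1 : e <= d / 2) by apply Rmin_l.
  assert (He2 : e <= (x - A) / 2) by (eapply Rle_trans; [apply Rmin_r|apply Rmin_l]).
  assert (He3 : e <= (B - x) / 2) by (eapply Rle_trans; [apply Rmin_r|apply Rmin_r]).
  set (f := fun y => bump (x - e) (x + e) y * F y).
  assert (Cf : forall y, continuous f y).
  { intros y. apply (continuous_mult (K := R_AbsRing)); [apply smooth_continuous, smooth_bump|apply HF]. }
  assert (If : forall u v, ex_RInt f u v).
  { intros u v. apply (ex_RInt_continuous (V := R_CompleteNormedModule)). intros; apply Cf. }
  assert (Hpos : 0 < RInt f (x - e) (x + e)).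
  { apply RInt_gt_0; [lra| |intros; apply Cf].
    intros y Hy. apply Rmult_lt_0_compat; [now apply bump_pos|].
    destruct (Req_dec y x) as [->|Hyx]; [easy|].
    assert (Hy2 : Rabs (F y - F x) < F x).
    { apply Hd2. split; [split; [easy|now apply not_eq_sym]|]. apply Rabs_lt_between. lra. }
    apply Rabs_lt_between in Hy2. lra. }
  assert (Hz : forall u v, u <= v -> (forall y, u < y < v -> y <= x - e \/ x + e <= y) -> RInt f u v = 0).
  { intros u v Huv Hy. rewrite (RInt_ext f (fun _ => 0)).
    - rewrite RInt_const_R. ring_R.
    - intros y Hy2. rewrite Rmin_left, Rmax_right in Hy2 by easy. unfold f.
      rewrite bump_out by now apply Hy. ring_R. }
  pose proof (H (x - e) (x + e) ltac:(lra) ltac:(lra) ltac:(lra)) as HH. fold f in HH.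
  rewrite <- (RInt_Chasles_R f A (x - e) B), <- (RInt_Chasles_R f (x - e) (x + e) B) in HH by apply If.
  rewrite (Hz A (x - e)), (Hz (x + e) B) in HH; [lra|lra| |lra|]; intros y Hy; lra.
Qed.

(** * From weak solutions to an integral identity *)

Section WeakToIntegral.

Variables (k G : R -> R) (LG HG L T : R) (w : R -> R -> R).
Hypothesis Hk : density k.
Hypothesis HLG : Lip LG G.
Hypothesis HHG : bounded_by HG G.
Hypothesis HT : 0 < T.
Hypothesis Hwz : forall t, Lip L (fun z => w z t).
Hypothesis Hwt : forall z, Lip L (w z).
Hypothesis Hweak : forall phi, test_fun T phi ->
  RInt (fun t => intR (fun z => w z t * Dt phi z t
     - kavg k (fun x => G (w x t)) z * Dz phi z t)) 0 T
  = intR (fun z => w z T * phi z T - w z 0 * phi z 0).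

Let r z s := rhs k G (fun x => w x s) z.

Lemma weak_rate_continuous z t : continuity_2d_pt r z t.
Proof.
  apply (continuity_2d_Lipschitz _ _ _ (rate k LG * L) (rate k LG * L)).
  intros u v.
  assert (A : Rabs (r u v - r u t) <= rate k LG * (L * Rabs (v - t))).
  { apply (rhs_close k G LG HG Hk HLG HHG L L _ _ _ u (Hwz v) (Hwz t)). intros x. apply Hwt. }
  pose proof (rhs_Lip k G LG HG Hk HLG HHG _ _ (Hwz t) u z) as B.
  pose proof (Rabs_triang (r u v - r u t) (r u t - r z t)) as C.
  replace (r u v - r u t + (r u t - r z t)) with (r u v - r z t) in C by ring.
  unfold r in *. cbv beta in *. lra.
Qed.

Lemma weak_continuous z t : continuity_2d_pt w z t.
Proof.
  apply (continuity_2d_Lipschitz _ _ _ L L).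
  intros u v. pose proof (Hwt u v t) as A. pose proof (Hwz t u z) as B.
  pose proof (Rabs_triang (w u v - w u t) (w u t - w z t)) as C.
  replace (w u v - w u t + (w u t - w z t)) with (w u v - w z t) in C by ring.
  cbv beta in *. lra.
Qed.

Variables (a b c : R).
Hypothesis Hc : 0 <= c.
Hypothesis Ha : - c <= a.
Hypothesis Hb : b <= c.

Let psi := bump a b.
Let g t := RInt (fun z => psi z * w z t) (- c) c.
Let q t := RInt (fun z => psi z * r z t) (- c) c.

Lemma bump_mult_continuous (f : R -> R -> R) t z : (forall z t, continuity_2d_pt f z t) ->
  continuity_2d_pt (fun t z => psi z * f z t) t z.
Proof.
  intros Hf. apply (continuity_2d_swap (fun z t => psi z * f z t)).
  apply continuity_2d_pt_mult; [|apply Hf].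
  pose proof (smooth_continuous psi z (smooth_bump a b)) as Hp.
  intros eps. apply continuity_pt_filterlim in Hp.
  destruct (Hp eps (cond_pos eps)) as [d [Hd1 Hd2]]. exists (mkposreal d Hd1).
  intros u v Hu _. destruct (Req_dec u z) as [->|Hn].
  - replace (psi z - psi z) with 0 by ring. rewrite Rabs_R0. apply cond_pos.
  - apply Hd2. split; [split; [easy|now apply not_eq_sym]|exact Hu].
Qed.

Lemma bump_mult_ex_RInt (f : R -> R -> R) t : (forall z t, continuity_2d_pt f z t) ->
  ex_RInt (fun z => psi z * f z t) (- c) c.
Proof.
  intros Hf. apply (ex_RInt_continuous (V := R_CompleteNormedModule)). intros z _.
  apply (continuity_2d_continuous_2 (fun t z => psi z * f z t)).
  now apply bump_mult_continuous.
Qed.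

Lemma tested_continuous t : continuous g t.
Proof.
  refine (continuous_RInt_param_fixed (fun t z => psi z * w z t) (- c) c t _ _); [lra|].
  intros s z _. exact (bump_mult_continuous w s z weak_continuous).
Qed.

Lemma tested_rate_continuous t : continuous q t.
Proof.
  refine (continuous_RInt_param_fixed (fun t z => psi z * r z t) (- c) c t _ _); [lra|].
  intros s z _. exact (bump_mult_continuous r s z weak_rate_continuous).
Qed.

Lemma tested_rate_ex_RInt u v : ex_RInt q u v.
Proof. apply (ex_RInt_continuous (V := R_CompleteNormedModule)). intros; apply tested_rate_continuous. Qed.

Let p t := RInt q 0 t.

Lemma tested_rate_primitive t : is_derive p t (q t).
Proof.
  apply (is_derive_RInt (V := R_NormedModule) q _ 0); [|apply tested_rate_continuous].
  apply filter_forall. intros s. apply (RInt_correct (V := R_CompleteNormedModule)), tested_rate_ex_RInt.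
Qed.

Lemma bump_zero_outside z : c < Rabs z -> psi z = 0.
Proof.
  intros Hz. apply bump_out. unfold Rabs in Hz. destruct (Rcase_abs z); lra.
Qed.

(** Testing with a product reduces the equation to a scalar one: integration by parts in z turns the
    flux term into the tested rate [q], leaving the integrand of the weak form of g' = q. *)
Lemma weak_product_identity chi dchi t : 0 < t < T -> (forall t, is_derive chi t (dchi t)) ->
  intR (fun z => w z t * Dt (fun z t => psi z * chi t) z t
     - kavg k (fun x => G (w x t)) z * Dz (fun z t => psi z * chi t) z t)
  = dchi t * g t + chi t * q t.
Proof.
  intros Ht Hchi.
  assert (Hps : smooth psi) by apply smooth_bump.
  assert (Hdp : forall z, is_derive psi z (Derive psi z)) by (intros; now apply smooth_derive).
  assert (Cdp : forall z, continuous (Derive psi) z).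
  { intros z. apply smooth_continuous. now apply smooth_derive. }
  set (h := fun x => G (w x t)).
  assert (Hh : Lip (LG * L) h) by exact (Lip_comp LG L G (fun z => w z t) HLG (Hwz t)).
  assert (HhH : bounded_by HG h) by (intros x; apply HHG).
  assert (Hder : forall z, is_derive (kavg k h) z (r z t))
    by (intros z; exact (proj2 (dkavg_spec k Hk h HG _ z Hh HhH))).
  assert (Cr : forall z, continuous (fun z => r z t) z)
    by (intros z; apply (continuity_2d_continuous_1 r), weak_rate_continuous).
  assert (Ck : forall z, continuous (kavg k h) z).
  { intros z. apply (ex_derive_continuous (V := R_NormedModule)). exists (r z t). apply Hder. }
  assert (I1 : ex_RInt (fun z => psi z * w z t) (- c) c)
    by (apply bump_mult_ex_RInt, weak_continuous).
  assert (I2 : ex_RInt (fun z => kavg k h z * Derive psi z) (- c) c).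
  { apply (ex_RInt_continuous (V := R_CompleteNormedModule)). intros z _.
    apply (continuous_mult (K := R_AbsRing)); [apply Ck|apply Cdp]. }
  assert (E : forall z, w z t * Dt (fun z t => psi z * chi t) z t
     - kavg k h z * Dz (fun z t => psi z * chi t) z t
     = dchi t * (psi z * w z t) - chi t * (kavg k h z * Derive psi z)).
  { intros z. unfold Dt, Dz. rewrite Derive_scal, Derive_scal_l.
    rewrite (is_derive_unique _ _ _ (Hchi t)). ring. }
  assert (I3 : ex_RInt (fun z => dchi t * (psi z * w z t) - chi t * (kavg k h z * Derive psi z)) (- c) c).
  { apply ex_RInt_minus_R; now apply ex_RInt_scal_R. }
  rewrite (intR_compact _ c); [|easy| |].
  - rewrite (RInt_ext _ _ _ _ (fun z _ => E z)).
    rewrite (RInt_minus_R _ _ _ _ (ex_RInt_scal_R _ _ _ (dchi t) I1) (ex_RInt_scal_R _ _ _ (chi t) I2)),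
      (RInt_scal_R _ _ _ (dchi t) I1), (RInt_scal_R _ _ _ (chi t) I2).
    rewrite (RInt_by_parts (kavg k h) (fun z => r z t) psi (Derive psi) (- c) c ltac:(lra) Hder Cr Hdp Cdp).
    + unfold g, q. rewrite (RInt_ext (fun z => r z t * psi z) (fun z => psi z * r z t))
        by (intros; ring_R). ring_R.
    + unfold psi. rewrite !bump_out by lra. ring.
  - intros z Hz. fold h. rewrite E, bump_zero_outside by easy.
    rewrite (Derive_ext_loc _ (fun _ => 0)), Derive_const; [ring|].
    assert (Hd : 0 < Rabs z - c) by lra. exists (mkposreal _ Hd). intros x Hx.
    apply bump_zero_outside. change (Rabs (x - z) < Rabs z - c) in Hx.
    pose proof (Rabs_triang_inv z x). rewrite Rabs_minus_sym in Hx. lra.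
  - apply (ex_RInt_ext _ _ _ _ (fun z _ => eq_sym (E z))). easy.
Qed.

(** The test function in time is a primitive [chi] of the bump [beta] vanishing at T, so the
    terminal term disappears and [chi 0] is minus the mass of [beta]. As [p] vanishes at 0,
    integrating [chi * q] by parts leaves no boundary term, and everything becomes an integral
    against [beta]. *)
Lemma weak_tested_in_time a' b' : 0 <= a' -> a' < b' -> b' <= T ->
  RInt (fun t => bump a' b' t * (g t - g 0 - p t)) 0 T = 0.
Proof.
  intros Ha' Hab' Hb'.
  set (beta := bump a' b').
  assert (Hbeta : smooth beta) by apply smooth_bump.
  set (chi := fun t => RInt beta T t).
  assert (Cbeta : forall t, continuous beta t) by (intros; now apply smooth_continuous).
  assert (Ibeta : forall u v, ex_RInt beta u v).
  { intros. apply (ex_RInt_continuous (V := R_CompleteNormedModule)). intros; apply Cbeta. }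
  assert (Hchi : forall t, is_derive chi t (beta t)).
  { intros t. apply (is_derive_RInt (V := R_NormedModule) beta _ T); [|apply Cbeta].
    apply filter_forall. intros s. apply (RInt_correct (V := R_CompleteNormedModule)), Ibeta. }
  assert (Cchi : forall t, continuous chi t).
  { intros t. apply (ex_derive_continuous (V := R_NormedModule)). now exists (beta t). }
  assert (HchiT : chi T = 0) by exact (RInt_point (V := R_CompleteNormedModule) T beta).
  assert (Hchi0 : chi 0 = - RInt beta 0 T).
  { symmetry. exact (opp_RInt_swap (V := R_CompleteNormedModule) beta 0 T (Ibeta 0 T)). }
  assert (Cp : forall t, continuous p t).
  { intros t. apply (ex_derive_continuous (V := R_NormedModule)). exists (q t). apply tested_rate_primitive. }
  assert (I1 : ex_RInt (fun t => beta t * g t) 0 T).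
  { apply (ex_RInt_continuous (V := R_CompleteNormedModule)). intros t _.
    apply (continuous_mult (K := R_AbsRing)); [apply Cbeta|apply tested_continuous]. }
  assert (I2 : ex_RInt (fun t => chi t * q t) 0 T).
  { apply (ex_RInt_continuous (V := R_CompleteNormedModule)). intros t _.
    apply (continuous_mult (K := R_AbsRing)); [apply Cchi|apply tested_rate_continuous]. }
  assert (I3 : ex_RInt (fun t => p t * beta t) 0 T).
  { apply (ex_RInt_continuous (V := R_CompleteNormedModule)). intros t _.
    apply (continuous_mult (K := R_AbsRing)); [apply Cp|apply Cbeta]. }
  assert (Hp0 : p 0 = 0) by exact (RInt_point (V := R_CompleteNormedModule) 0 q).
  assert (Htest : test_fun T (fun z t => psi z * chi t)).
  { split.
    - apply smooth2_product; [apply smooth_bump|now apply smooth_primitive].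
    - exists c. intros z t _ Hz. rewrite bump_zero_outside by easy. ring. }
  pose proof (Hweak _ Htest) as E.
  rewrite (RInt_ext _ (fun t => beta t * g t + chi t * q t)) in E.
  2: { intros t Ht. rewrite Rmin_left, Rmax_right in Ht by lra.
       now apply weak_product_identity. }
  rewrite RInt_plus_R in E by easy.
  assert (E2 : intR (fun z => w z T * (psi z * chi T) - w z 0 * (psi z * chi 0)) = - chi 0 * g 0).
  { assert (Ez : forall z, w z T * (psi z * chi T) - w z 0 * (psi z * chi 0) = - chi 0 * (psi z * w z 0)).
    { intros z. rewrite HchiT. ring. }
    assert (I4 : ex_RInt (fun z => psi z * w z 0) (- c) c)
      by (apply bump_mult_ex_RInt, weak_continuous).
    rewrite (intR_compact _ c); [|easy| |].
    - rewrite (RInt_ext _ _ _ _ (fun z _ => Ez z)). now apply RInt_scal_R.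
    - intros z Hz. rewrite Ez, bump_zero_outside by easy. ring.
    - apply (ex_RInt_ext _ _ _ _ (fun z _ => eq_sym (Ez z))). now apply ex_RInt_scal_R. }
  rewrite E2 in E.
  pose proof (RInt_by_parts p q chi beta 0 T ltac:(lra) tested_rate_primitive tested_rate_continuous Hchi Cbeta) as E3.
  rewrite Hp0, HchiT in E3. specialize (E3 ltac:(ring)).
  rewrite (RInt_ext (fun t => q t * chi t) (fun t => chi t * q t)) in E3 by (intros; ring_R).
  rewrite (RInt_ext _ (fun t => (beta t * g t - g 0 * beta t) - p t * beta t)).
  2: { intros; fold beta; ring_R. }
  pose proof (ex_RInt_scal_R beta 0 T (g 0) (Ibeta 0 T)) as I5.
  rewrite (RInt_minus_R _ _ 0 T (ex_RInt_minus_R _ _ 0 T I1 I5) I3), (RInt_minus_R _ _ 0 T I1 I5),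
    (RInt_scal_R _ _ _ (g 0) (Ibeta 0 T)).
  rewrite Hchi0 in E. lra.
Qed.

(** The continuous function [g - g 0 - p] and its negative both pass the one-sided bump test. *)
Lemma weak_integral_identity t : 0 < t < T ->
  RInt (fun z => psi z * w z t) (- c) c - RInt (fun z => psi z * w z 0) (- c) c
  = RInt (fun s => RInt (fun z => psi z * r z s) (- c) c) 0 t.
Proof.
  intros Ht.
  assert (Cp : forall t, continuous p t).
  { intros s. apply (ex_derive_continuous (V := R_NormedModule)). exists (q s). apply tested_rate_primitive. }
  assert (CF : forall s, continuous (fun t => g t - g 0 - p t) s).
  { intros s. apply (continuous_minus (V := R_NormedModule)); [|apply Cp].
    apply (continuous_minus (V := R_NormedModule)); [apply tested_continuous|apply continuous_const]. }
  assert (A : g t - g 0 - p t <= 0).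
  { apply (nonpos_of_bump_tests (fun t => g t - g 0 - p t) 0 T); [easy| |easy].
    intros a' b' H1 H2 H3. rewrite weak_tested_in_time by easy. lra. }
  assert (B : - (g t - g 0 - p t) <= 0).
  { apply (nonpos_of_bump_tests (fun t => - (g t - g 0 - p t)) 0 T); [| |easy].
    - intros s. apply (continuous_opp (V := R_NormedModule)), CF.
    - intros a' b' H1 H2 H3.
      rewrite (RInt_ext _ (fun t => -1 * (bump a' b' t * (g t - g 0 - p t)))) by (intros; ring_R).
      assert (I : ex_RInt (fun t => bump a' b' t * (g t - g 0 - p t)) 0 T).
      { apply (ex_RInt_continuous (V := R_CompleteNormedModule)); intros s _.
        apply (continuous_mult (K := R_AbsRing)); [apply smooth_continuous, smooth_bump|apply CF]. }
      rewrite (RInt_scal_R _ _ _ (-1) I), (weak_tested_in_time a' b' H1 H2 H3).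
      lra. }
  change (g t - g 0 = p t). lra.
Qed.

End WeakToIntegral.

(** * Comparison of two weak solutions *)

Section Contraction.

Variables (k G : R -> R) (LG HG L T : R) (w v : R -> R -> R).
Hypothesis Hk : density k.
Hypothesis HLG : Lip LG G.
Hypothesis HHG : bounded_by HG G.
Hypothesis HT : 0 < T.
Hypothesis Hwz : forall t, Lip L (fun z => w z t).
Hypothesis Hwt : forall z, Lip L (w z).
Hypothesis Hvz : forall t, Lip L (fun z => v z t).
Hypothesis Hvt : forall z, Lip L (v z).
Hypothesis Hw : forall phi, test_fun T phi ->
  RInt (fun t => intR (fun z => w z t * Dt phi z t
     - kavg k (fun x => G (w x t)) z * Dz phi z t)) 0 T
  = intR (fun z => w z T * phi z T - w z 0 * phi z 0).
Hypothesis Hv : forall phi, test_fun T phi ->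
  RInt (fun t => intR (fun z => v z t * Dt phi z t
     - kavg k (fun x => G (v x t)) z * Dz phi z t)) 0 T
  = intR (fun z => v z T * phi z T - v z 0 * phi z 0).
Hypothesis Hinit : forall z, w z 0 = v z 0.

(** In the difference of the two integral identities for a bump in z, [rhs_close] bounds the tested
    rates and [weighted_integral_bound] produces the factor 1/2, with [m] multiplied by the mass of
    the bump. As the bump is arbitrary, the bound is pointwise; the opposite sign follows by
    exchanging the solutions. *)
Lemma weak_contraction_open m z t : 0 <= m -> 
  (forall z t, 0 <= t <= T -> Rabs (w z t - v z t) <= m * exp (2 * rate k LG * t)) ->
  0 < t < T -> w z t - v z t <= m / 2 * exp (2 * rate k LG * t).
Proof.
  intros Hm H Ht.
  set (M := m / 2 * exp (2 * rate k LG * t)).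
  cut (w z t - v z t - M <= 0); [lra|].
  set (c := Rabs z + 1). assert (Hc : 0 <= c) by (unfold c; pose proof (Rabs_pos z); lra).
  assert (Cw : forall z, continuous (fun z => w z t) z)
    by (intros x; exact (Lip_continuous L _ x (Hwz t))).
  assert (Cv : forall z, continuous (fun z => v z t) z)
    by (intros x; exact (Lip_continuous L _ x (Hvz t))).
  apply (nonpos_of_bump_tests (fun z => w z t - v z t - M) (- c) c).
  - intros x. apply (continuous_minus (V := R_NormedModule)); [|apply continuous_const].
    apply (continuous_minus (V := R_NormedModule)); [apply Cw|apply Cv].
  - intros a b Ha Hab Hb.
    set (psi := bump a b).
    assert (Cpsi : forall z, continuous psi z) by (intros; apply smooth_continuous, smooth_bump).
    assert (Ipsi : ex_RInt psi (- c) c).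
    { apply (ex_RInt_continuous (V := R_CompleteNormedModule)). intros; apply Cpsi. }
    assert (Iw : ex_RInt (fun z => psi z * w z t) (- c) c).
    { apply (ex_RInt_continuous (V := R_CompleteNormedModule)). intros x _.
      apply (continuous_mult (K := R_AbsRing)); [apply Cpsi|apply Cw]. }
    assert (Iv : ex_RInt (fun z => psi z * v z t) (- c) c).
    { apply (ex_RInt_continuous (V := R_CompleteNormedModule)). intros x _.
      apply (continuous_mult (K := R_AbsRing)); [apply Cpsi|apply Cv]. }
    rewrite (RInt_ext _ (fun z => (psi z * w z t - psi z * v z t) - M * psi z))
      by (intros; unfold psi; ring_R).
    rewrite (RInt_minus_R _ _ _ _ (ex_RInt_minus_R _ _ _ _ Iw Iv) (ex_RInt_scal_R _ _ _ M Ipsi)),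
      (RInt_minus_R _ _ _ _ Iw Iv), (RInt_scal_R _ _ _ M Ipsi).
    pose proof (weak_integral_identity k G LG HG L T w Hk HLG HHG HT Hwz Hwt Hw a b c Hc Ha Hb t Ht) as E1.
    pose proof (weak_integral_identity k G LG HG L T v Hk HLG HHG HT Hvz Hvt Hv a b c Hc Ha Hb t Ht) as E2.
    fold psi in E1, E2.
    rewrite (RInt_ext (fun z => psi z * v z 0) (fun z => psi z * w z 0)) in E2
      by (intros; now rewrite Hinit).
    set (qw := fun s => RInt (fun z => psi z * rhs k G (fun x => w x s) z) (- c) c) in *.
    set (qv := fun s => RInt (fun z => psi z * rhs k G (fun x => v x s) z) (- c) c) in *.
    assert (Iqw : ex_RInt qw 0 t) by exact (tested_rate_ex_RInt k G LG HG L w Hk HLG HHG Hwz Hwt a b c Hc 0 t).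
    assert (Iqv : ex_RInt qv 0 t) by exact (tested_rate_ex_RInt k G LG HG L v Hk HLG HHG Hvz Hvt a b c Hc 0 t).
    assert (Hpsi0 : 0 <= RInt psi (- c) c).
    { apply RInt_ge_0; [lra|easy|]. intros; apply bump_nonneg. }
    assert (B : Rabs (RInt (fun s => qw s - qv s) 0 t)
       <= (m * RInt psi (- c) c) / 2 * exp (2 * rate k LG * t)).
    { apply weighted_integral_bound; [now apply Rmult_le_pos|lra|exact (ex_RInt_minus_R _ _ _ _ Iqw Iqv)|].
      intros s Hs. unfold qw, qv.
      assert (Irw : ex_RInt (fun z => psi z * rhs k G (fun x => w x s) z) (- c) c).
      { apply (bump_mult_ex_RInt a b c (fun z s => rhs k G (fun x => w x s) z)).
        exact (weak_rate_continuous k G LG HG L w Hk HLG HHG Hwz Hwt). }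
      assert (Irv : ex_RInt (fun z => psi z * rhs k G (fun x => v x s) z) (- c) c).
      { apply (bump_mult_ex_RInt a b c (fun z s => rhs k G (fun x => v x s) z)).
        exact (weak_rate_continuous k G LG HG L v Hk HLG HHG Hvz Hvt). }
      rewrite <- (RInt_minus_R _ _ _ _ Irw Irv).
      replace (rate k LG * (m * RInt psi (- c) c) * exp (2 * rate k LG * s))
        with (RInt (fun z => (rate k LG * (m * exp (2 * rate k LG * s))) * psi z) (- c) c)
        by (rewrite (RInt_scal_R _ _ _ _ Ipsi); ring_R).
      apply abs_RInt_le_fun; [lra|exact (ex_RInt_minus_R _ _ _ _ Irw Irv)|exact (ex_RInt_scal_R _ _ _ _ Ipsi)|].
      intros x _. rewrite <- Rmult_minus_distr_l, Rabs_mult, (Rabs_pos_eq (psi x)) by apply bump_nonneg.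
      rewrite Rmult_comm. apply Rmult_le_compat_r; [apply bump_nonneg|].
      apply (rhs_close k G LG HG Hk HLG HHG L L _ _ _ x (Hwz s) (Hvz s)).
      intros y. apply H. lra. }
    rewrite (RInt_minus_R _ _ _ _ Iqw Iqv), <- E1, <- E2 in B.
    apply Rabs_le_between in B. unfold M.
    replace (m * RInt psi (- c) c / 2 * exp (2 * rate k LG * t))
      with (m / 2 * exp (2 * rate k LG * t) * RInt psi (- c) c) in B by (unfold Rdiv; ring_R). lra.
  - unfold c. pose proof (Rle_abs z). pose proof (Rle_abs (- z)). rewrite Rabs_Ropp in *. lra.
Qed.

End Contraction.

(** * Uniqueness and conclusion *)

Section Uniqueness.

Variables (k G : R -> R) (LG HG L T : R) (w v : R -> R -> R).
Hypothesis Hk : density k.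
Hypothesis HLG : Lip LG G.
Hypothesis HHG : bounded_by HG G.
Hypothesis HT : 0 < T.
Hypothesis Hwz : forall t, Lip L (fun z => w z t).
Hypothesis Hwt : forall z, Lip L (w z).
Hypothesis Hvz : forall t, Lip L (fun z => v z t).
Hypothesis Hvt : forall z, Lip L (v z).
Hypothesis Hw : forall phi, test_fun T phi ->
  RInt (fun t => intR (fun z => w z t * Dt phi z t
     - kavg k (fun x => G (w x t)) z * Dz phi z t)) 0 T
  = intR (fun z => w z T * phi z T - w z 0 * phi z 0).
Hypothesis Hv : forall phi, test_fun T phi ->
  RInt (fun t => intR (fun z => v z t * Dt phi z t
     - kavg k (fun x => G (v x t)) z * Dz phi z t)) 0 T
  = intR (fun z => v z T * phi z T - v z 0 * phi z 0).
Hypothesis Hinit : forall z, w z 0 = v z 0.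

Let E t := exp (2 * rate k LG * t).

(** The estimate on the open interval is extended to t = 0 by the common initial data and to t = T
    by Lipschitz continuity in time. *)
Lemma weak_contraction m : 0 <= m -> 
  (forall z t, 0 <= t <= T -> Rabs (w z t - v z t) <= m * E t) ->
  (forall z t, 0 <= t <= T -> Rabs (w z t - v z t) <= m / 2 * E t).
Proof.
  intros Hm H z t Ht.
  assert (Hopen : forall t, 0 < t < T -> Rabs (w z t - v z t) <= m / 2 * E t).
  { intros s Hs. apply Rabs_le.
    pose proof (weak_contraction_open k G LG HG L T w v Hk HLG HHG HT Hwz Hwt Hvz Hvt Hw Hv Hinit
      m z s Hm H Hs) as A.
    assert (H' : forall z t, 0 <= t <= T -> Rabs (v z t - w z t) <= m * E t).
    { intros; rewrite Rabs_minus_sym; now apply H. }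
    pose proof (weak_contraction_open k G LG HG L T v w Hk HLG HHG HT Hvz Hvt Hwz Hwt Hv Hw
      (fun z => eq_sym (Hinit z)) m z s Hm H' Hs) as B.
    fold (E s) in A, B. lra. }
  assert (HEpos : forall s, 0 < E s) by (intros; apply exp_pos).
  destruct (Req_dec t 0) as [->|H0].
  { rewrite Hinit. replace (v z 0 - v z 0) with 0 by ring. rewrite Rabs_R0.
    pose proof (HEpos 0). nra. }
  destruct (Req_dec t T) as [->|H1]; [|apply Hopen; lra].
  apply le_of_forall_eps. intros eps Heps.
  assert (HL : 0 <= L) by exact (Lip_nonneg _ _ (Hwt 0)).
  (* Within eps/(2(L + 1)) of T, the two solutions, each [L]-Lipschitz in time, together change by
     at most eps. *)
  set (s := T - Rmin (T / 2) (eps / (2 * (L + 1)))).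
  assert (He : 0 < eps / (2 * (L + 1))) by (apply Rdiv_lt_0_compat; lra).
  assert (Hs1 : 0 < Rmin (T / 2) (eps / (2 * (L + 1)))) by (apply Rmin_glb_lt; lra).
  pose proof (Rmin_l (T / 2) (eps / (2 * (L + 1)))) as Hs2.
  pose proof (Rmin_r (T / 2) (eps / (2 * (L + 1)))) as Hs3.
  assert (Hs : 0 < s < T) by (unfold s; lra).
  pose proof (Hopen s Hs) as A.
  pose proof (Hwt z T s) as B. pose proof (Hvt z s T) as C.
  rewrite (Rabs_pos_eq (T - s)) in B by lra.
  rewrite (Rabs_minus_sym s T), (Rabs_pos_eq (T - s)) in C by lra.
  assert (Hd : 2 * (L * (T - s)) <= eps).
  { replace (T - s) with (Rmin (T / 2) (eps / (2 * (L + 1)))) by (unfold s; ring).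
    apply Rle_trans with (2 * ((L + 1) * (eps / (2 * (L + 1))))).
    - apply Rmult_le_compat_l; [lra|]. apply Rmult_le_compat; lra.
    - right; field; lra. }
  assert (HE : E s <= E T).
  { unfold E. left. apply exp_increasing.
    pose proof (rate_ge_1 k G LG Hk HLG). nra. }
  pose proof (Rabs_triang (w z T - w z s) (w z s - v z s + (v z s - v z T))) as T1.
  pose proof (Rabs_triang (w z s - v z s) (v z s - v z T)) as T2.
  replace (w z T - w z s + (w z s - v z s + (v z s - v z T))) with (w z T - v z T) in T1 by ring.
  nra.
Qed.

Lemma weak_unique z t : 0 <= t <= T -> w z t = v z t.
Proof.
  intros Ht.
  assert (HL : 0 <= L) by exact (Lip_nonneg _ _ (Hwt 0)).
  assert (Hc : 1 <= rate k LG) by exact (rate_ge_1 k G LG Hk HLG).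
  (* Equal initial data and the Lipschitz bounds in time keep the difference below [2 * L * T], from
     which the halving starts. *)
  set (m := 2 * L * T). assert (Hm : 0 <= m) by (unfold m; nra).
  assert (A : forall n z t, 0 <= t <= T -> Rabs (w z t - v z t) <= m * (/ 2) ^ n * E t).
  { induction n as [|n IH].
    - intros x s Hs. simpl. rewrite Rmult_1_r.
      pose proof (Hwt x s 0) as B. pose proof (Hvt x 0 s) as C.
      rewrite (Rabs_pos_eq (s - 0)) in B by lra.
      rewrite (Rabs_minus_sym 0 s), (Rabs_pos_eq (s - 0)) in C by lra.
      pose proof (Rabs_triang (w x s - w x 0) (v x 0 - v x s)) as T1.
      replace (w x s - w x 0 + (v x 0 - v x s)) with (w x s - v x s) in T1
        by (rewrite Hinit; ring).
      assert (1 <= E s) by (apply exp_ge_1; nra).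
      assert (L * (s - 0) <= L * T) by (apply Rmult_le_compat_l; lra).
      apply Rle_trans with m; [unfold m; lra|]. nra.
    - intros x s Hs.
      replace (m * (/ 2) ^ S n * E s) with (m * (/ 2) ^ n / 2 * E s) by (simpl; field).
      apply weak_contraction; [|exact IH|easy].
      apply Rmult_le_pos; [easy|apply pow_le; lra]. }
  assert (Hz : Rabs (w z t - v z t) <= 0).
  { apply le_of_forall_eps. intros eps Heps.
    assert (0 < E t) by apply exp_pos.
    destruct (half_pow_small (m * E t) eps) as [n Hn]; [nra|easy|].
    specialize (Hn n ltac:(lia)). specialize (A n z t Ht). lra. }
  pose proof (Rabs_pos (w z t - v z t)).
  destruct (Req_dec (w z t - v z t) 0) as [|Hn]; [lra|].
  apply Rabs_pos_lt in Hn. lra.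
Qed.

End Uniqueness.

(** The hypotheses on a weak solution concern only times in [0, T]; composing with this projection
    gives Lipschitz bounds at all times without changing the weak formulation. *)
Definition clamp (T t : R) : R := Rmin T (Rmax 0 t).

Lemma clamp_range T t : 0 < T -> 0 <= clamp T t <= T.
Proof.
  intros HT. unfold clamp. split; [apply Rmin_glb; [lra|apply Rmax_l]|apply Rmin_l].
Qed.

Lemma clamp_id T t : 0 <= t <= T -> clamp T t = t.
Proof. intros Ht. unfold clamp. now rewrite Rmax_right, Rmin_right by (try rewrite Rmax_right; lra). Qed.

Lemma Lip_clamp T : 0 < T -> Lip 1 (clamp T).
Proof.
  intros HT. apply Lip_of_ordered. intros x y Hxy. unfold clamp, Rmin, Rmax.
  destruct (Rle_dec 0 x), (Rle_dec 0 y); repeat destruct (Rle_dec T _); apply Rabs_le; lra.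
Qed.

Lemma avg_Wf_flux Phi V alpha (u : R -> R) z : (forall x, 1 <= u x) ->
  avg Phi alpha (fun x => Wf V (u x)) z = kavg (Phia Phi alpha) (fun x => flux V (u x)) z.
Proof.
  intros Hu. unfold avg, kavg. f_equal. apply functional_extensionality. intros x.
  now rewrite flux_eq.
Qed.

(** The bound [1 <= w] permits the passage to the truncated flux, and the weak form evaluates [w]
    only at times where [clamp] is the identity. *)
Lemma weak_sol_clamp Phi V alpha T w : 0 < T -> (forall z t, 0 <= t <= T -> 1 <= w z t) ->
  weak_sol Phi V alpha T w -> forall phi, test_fun T phi ->
  RInt (fun t => intR (fun z => w z (clamp T t) * Dt phi z t
     - kavg (Phia Phi alpha) (fun x => flux V (w x (clamp T t))) z * Dz phi z t)) 0 T
  = intR (fun z => w z (clamp T T) * phi z T - w z (clamp T 0) * phi z 0).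
Proof.
  intros HT Hw1 Hw phi Hphi. rewrite !clamp_id by lra. rewrite <- (Hw phi Hphi).
  apply RInt_ext. intros t Ht. rewrite Rmin_left, Rmax_right in Ht by lra.
  rewrite clamp_id by lra. f_equal. apply functional_extensionality. intros z.
  rewrite avg_Wf_flux; [easy|]. intros; apply Hw1; lra.
Qed.

Lemma lipschitz_strip_clamp T w L : 0 < T ->
  (forall z z' t t', 0 <= t <= T -> 0 <= t' <= T ->
    Rabs (w z t - w z' t') <= L * (Rabs (z - z') + Rabs (t - t'))) ->
  (forall t, Lip L (fun z => w z (clamp T t))) /\ (forall z, Lip L (fun t => w z (clamp T t))).
Proof.
  intros HT H. split.
  - intros t x y. eapply Rle_trans; [apply H; now apply clamp_range|].
    replace (clamp T t - clamp T t) with 0 by ring. rewrite Rabs_R0. lra.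
  - intros z s t. eapply Rle_trans; [apply H; now apply clamp_range|].
    replace (z - z) with 0 by ring. rewrite Rabs_R0, Rplus_0_l.
    assert (HL : 0 <= L).
    { pose proof (H 1 0 0 0 ltac:(lra) ltac:(lra)) as A. pose proof (Rabs_pos (w 1 0 - w 0 0)).
      replace (0 - 0) with 0 in A by ring. rewrite Rminus_0_r, Rabs_R0, Rabs_R1 in A. lra. }
    pose proof (Lip_clamp T HT s t). apply Rmult_le_compat_l; lra.
Qed.

Theorem theorem2p5
  (Phi V y0 : R -> R) (alpha T : R)
  (hPhi : kernel_hyp Phi)
  (hVC1 : C1_nonneg V) (hVdec : nonincr_nonneg V)
  (halpha : 0 < alpha) (hT : 0 < T)
  (hy0BV : BV y0) (hy0ge : forall z, 1 <= y0 z) :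
  (* existence and convergence of the scheme *)
  (forall (dt dz : nat -> R) (M : R),
     (forall k, 0 < dt k) -> (forall k, 0 < dz k) ->
     is_lim_seq dt 0 -> is_lim_seq dz 0 ->
     (forall k w, 1 <= w -> 0 <= dt k / dz k * Derive (Wf V) w <= 1) ->
     (forall k z l, is_derive (fun x => winterp Phi V y0 alpha (dt k) (dz k) x 0) z l ->
        Rabs l <= M) ->
     exists walpha : R -> R -> R,
       lipschitz_strip T walpha /\
       (forall K : R -> Prop, compact K ->
          forall eps, 0 < eps -> exists N : nat, forall k, (N <= k)%nat ->
            forall z t, K z -> 0 <= t <= T ->
              Rabs (winterp Phi V y0 alpha (dt k) (dz k) z t - walpha z t) < eps) /\
       weak_sol Phi V alpha T walpha /\
       (forall z, walpha z 0 = avg Phi alpha y0 z))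
  /\
  (* uniqueness of Lipschitz weak solutions given the initial data *)
  (forall w1 w2 : R -> R -> R,
     lipschitz_strip T w1 -> lipschitz_strip T w2 ->
     (forall z t, 0 <= t <= T -> 1 <= w1 z t) ->
     (forall z t, 0 <= t <= T -> 1 <= w2 z t) ->
     weak_sol Phi V alpha T w1 -> weak_sol Phi V alpha T w2 ->
     (forall z, w1 z 0 = w2 z 0) ->
     forall z t, 0 <= t <= T -> w1 z t = w2 z t).
Proof.
  set (k := Phia Phi alpha).
  assert (Hk : density k) by now apply density_Phia.
  destruct (flux_Lip V hVC1) as [LG HLG].
  set (HG := Rabs (V 0) + Rabs (V 1)).
  assert (HHG : bounded_by HG (flux V)) by now apply flux_bounded.
  split.
  - intros dt dz M Hdt Hdz Ldt Ldz HCFL _.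
    destruct (BV_bounded y0 hy0BV) as [H HH].
    pose proof (DM_BV y0 hy0BV) as Hy0.
    set (w0 := kavg k y0). set (L0 := 2 * k 0 * H).
    assert (Hw0 : Lip L0 w0) by now apply kavg_Lip.
    set (W := evol k (flux V) w0).
    pose proof (evol_regular k (flux V) w0 LG HG L0 Hk HLG HHG Hw0) as Hreg.
    pose proof (evol_fixpoint k (flux V) w0 LG HG L0 Hk HLG HHG Hw0) as Hfix.
    fold W in Hreg, Hfix.
    (* The extra unit of time leaves room for the time level after T that the interpolation uses. *)
    set (T1 := T + 1). set (Wm := weight k LG T1).
    assert (Hrate : 1 <= rate k LG) by exact (rate_ge_1 k (flux V) LG Hk HLG).
    assert (HWm : forall t, t <= T1 -> weight k LG t <= Wm).
    { intros t Ht. unfold Wm, weight.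
      pose proof (Rle_max_compat_l t T1 0 Ht) as Hle.
      destruct (Rle_lt_or_eq_dec _ _ Hle) as [Hlt| ->]; [|lra].
      left. apply exp_increasing. nra. }
    set (Lz := 2 * L0 * Wm). set (sp := speed k HG).
    assert (HLz : forall t, t <= T1 -> Lip Lz (fun z => W z t))
      by exact (evol_Lip_z Phi V y0 alpha LG HG hPhi halpha HLG HHG L0 T1 Wm Hw0 HWm).
    assert (Hsp : forall z, Lip sp (W z)) by apply Hreg.
    assert (HLz0 : 0 <= Lz) by (apply (Lip_nonneg _ _ (HLz 0 ltac:(unfold T1; lra)))).
    assert (Hsp0 : 0 <= sp) by exact (Lip_nonneg _ _ (Hsp 0)).
    assert (Hk0 : 0 <= k 0) by (apply Hk; lra).
    assert (HH0 : 0 <= H) by exact (bounded_by_nonneg _ _ HH).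
    set (X := exp (rate k LG * T1)).
    assert (HX : 0 < X) by apply exp_pos.
    (* [Q] adds up all coefficients in the bound of [winterp_error], so that [Q * (dz n + dt n)]
       dominates it. *)
    set (Q := (H * k 0 + 2 * Lz + sp) * X + 2 * Lz + sp).
    assert (HHk : 0 <= H * k 0) by now apply Rmult_le_pos.
    assert (HQ : 0 <= Q) by (unfold Q; nra).
    assert (Hconv : forall eps, 0 < eps -> exists N, forall n, (N <= n)%nat ->
      forall z t, 0 <= t <= T -> Rabs (winterp Phi V y0 alpha (dt n) (dz n) z t - W z t) < eps).
    { intros eps Heps.
      (* The minimum with 1 ensures [dt n < 1], hence [t <= T1 - dt n]; the 2 accounts for the two
         mesh sizes. *)
      assert (He : 0 < Rmin 1 (eps / (2 * (Q + 1)))).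
      { apply Rmin_glb_lt; [lra|apply Rdiv_lt_0_compat; lra]. }
      apply is_lim_seq_spec in Ldt. apply is_lim_seq_spec in Ldz.
      destruct (Ldt (mkposreal _ He)) as [N1 HN1]. destruct (Ldz (mkposreal _ He)) as [N2 HN2].
      simpl in HN1, HN2. exists (N1 + N2)%nat. intros n Hn z t Ht.
      specialize (HN1 n ltac:(lia)). specialize (HN2 n ltac:(lia)).
      pose proof (Hdt n) as Hdtn. pose proof (Hdz n) as Hdzn.
      rewrite Rminus_0_r, Rabs_pos_eq in HN1, HN2 by lra.
      pose proof (Rmin_l 1 (eps / (2 * (Q + 1)))) as M1.
      pose proof (Rmin_r 1 (eps / (2 * (Q + 1)))) as M2.
      pose proof (winterp_error Phi V y0 alpha (dt n) (dz n) H LG HG hPhi hVC1 hVdec halpha Hdtn Hdzn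
        Hy0 HH hy0ge (HCFL n) HLG HHG L0 T1 Wm Hw0 HWm z t (proj1 Ht) ltac:(unfold T1; lra)) as B.
      fold k w0 W Lz sp X in B.
      eapply Rle_lt_trans; [exact B|].
      apply Rle_lt_trans with (Q * (dz n + dt n)).
      - assert (A1 : 0 <= (H * k 0 + 2 * Lz) * X * dt n) by (apply Rmult_le_pos; nra).
        assert (A2 : 0 <= sp * X * dz n) by (apply Rmult_le_pos; nra).
        assert (A3 : 0 <= 2 * Lz * dt n) by nra.
        assert (A4 : 0 <= sp * dz n) by nra.
        unfold Q. lra.
      - apply Rle_lt_trans with (Q * (2 * (eps / (2 * (Q + 1))))).
        + apply Rmult_le_compat_l; lra.
        + apply Rlt_le_trans with ((Q + 1) * (2 * (eps / (2 * (Q + 1))))); [|right; field; lra].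
          apply Rmult_lt_compat_r; [|lra].
          apply Rmult_lt_0_compat; [lra|]. apply Rdiv_lt_0_compat; lra. }
    (* The lower bound passes from the scheme to its limit; with it the truncated flux coincides
       with [Wf V] along [W]. *)
    assert (HW1 : forall z t, 0 <= t <= T -> 1 <= W z t).
    { intros z t Ht. apply le_of_forall_eps. intros eps Heps.
      destruct (Hconv eps Heps) as [N HN]. specialize (HN N ltac:(lia) z t Ht).
      pose proof (winterp_ge_1 Phi V y0 alpha (dt N) (dz N) H HG hPhi hVC1 hVdec halpha
        (Hdt N) (Hdz N) Hy0 HH hy0ge (HCFL N) HHG z t (proj1 Ht)) as B.
      apply Rabs_lt_between in HN. lra. }
    exists W. split; [|split; [|split]].
    + exists (Lz + sp). intros z z' t t' Ht Ht'.
      pose proof (HLz t ltac:(unfold T1; lra) z z') as A. pose proof (Hsp z' t t') as B.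
      pose proof (Rabs_triang (W z t - W z' t) (W z' t - W z' t')) as C.
      replace (W z t - W z' t + (W z' t - W z' t')) with (W z t - W z' t') in C by ring.
      pose proof (Rabs_pos (z - z')). pose proof (Rabs_pos (t - t')). cbv beta in A. nra.
    + intros K _ eps Heps. destruct (Hconv eps Heps) as [N HN]. exists N.
      intros n Hn z t _ Ht. now apply HN.
    + intros phi Hphi.
      rewrite <- (fixpoint_weak k (flux V) w0 LG HG L0 W Hk HLG HHG Hreg Hfix phi T hT Hphi).
      apply RInt_ext. intros t Ht. rewrite Rmin_left, Rmax_right in Ht by lra.
      f_equal. apply functional_extensionality. intros z.
      rewrite avg_Wf_flux; [easy|]. intros; apply HW1; lra.
    + intros z. exact (evol_initial k (flux V) w0 LG HG L0 Hk HLG HHG Hw0 z 0 (Rle_refl 0)).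
  - intros w1 w2 [L1 H1] [L2 H2] Hge1 Hge2 Hs1 Hs2 Hinit z t Ht.
    destruct (lipschitz_strip_clamp T w1 L1 hT H1) as [A1 B1].
    destruct (lipschitz_strip_clamp T w2 L2 hT H2) as [A2 B2].
    pose proof (Rmax_l L1 L2) as M1. pose proof (Rmax_r L1 L2) as M2.
    rewrite <- (clamp_id T t Ht).
    apply (weak_unique k (flux V) LG HG (Rmax L1 L2) T
      (fun z t => w1 z (clamp T t)) (fun z t => w2 z (clamp T t)) Hk HLG HHG hT).
    + intros s. exact (Lip_le _ _ _ M1 (A1 s)).
    + intros x. exact (Lip_le _ _ _ M1 (B1 x)).
    + intros s. exact (Lip_le _ _ _ M2 (A2 s)).
    + intros x. exact (Lip_le _ _ _ M2 (B2 x)).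
    + exact (weak_sol_clamp Phi V alpha T w1 hT Hge1 Hs1).
    + exact (weak_sol_clamp Phi V alpha T w2 hT Hge2 Hs2).
    + intros x. rewrite clamp_id by lra. apply Hinit.
    + easy.
Qed.
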